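(* Let $\mathfrak h$ be a complex vector space of dimension $l$, $G\subset\mathrm{GL}(\mathfrak h)$ a finite subgroup, and $c$ a conjugation-invariant complex function on the set $\mathcal S$ of complex reflections of $G$. Let $U\subset M_c(\mathbb C)=\mathbb C[\mathfrak h]$ be a $G$-subrepresentation of dimension $l=\dim\mathfrak h$, sitting in degree $r$, which consists of singular vectors. Let $J=\langle U\rangle$ be the submodule generated by $U$, and assume that $A=M_c(\mathbb C)/J$ is finite-dimensional. Then: (i) $A$ is a Frobenius algebra. (ii) $A$ admits a BGG type resolution by $H_{1,c}(G,\mathfrak h)$-modules $$A\leftarrow M_c(\mathbb C)\leftarrow M_c(U)\leftarrow M_c(\wedge^2U)\leftarrow\cdots\leftarrow M_c(\wedge^lU)\leftarrow0 .$$ (iii) The character of $A$ is $$\chi_A(g,t)=t^{\frac l2-\sum_{s\in\mathcal S}\frac{2c_s}{1-\lambda_s}}\,\frac{\det_U(1-gt^r)}{\det_{\mathfrak h^*}(1-gt)},$$ and in particular $\dim A=r^l$. (iv) If $G$ preserves an inner product on $\mathfrak h$, then $A$ is irreducible.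
   Context: A complex reflection is a semisimple $s\in\mathrm{GL}(\mathfrak h)$ with $\operatorname{rank}(1-s)=1$. For $s\in\mathcal S$, $\alpha_s\in\mathfrak h^*$ satisfies $s\alpha_s=\lambda_s\alpha_s$, $\lambda_s\ne1$, and $\alpha_s^\vee\in\mathfrak h$ satisfies $s\alpha_s^\vee=\lambda_s^{-1}\alpha_s^\vee$, $\langle\alpha_s,\alpha_s^\vee\rangle=2$. $H_{1,c}(G,\mathfrak h)$ is the quotient of $\mathbb CG\ltimes\mathbf T(\mathfrak h\oplus\mathfrak h^* )$ by $[x,x']=0$, $[y,y']=0$, $[y,x]=(y,x)-\sum_{s\in\mathcal S}c_s(y,\alpha_s)(x,\alpha_s^\vee)s$. For a finite-dimensional $G$-representation $\tau$, $M_c(\tau)=H_{1,c}(G,\mathfrak h)\otimes_{\mathbb CG\ltimes S\mathfrak h}\tau$ with $\mathfrak h$ acting on $\tau$ by $0$; $M_c(\mathbb C)=\mathbb C[\mathfrak h]$ is the case of the trivial representation. A vector is singular if it is killed by all $y\in\mathfrak h$. Submodules of $\mathbb C[\mathfrak h]$ are ideals, so $A$ is a graded commutative algebra; it is called Frobenius if its top-degree component $A[d]$ is $1$-dimensional and multiplication $A[m]\times A[d-m]\to A[d]$ is a nondegenerate pairing for $0\le m\le d$. The character is $\chi_A(g,t)=\mathrm{Tr}_A(gt^{\mathbf h})$ where $\mathbf h=\sum_ix_iy_i+\frac12\dim\mathfrak h-\sum_{s\in\mathcal S}\frac{2c_s}{1-\lambda_s}s$ ($y_i$ a basis of $\mathfrak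 h$, $x_i$ the dual basis). ''Inner product'' means a nondegenerate symmetric bilinear form. ''Resolution'' means the displayed complex is exact and its maps are $H_{1,c}(G,\mathfrak h)$-homomorphisms.
   Formalization: Parts (i) and (iv) assume r > 0: for l = 1, r = 0 and U the constants, A = 0 is neither Frobenius nor irreducible; the character formula is read for real t > 0 with nonzero denominator. *)

(* Defs.v *)
From HB Require Import structures.
From mathcomp Require Import all_boot all_order all_algebra all_fingroup all_character.
From mathcomp Require Import complex.
From mathcomp Require Import boolp classical_sets reals sequences exp trigo.
From mathcomp Require Import mpoly generic_quotient.

Set Implicit Arguments.
Unset Strict Implicit.
Unset Printing Implicit Defensive.

Import Order.TTheory GRing.Theory Num.Theory.

Local Open Scope quotient_scope.
Local Open Scope complex_scope.
Local Open Scope ring_scope.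

(* [palg rel]: the associative unital K-algebra with generators X and defining
   relations rel, as the quotient of formal expressions by the least congruence
   containing rel and the algebra axioms. It is only a pzRingType: 1 <> 0 is not
   known a priori. *)
Section PresentedAlgebra.
Variables (K : comPzRingType) (X : Type).

Inductive aterm :=
  | AGen of X
  | ACst of K
  | AAdd of aterm & aterm
  | AMul of aterm & aterm.

HB.instance Definition _ := gen_eqMixin aterm.
HB.instance Definition _ := gen_choiceMixin aterm.

Variable rel : aterm -> aterm -> Prop.

Inductive acong : aterm -> aterm -> Prop :=
  | ac_rel a b : rel a b -> acong a b
  | ac_refl a : acong a a
  | ac_sym a b : acong a b -> acong b a
  | ac_trans b a c : acong a b -> acong b c -> acong a c
  | ac_add a a' b b' : acong a a' -> acong b b' -> acong (AAdd a b) (AAdd a' b')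
  | ac_mul a a' b b' : acong a a' -> acong b b' -> acong (AMul a b) (AMul a' b')
  | ac_addA a b c : acong (AAdd a (AAdd b c)) (AAdd (AAdd a b) c)
  | ac_addC a b : acong (AAdd a b) (AAdd b a)
  | ac_add0 a : acong (AAdd (ACst 0) a) a
  | ac_addN a : acong (AAdd (AMul (ACst (-1)) a) a) (ACst 0)
  | ac_mulA a b c : acong (AMul a (AMul b c)) (AMul (AMul a b) c)
  | ac_mul1l a : acong (AMul (ACst 1) a) a
  | ac_mulDl a b c : acong (AMul (AAdd a b) c) (AAdd (AMul a c) (AMul b c))
  | ac_mulDr a b c : acong (AMul a (AAdd b c)) (AAdd (AMul a b) (AMul a c))
  | ac_cstD k k' : acong (ACst (k + k')) (AAdd (ACst k) (ACst k'))
  | ac_cstM k k' : acong (ACst (k * k')) (AMul (ACst k) (ACst k'))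
  | ac_cstC k a : acong (AMul (ACst k) a) (AMul a (ACst k)).

Definition aequiv (a b : aterm) : bool := `[< acong a b >].

Fact aequiv_refl : reflexive aequiv.
Proof. by move=> a; apply/asboolP; apply: ac_refl. Qed.
Fact aequiv_sym : ssrbool.symmetric aequiv.
Proof. by move=> a b; apply/asboolP/asboolP; apply: ac_sym. Qed.
Fact aequiv_trans : transitive aequiv.
Proof.
by move=> b a c /asboolP ab /asboolP bc; apply/asboolP; apply: ac_trans ab bc.
Qed.
Canonical aequiv_equiv := EquivRel aequiv aequiv_refl aequiv_sym aequiv_trans.

Definition palg := {eq_quot aequiv}.
HB.instance Definition _ := Choice.on palg.
HB.instance Definition _ := EqQuotient.on palg.

Definition pgen (x : X) : palg := \pi_palg (AGen x).
Definition pcst (k : K) : palg := \pi_palg (ACst k).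

Lemma palg_eqP a b : reflect (acong a b) (\pi_palg a == \pi_palg b).
Proof. by rewrite eqmodE; apply: asboolP. Qed.

Lemma palg_reprP a : acong (repr (\pi_palg a)) a.
Proof. by apply/palg_eqP; rewrite reprK. Qed.

Definition padd (p q : palg) : palg := \pi_palg (AAdd (repr p) (repr q)).
Definition pmul (p q : palg) : palg := \pi_palg (AMul (repr p) (repr q)).

Lemma padd_pi a b : padd (\pi_palg a) (\pi_palg b) = \pi_palg (AAdd a b).
Proof. by apply/eqP/palg_eqP; apply: ac_add; apply: palg_reprP. Qed.

Lemma pmul_pi a b : pmul (\pi_palg a) (\pi_palg b) = \pi_palg (AMul a b).
Proof. by apply/eqP/palg_eqP; apply: ac_mul; apply: palg_reprP. Qed.

Definition popp (p : palg) := pmul (pcst (-1)) p.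

Fact paddA : associative padd.
Proof.
elim/quotW=> a; elim/quotW=> b; elim/quotW=> c.
rewrite (padd_pi b c) (padd_pi a b) !padd_pi.
by apply/eqP/palg_eqP; apply: ac_addA.
Qed.
Fact paddC : commutative padd.
Proof.
elim/quotW=> a; elim/quotW=> b; rewrite !padd_pi.
by apply/eqP/palg_eqP; apply: ac_addC.
Qed.
Fact padd0 : left_id (pcst 0) padd.
Proof.
by elim/quotW=> a; rewrite padd_pi; apply/eqP/palg_eqP; apply: ac_add0.
Qed.
Fact paddN : left_inverse (pcst 0) popp padd.
Proof.
elim/quotW=> a; rewrite /popp (pmul_pi (ACst (-1)) a) padd_pi.
by apply/eqP/palg_eqP; apply: ac_addN.
Qed.
HB.instance Definition _ :=
  GRing.isZmodule.Build palg paddA paddC padd0 paddN.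

Fact pmulA : associative pmul.
Proof.
elim/quotW=> a; elim/quotW=> b; elim/quotW=> c.
rewrite (pmul_pi b c) (pmul_pi a b) !pmul_pi.
by apply/eqP/palg_eqP; apply: ac_mulA.
Qed.
Fact pmul1l : left_id (pcst 1) pmul.
Proof.
by elim/quotW=> a; rewrite pmul_pi; apply/eqP/palg_eqP; apply: ac_mul1l.
Qed.
Fact pmul1r : right_id (pcst 1) pmul.
Proof.
elim/quotW=> a; rewrite pmul_pi; apply/eqP/palg_eqP.
by apply: ac_trans (ac_mul1l a); apply/ac_sym/ac_cstC.
Qed.
Fact pmulDl : left_distributive pmul padd.
Proof.
elim/quotW=> a; elim/quotW=> b; elim/quotW=> c.
rewrite (padd_pi a b) (pmul_pi a c) (pmul_pi b c) pmul_pi padd_pi.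
by apply/eqP/palg_eqP; apply: ac_mulDl.
Qed.
Fact pmulDr : right_distributive pmul padd.
Proof.
elim/quotW=> a; elim/quotW=> b; elim/quotW=> c.
rewrite (padd_pi b c) (pmul_pi a b) (pmul_pi a c) pmul_pi padd_pi.
by apply/eqP/palg_eqP; apply: ac_mulDr.
Qed.
HB.instance Definition _ :=
  GRing.Zmodule_isPzRing.Build palg pmulA pmul1l pmul1r pmulDl pmulDr.

End PresentedAlgebra.

Arguments ACst {K X}.
Arguments AGen {K X}.

(* [pmod rel]: the left R-module with generators X and defining relations rel. *)
Section PresentedModule.
Variables (R : pzRingType) (X : Type).

Inductive mterm :=
  | MGen of X
  | MZero
  | MAdd of mterm & mterm
  | MScale of R & mterm.

HB.instance Definition _ := gen_eqMixin mterm.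
HB.instance Definition _ := gen_choiceMixin mterm.

Variable rel : mterm -> mterm -> Prop.

Inductive mcong : mterm -> mterm -> Prop :=
  | mc_rel a b : rel a b -> mcong a b
  | mc_refl a : mcong a a
  | mc_sym a b : mcong a b -> mcong b a
  | mc_trans b a c : mcong a b -> mcong b c -> mcong a c
  | mc_add a a' b b' : mcong a a' -> mcong b b' -> mcong (MAdd a b) (MAdd a' b')
  | mc_scale h a a' : mcong a a' -> mcong (MScale h a) (MScale h a')
  | mc_addA a b c : mcong (MAdd a (MAdd b c)) (MAdd (MAdd a b) c)
  | mc_addC a b : mcong (MAdd a b) (MAdd b a)
  | mc_add0 a : mcong (MAdd MZero a) a
  | mc_addN a : mcong (MAdd (MScale (-1) a) a) MZero
  | mc_scaleA h k a : mcong (MScale h (MScale k a)) (MScale (h * k) a)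
  | mc_scale1 a : mcong (MScale 1 a) a
  | mc_scaleDr h a b : mcong (MScale h (MAdd a b)) (MAdd (MScale h a) (MScale h b))
  | mc_scaleDl h k a : mcong (MScale (h + k) a) (MAdd (MScale h a) (MScale k a)).

Definition mequiv (a b : mterm) : bool := `[< mcong a b >].

Fact mequiv_refl : reflexive mequiv.
Proof. by move=> a; apply/asboolP; apply: mc_refl. Qed.
Fact mequiv_sym : ssrbool.symmetric mequiv.
Proof. by move=> a b; apply/asboolP/asboolP; apply: mc_sym. Qed.
Fact mequiv_trans : transitive mequiv.
Proof.
by move=> b a c /asboolP ab /asboolP bc; apply/asboolP; apply: mc_trans ab bc.
Qed.
Canonical mequiv_equiv := EquivRel mequiv mequiv_refl mequiv_sym mequiv_trans.

Definition pmod := {eq_quot mequiv}.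
HB.instance Definition _ := Choice.on pmod.
HB.instance Definition _ := EqQuotient.on pmod.

Definition mgen (x : X) : pmod := \pi_pmod (MGen x).

Lemma pmod_eqP a b : reflect (mcong a b) (\pi_pmod a == \pi_pmod b).
Proof. by rewrite eqmodE; apply: asboolP. Qed.

Lemma pmod_reprP a : mcong (repr (\pi_pmod a)) a.
Proof. by apply/pmod_eqP; rewrite reprK. Qed.

Definition madd (p q : pmod) : pmod := \pi_pmod (MAdd (repr p) (repr q)).
Definition mscale (h : R) (q : pmod) : pmod := \pi_pmod (MScale h (repr q)).

Lemma madd_pi a b : madd (\pi_pmod a) (\pi_pmod b) = \pi_pmod (MAdd a b).
Proof. by apply/eqP/pmod_eqP; apply: mc_add; apply: pmod_reprP. Qed.

Lemma mscale_pi h a : mscale h (\pi_pmod a) = \pi_pmod (MScale h a).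
Proof. by apply/eqP/pmod_eqP; apply: mc_scale; apply: pmod_reprP. Qed.

Fact maddA : associative madd.
Proof.
elim/quotW=> a; elim/quotW=> b; elim/quotW=> c.
rewrite (madd_pi b c) (madd_pi a b) !madd_pi.
by apply/eqP/pmod_eqP; apply: mc_addA.
Qed.
Fact maddC : commutative madd.
Proof.
elim/quotW=> a; elim/quotW=> b; rewrite !madd_pi.
by apply/eqP/pmod_eqP; apply: mc_addC.
Qed.
Fact madd0 : left_id (\pi_pmod MZero) madd.
Proof.
by elim/quotW=> a; rewrite madd_pi; apply/eqP/pmod_eqP; apply: mc_add0.
Qed.
Fact maddN : left_inverse (\pi_pmod MZero) (mscale (-1)) madd.
Proof.
elim/quotW=> a; rewrite (mscale_pi (-1) a) madd_pi.
by apply/eqP/pmod_eqP; apply: mc_addN.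
Qed.
HB.instance Definition _ :=
  GRing.isZmodule.Build pmod maddA maddC madd0 maddN.

Fact mscaleA h k v : mscale h (mscale k v) = mscale (h * k) v.
Proof.
elim/quotW: v => a; rewrite (mscale_pi k a) !mscale_pi.
by apply/eqP/pmod_eqP; apply: mc_scaleA.
Qed.
Fact mscale1 : left_id 1 mscale.
Proof.
by elim/quotW=> a; rewrite mscale_pi; apply/eqP/pmod_eqP; apply: mc_scale1.
Qed.
Fact mscaleDr : right_distributive mscale madd.
Proof.
move=> h; elim/quotW=> a; elim/quotW=> b.
rewrite (madd_pi a b) (mscale_pi h a) (mscale_pi h b) mscale_pi madd_pi.
by apply/eqP/pmod_eqP; apply: mc_scaleDr.
Qed.
Fact mscaleDl v : {morph mscale^~ v : h k / h + k >-> madd h k}.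
Proof.
move=> h k; elim/quotW: v => a.
rewrite (mscale_pi h a) (mscale_pi k a) mscale_pi madd_pi.
by apply/eqP/pmod_eqP; apply: mc_scaleDl.
Qed.
HB.instance Definition _ :=
  GRing.Zmodule_isLmodule.Build R pmod mscaleA mscale1 mscaleDr mscaleDl.

Variable V : lmodType R.

Fixpoint meval (f : X -> V) (a : mterm) : V :=
  match a with
  | MGen x => f x
  | MZero => 0
  | MAdd a b => meval f a + meval f b
  | MScale h a => h *: meval f a
  end.

(* The linear map induced by f; meaningful when f respects the relations. *)
Definition mlift (f : X -> V) (q : pmod) : V := meval f (repr q).

Definition mrespects (f : X -> V) :=
  forall a b, rel a b -> meval f a = meval f b.

Lemma mlift_pi f a : mrespects f -> mlift f (\pi_pmod a) = meval f a.
Proof.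
move=> fP; have : mcong (repr (\pi_pmod a)) a by exact: pmod_reprP.
rewrite /mlift; move: (repr _) => b; elim=> //=.
- by move=> ? ? ? _ -> _ ->.
- by move=> ? ? ? ? _ -> _ ->.
- by move=> ? ? ? _ ->.
- by move=> *; rewrite addrA.
- by move=> *; rewrite addrC.
- by move=> *; rewrite add0r.
- by move=> *; rewrite scaleN1r addNr.
- by move=> *; rewrite scalerA.
- by move=> *; rewrite scale1r.
- by move=> *; rewrite scalerDr.
- by move=> *; rewrite scalerDl.
Qed.

Lemma mlift_gen f x : mrespects f -> mlift f (mgen x) = f x.
Proof. exact: mlift_pi. Qed.

End PresentedModule.

Arguments MZero {R X}.
Arguments MGen {R X}.

Section QuotientModule.
Variables (R : pzRingType) (V : lmodType R) (S : V -> Prop).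

Inductive span_sub : V -> Prop :=
  | ss_gen v : S v -> span_sub v
  | ss_zero : span_sub 0
  | ss_add v w : span_sub v -> span_sub w -> span_sub (v + w)
  | ss_scale h v : span_sub v -> span_sub (h *: v).

Definition sub_equiv (v w : V) : bool := `[< span_sub (v - w) >].

Fact sub_equiv_refl : reflexive sub_equiv.
Proof. by move=> v; apply/asboolP; rewrite subrr; apply: ss_zero. Qed.
Fact sub_equiv_sym : ssrbool.symmetric sub_equiv.
Proof.
suff H v w : span_sub (v - w) -> span_sub (w - v).
  by move=> v w; apply/asboolP/asboolP; apply: H.
by move=> /(ss_scale (-1)); rewrite scaleN1r opprB.
Qed.
Fact sub_equiv_trans : transitive sub_equiv.
Proof.
move=> w v z /asboolP vw /asboolP wz; apply/asboolP.
by rewrite -(subrKA w); apply: ss_add.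
Qed.
Canonical sub_equiv_equiv :=
  EquivRel sub_equiv sub_equiv_refl sub_equiv_sym sub_equiv_trans.

(* The quotient of V by the submodule generated by S. *)
Definition qmod := {eq_quot sub_equiv}.
HB.instance Definition _ := Choice.on qmod.
HB.instance Definition _ := EqQuotient.on qmod.

Lemma qmod_eqP v w : reflect (span_sub (v - w)) (\pi_qmod v == \pi_qmod w).
Proof. by rewrite eqmodE; apply: asboolP. Qed.

Lemma qmod_reprP v : span_sub (repr (\pi_qmod v) - v).
Proof. by apply/qmod_eqP; rewrite reprK. Qed.

Definition qadd (p q : qmod) : qmod := \pi_qmod (repr p + repr q).
Definition qscale (h : R) (q : qmod) : qmod := \pi_qmod (h *: repr q).

Lemma qadd_pi v w : qadd (\pi_qmod v) (\pi_qmod w) = \pi_qmod (v + w).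
Proof.
by apply/eqP/qmod_eqP; rewrite opprD addrACA; apply: ss_add; apply: qmod_reprP.
Qed.

Lemma qscale_pi h v : qscale h (\pi_qmod v) = \pi_qmod (h *: v).
Proof.
by apply/eqP/qmod_eqP; rewrite -scalerBr; apply: ss_scale; apply: qmod_reprP.
Qed.

Fact qaddA : associative qadd.
Proof.
elim/quotW=> a; elim/quotW=> b; elim/quotW=> c.
by rewrite (qadd_pi b c) (qadd_pi a b) !qadd_pi addrA.
Qed.
Fact qaddC : commutative qadd.
Proof. by elim/quotW=> a; elim/quotW=> b; rewrite !qadd_pi addrC. Qed.
Fact qadd0 : left_id (\pi_qmod 0) qadd.
Proof. by elim/quotW=> a; rewrite qadd_pi add0r. Qed.
Fact qaddN : left_inverse (\pi_qmod 0) (qscale (-1)) qadd.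
Proof. by elim/quotW=> a; rewrite (qscale_pi (-1) a) qadd_pi scaleN1r addNr. Qed.
HB.instance Definition _ :=
  GRing.isZmodule.Build qmod qaddA qaddC qadd0 qaddN.

Fact qscaleA h k v : qscale h (qscale k v) = qscale (h * k) v.
Proof. by elim/quotW: v => a; rewrite (qscale_pi k a) !qscale_pi scalerA. Qed.
Fact qscale1 : left_id 1 qscale.
Proof. by elim/quotW=> a; rewrite qscale_pi scale1r. Qed.
Fact qscaleDr : right_distributive qscale qadd.
Proof.
move=> h; elim/quotW=> a; elim/quotW=> b.
by rewrite (qadd_pi a b) (qscale_pi h a) (qscale_pi h b) qscale_pi qadd_pi scalerDr.
Qed.
Fact qscaleDl v : {morph qscale^~ v : h k / h + k >-> qadd h k}.
Proof.
move=> h k; elim/quotW: v => a.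
by rewrite (qscale_pi h a) (qscale_pi k a) qscale_pi qadd_pi scalerDl.
Qed.
HB.instance Definition _ :=
  GRing.Zmodule_isLmodule.Build R qmod qscaleA qscale1 qscaleDr qscaleDl.

End QuotientModule.

Section ExteriorPower.
Variables (K : comPzRingType) (U : lmodType K) (k : nat).

Definition upd (w : {ffun 'I_k -> U}) (i : 'I_k) (x : U) : {ffun 'I_k -> U} :=
  [ffun j => if j == i then x else w j].

Inductive ext_rel :
    mterm K {ffun 'I_k -> U} -> mterm K {ffun 'I_k -> U} -> Prop :=
  | ext_multilinear (w : {ffun 'I_k -> U}) i a x y :
      ext_rel (MGen (upd w i (a *: x + y)))
              (MAdd (MScale a (MGen (upd w i x))) (MGen (upd w i y)))
  | ext_alternating (w : {ffun 'I_k -> U}) i j :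
      i != j -> w i = w j -> ext_rel (MGen w) MZero.

Definition ext_power : lmodType K := pmod ext_rel.

Definition wedge (w : {ffun 'I_k -> U}) : ext_power := mgen ext_rel w.

Definition ext_map (f : U -> U) : ext_power -> ext_power :=
  mlift (fun w : {ffun 'I_k -> U} => wedge [ffun i => f (w i)]).

Lemma ext_map_wedge (f : {linear U -> U}) w :
  ext_map f (wedge w) = wedge [ffun i => f (w i)].
Proof.
apply: mlift_gen => _ _ [w' i a x y|w' i j ij wij] /=.
  have updE z : [ffun j => f (upd w' i z j)] = upd [ffun j => f (w' j)] i (f z).
    by apply/ffunP=> j; rewrite !ffunE; case: eqP.
  rewrite !updE linearP.
  have -> : a *: wedge (upd [ffun j => f (w' j)] i (f x)) =
            \pi_(pmod ext_rel) (MScale a (MGen (upd [ffun j => f (w' j)] i (f x)))).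
    exact: mscale_pi.
  rewrite [RHS](madd_pi ext_rel _ (MGen _)).
  by apply/eqP/pmod_eqP/mc_rel/ext_multilinear.
apply/eqP/pmod_eqP/mc_rel/(ext_alternating ij).
by rewrite !ffunE wij.
Qed.

End ExteriorPower.

(* We take 𝔥 = 'cV_l, with g acting by y |-> crep g *m y, and 𝔥* = 'rV_l, with
   g acting by x |-> x *m crep g^-1; the pairing (y, x) is the entry of x *m y. *)
Definition pair (K : pzRingType) l (x : 'rV[K]_l) (y : 'cV[K]_l) : K :=
  (x *m y) 0 0.

Definition complex_reflection (K : fieldType) l (M : 'M[K]_l) : bool :=
  `[< diagonalizable M >] && (\rank (1%:M - M) == 1%N).

(* A finite subgroup of GL(𝔥), given as a finite group with a faithful matrix
   representation, with the parameter c and a choice of λ_s, α_s, α_s^∨. The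
   values of c, λ, α, α^∨ outside the complex reflections are irrelevant. *)
Record cherednik_datum (R : realType) (l : nat) := CherednikDatum {
  cgroup :> finGroupType;
  crep : mx_representation R[i] [set: cgroup] l;
  crep_faithful : mx_faithful crep;
  cparam : cgroup -> R[i];
  cparam_conj : forall g s, complex_reflection (crep s) ->
    cparam (s ^ g)%g = cparam s;
  clam : cgroup -> R[i];
  calpha : cgroup -> 'rV[R[i]]_l;
  calphav : cgroup -> 'cV[R[i]]_l;
  clam_neq1 : forall s, complex_reflection (crep s) -> clam s != 1;
  calphaE : forall s, complex_reflection (crep s) ->
    calpha s *m crep (s^-1)%g = clam s *: calpha s;
  calphavE : forall s, complex_reflection (crep s) ->
    crep s *m calphav s = (clam s)^-1 *: calphav s;
  cpair2 : forall s, complex_reflection (crep s) ->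
    pair (calpha s) (calphav s) = 2
}.

Section CherednikAlgebra.
Variables (R : realType) (l : nat) (D : cherednik_datum R l).
Local Notation C := R[i].
Local Notation refl := (fun s : D => complex_reflection (crep D s)).

Inductive cgen := CG of D | CX of 'rV[C]_l | CY of 'cV[C]_l.

Local Notation tm := (aterm C cgen).
Local Notation "'[g' a ]" := (AGen (CG a) : tm).
Local Notation "'[x' a ]" := (AGen (CX a) : tm).
Local Notation "'[y' a ]" := (AGen (CY a) : tm).
Local Notation "a ⊕ b" := (AAdd a b) (at level 50, left associativity).
Local Notation "a ⊗ b" := (AMul a b) (at level 40, left associativity).
Local Notation cst := (@ACst C cgen).

(* The relations before cr_xx present CG ⋉ T(𝔥 ⊕ 𝔥^* ). *)
Inductive crel : tm -> tm -> Prop :=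
  | cr_one : crel [g 1%g] (cst 1)
  | cr_mul g h : crel [g (g * h)%g] ([g g] ⊗ [g h])
  | cr_xlin a x x' : crel [x (a *: x + x')] (cst a ⊗ [x x] ⊕ [x x'])
  | cr_ylin a y y' : crel [y (a *: y + y')] (cst a ⊗ [y y] ⊕ [y y'])
  | cr_gx g x : crel ([g g] ⊗ [x x]) ([x (x *m crep D (g^-1)%g)] ⊗ [g g])
  | cr_gy g y : crel ([g g] ⊗ [y y]) ([y (crep D g *m y)] ⊗ [g g])
  | cr_xx x x' : crel ([x x] ⊗ [x x']) ([x x'] ⊗ [x x])
  | cr_yy y y' : crel ([y y] ⊗ [y y']) ([y y'] ⊗ [y y])
  | cr_yx y x :
      crel ([y y] ⊗ [x x] ⊕ cst (-1) ⊗ ([x x] ⊗ [y y]))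
           (cst (pair x y) ⊕ cst (-1) ⊗
             \big[@AAdd C cgen/cst 0]_(s : D | refl s)
               (cst (cparam s * pair (calpha s) y * pair x (calphav s)) ⊗ [g s])).

Definition cherednik : pzRingType := palg crel.

Definition hc (a : C) : cherednik := pcst crel a.
Definition hg (g : D) : cherednik := pgen crel (CG g).
Definition hx (x : 'rV[C]_l) : cherednik := pgen crel (CX x).
Definition hy (y : 'cV[C]_l) : cherednik := pgen crel (CY y).

Definition euler : cherednik :=
  \sum_(i < l) hx (delta_mx 0 i) * hy (delta_mx i 0) + hc (l%:R / 2)
  - \sum_(s : D | refl s) hc (2 * cparam s / (1 - clam s)) * hg s.

Section StandardModule.
Variables (T : lmodType C) (act : D -> T -> T).

Local Notation tt h v := (MGen (h, v) : mterm cherednik (cherednik * T)).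

(* H ⊗_B τ for B = CG ⋉ S𝔥: the subalgebra B is generated by C, G and 𝔥, so it
   suffices to balance the tensor product over these; 𝔥 acts on τ by 0. *)
Inductive tensor_rel :
    mterm cherednik (cherednik * T) -> mterm cherednik (cherednik * T) -> Prop :=
  | tr_left h h' v : tensor_rel (MScale h (tt h' v)) (tt (h * h') v)
  | tr_addl h h' v : tensor_rel (tt (h + h') v) (MAdd (tt h v) (tt h' v))
  | tr_addr h v v' : tensor_rel (tt h (v + v')) (MAdd (tt h v) (tt h v'))
  | tr_cst h a v : tensor_rel (tt (h * hc a) v) (tt h (a *: v))
  | tr_grp h g v : tensor_rel (tt (h * hg g) v) (tt h (act g v))
  | tr_y h y v : tensor_rel (tt (h * hy y) v) (tt h 0).

Definition standard : lmodType cherednik := pmod tensor_rel.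

Definition tens (h : cherednik) (v : T) : standard := mgen tensor_rel (h, v).

End StandardModule.

Definition standard_triv : lmodType cherednik :=
  standard (fun (_ : D) (v : C^o) => v).

(* f(x_1, ..., x_l) in H, with (x_i) the basis of 𝔥* dual to the standard one. *)
Definition hpoly (f : {mpoly C[l]}) : cherednik :=
  \sum_(m <- msupp f) hc f@_m * \prod_(i < l) hx (delta_mx 0 i) ^+ m i.

(* The identification C[𝔥] = M_c(C). *)
Definition poly_std (f : {mpoly C[l]}) : standard_triv :=
  hpoly f *: (tens (fun (_ : D) (v : C^o) => v) 1 1 : standard_triv).

Section Quotient.
Variable u : 'I_l -> {mpoly C[l]}.

(* A = M_c(C) / J, where J is the submodule generated by the span of the u_j. *)
Definition Aquot : lmodType cherednik :=
  qmod (fun v : standard_triv => exists j, v = poly_std (u j)).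

Definition Aproj (v : standard_triv) : Aquot := \pi_Aquot v.

(* The class of a polynomial; as J is an ideal, the product of A is
   Acls f * Acls g = Acls (f * g). *)
Definition Acls (f : {mpoly C[l]}) : Aquot := Aproj (poly_std f).

Definition Acomp (m : nat) (a : Aquot) : Prop :=
  exists2 f, f \is m.-homog & a = Acls f.

Definition frobenius : Prop := exists d : nat,
  [/\ exists w, [/\ Acomp d w, w <> 0 &
        forall a, Acomp d a -> exists z : C, a = hc z *: w],
      forall m a, (d < m)%N -> Acomp m a -> a = 0
    & forall m f, (m <= d)%N -> f \is m.-homog ->
        (forall g, g \is (d - m).-homog -> Acls (f * g) = 0) -> Acls f = 0].

Section Resolution.
Variable rU : D -> 'M[C]_l.

(* A, M_c(C), M_c(U), M_c(Λ^2 U), M_c(Λ^3 U), ... *)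
Definition bgg (n : nat) : lmodType cherednik :=
  match n with
  | 0 => Aquot
  | 1 => standard_triv
  | 2 => standard (fun (g : D) (v : 'cV[C]_l) => rU g *m v)
  | k.+3 => standard (fun (g : D) (w : ext_power 'cV[C]_l k.+2) =>
                        ext_map (mulmx (rU g)) w)
  end.

Definition bgg_resolution : Prop :=
  exists d : forall k, {linear bgg k.+1 -> bgg k},
  [/\ forall v : standard_triv, d 0%N v = Aproj v,
      forall a : bgg 0, exists v, d 0%N v = a,
      forall k, (k < l)%N -> forall v, d k v = 0 <-> exists w, d k.+1 w = v
    & injective (d l)].

End Resolution.

Section Basis.
Variables (n : nat) (e : 'I_n -> Aquot).

Definition Alin (z : 'cV[C]_n) : Aquot := \sum_(i < n) hc (z i 0) *: e i.

Definition Abasis : Prop := forall a, exists! z, a = Alin z.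

(* The matrix in the basis e of the action of h on A. *)
Definition Amx (h : cherednik) : 'M[C]_n :=
  \matrix_(i, j) xget 0 [set z | h *: e j = Alin z]%classic i 0.

End Basis.

Definition irreducible : Prop :=
  (exists a : Aquot, a <> 0) /\
  forall N : Aquot -> Prop,
    N 0 -> (forall a b, N a -> N b -> N (a + b)) ->
    (forall h a, N a -> N (h *: a)) ->
    (forall a, N a -> a = 0) \/ (forall a, N a).

End Quotient.

Definition dual_mx (g : D) : 'M[C]_l := (crep D (g^-1)%g)^T.

Definition lowest_weight : C :=
  l%:R / 2 - \sum_(s : D | refl s) 2 * cparam s / (1 - clam s).

Definition preserves_inner_product : Prop :=
  exists B : 'M[C]_l, [/\ B^T = B, B \in unitmx &
    forall g : D, (crep D g)^T *m B *m crep D g = B].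

End CherednikAlgebra.

(* t^z = exp (z ln t) for t > 0. *)
Definition cpow (R : realType) (t : R) (z : R[i]) : R[i] :=
  (expR (complex.Re z * ln t))%:C *
  (cos (complex.Im z * ln t) +i* sin (complex.Im z * ln t)).

(* T = t^M for a diagonalizable matrix M. *)
Definition is_mxpow (R : realType) n (t : R) (M T : 'M[R[i]]_n) : Prop :=
  exists (P : 'M[R[i]]_n) (d : 'rV[R[i]]_n),
  [/\ P \in unitmx, M = invmx P *m diag_mx d *m P &
      T = invmx P *m diag_mx (map_mx (cpow t) d) *m P].

(* Main.v *)
(* The singular space U = <u_1, ..., u_l> generates the ideal (u), and finiteness
   of A = C[h]/(u) puts a power of every variable in (u). The powers x_i^N form a
   regular sequence, and multiplication by an element of (u) is null-homotopic on
   the Koszul complex of u; peeling off the x_i^N one at a time therefore shows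
   that this complex is exact and that the socle of A embeds in that of
   C[h]/(x_i^N), which is a line. This gives the Frobenius property.

   All the modules M_c(/\^k U) sit inside one module C[h] (x) /\U on which y acts
   by Dunkl operators, and the Koszul differential is the contraction with u. It
   commutes with C[h] and with G, so commutation with y has to be checked on
   constants only; there the commutator is a Koszul cycle with coefficients of
   degree r - 1, hence zero by exactness, since boundaries have coefficients in
   (u). So the Koszul complex is the BGG resolution.

   For the character, the matrices of g on U and on h* are made triangular, and the
   traces of g on the graded pieces are followed while dividing C[h] by the u_j (or
   by linear forms) one at a time; the degree m part has Euler weight
   lowest_weight + m. At g = 1 this gives the dimension.

   If G preserves a form B on h, all its reflections have order 2 and B, its inverse
   and the Euler element form an sl2-triple E, F, h. The E-string through 1 shows
   that lowest_weight = -j with 2 j <= d, d being the top degree, and the F-string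
   through the socle vector w then reaches degree 0. As every nonzero submodule
   contains w, by the Frobenius property, A is irreducible. *)

Require Import Defs.
From HB Require Import structures.
From mathcomp Require Import all_boot all_order all_algebra all_fingroup all_character.
From mathcomp Require Import complex.
From mathcomp Require Import boolp classical_sets reals sequences exp trigo.
From mathcomp Require Import zify ring.
From mathcomp Require Import ssrcomplements mpoly generic_quotient.

Import Order.TTheory GRing.Theory Num.Theory.

Local Open Scope complex_scope.
Local Open Scope ring_scope.

Local Open Scope quotient_scope.

Set Implicit Arguments.
Unset Strict Implicit.
Unset Printing Implicit Defensive.

(** * A recursive model of the exterior algebra *)

(** All algebras and modules are given by generators and relations, so the size of M_c(T) is not
    known beforehand. Spanning comes from normal ordering; independence comes from the Dunkl
    operators, once they are checked to satisfy the relations of H. Only then do singular vectors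
    become polynomials and J the ideal (u).

    Two forms of Koszul exactness are needed. The descent along the x_i^N works for the full
    sequence u and says nothing about its tails, whose quotients are infinite-dimensional. Dividing
    by the u_j one at a time needs the tails, and exactness passes to them by induction on the
    degree of the coefficients, which is where r > 0 enters. The graded trace on C[h] itself is
    never computed: the u_j and the linear forms give two relations to the same unknown series,
    which is eliminated.

    The hypotheses allow r = 0. Independence of the u_j then forces l <= 1, and for l = 1 the
    quotient A is zero: resolution, character and dimension survive, while the Frobenius property
    and irreducibility fail, whence the condition r > 0 on these two. *)

Definition tl (T : Type) n (w : 'I_n.+1 -> T) : 'I_n -> T := fun i => w (lift ord0 i).

Section Exterior.
Variable R : comNzRingType.

(* [ext n] is the exterior algebra of R^n, a pair (a, b) in [ext n.+1] standing
   for a + e_0 /\ b with a, b free of the first basis vector e_0. Below, [cre w]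
   is w /\ _, [contr f] the contraction with the linear form f (the Koszul
   differential), [prj k] the projection to degree k, and [Lam G] the algebra map
   sending e_j to the vector G j. *)
Fixpoint ext (n : nat) : lmodType R :=
  if n is m.+1 then (ext m * ext m)%type else R^o.

Fixpoint vac n (a : R) : ext n :=
  match n with 0 => a | m.+1 => (vac m a, 0) end.

Fixpoint cre n : ('I_n -> R) -> ext n -> ext n :=
  match n with
  | 0 => fun _ _ => 0
  | m.+1 => fun w z =>
    (cre (tl w) z.1, w ord0 *: z.1 - cre (tl w) z.2)
  end.

Fixpoint contr n : ('I_n -> R) -> ext n -> ext n :=
  match n with
  | 0 => fun _ _ => 0
  | m.+1 => fun f z =>
    (contr (tl f) z.1 + f ord0 *: z.2, - contr (tl f) z.2)
  end.

Fixpoint prj n k : ext n -> ext n :=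
  match n with
  | 0 => fun z => if k is 0 then z else 0
  | m.+1 => fun z =>
    (prj k z.1, if k is k'.+1 then prj k' z.2 else 0)
  end.

Arguments prj {n} k z.

Lemma creP n w : linear (@cre n w).
Proof.
elim: n w => [|n IH] w a x y /=; first by rewrite scaler0 addr0.
congr (_, _) => /=; first by rewrite IH.
by rewrite IH scalerDr !scalerA mulrC scalerBr !scalerA opprD addrACA.
Qed.
HB.instance Definition _ n w :=
  GRing.isLinear.Build R (ext n) (ext n) _ (@cre n w) (creP w).

Lemma contrP n f : linear (@contr n f).
Proof.
elim: n f => [|n IH] f a x y /=; first by rewrite scaler0 addr0.
congr (_, _) => /=; last by rewrite IH opprD scalerN.
by rewrite IH !scalerDr !scalerA (mulrC _ a) addrACA.
Qed.
HB.instance Definition _ n f :=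
  GRing.isLinear.Build R (ext n) (ext n) _ (@contr n f) (contrP f).

Lemma prjP n k : linear (@prj n k).
Proof.
elim: n k => [|n IH] [|k] a x y //=; first by rewrite scaler0 addr0.
  by congr (_, _) => /=; rewrite ?IH ?scaler0 ?addr0.
by congr (_, _) => /=; rewrite IH.
Qed.
HB.instance Definition _ n k :=
  GRing.isLinear.Build R (ext n) (ext n) _ (@prj n k) (@prjP n k).

Lemma vacP n : linear (@vac n : R^o -> ext n).
Proof.
by elim: n => //= n IH a x y; congr (_, _); rewrite ?IH //= scaler0 addr0.
Qed.
HB.instance Definition _ n :=
  GRing.isLinear.Build R R^o (ext n) _ (@vac n) (@vacP n).

Lemma vac_inj n : injective (@vac n).
Proof. by elim: n => //= n IH a b [] /IH. Qed.

Lemma vac0 n : vac n 0 = 0.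
Proof. by elim: n => //= n ->. Qed.

Lemma contr_vac n f a : @contr n f (vac n a) = 0.
Proof.
by elim: n f => //= n IH f; rewrite IH scaler0 addr0 linear0 oppr0.
Qed.

Lemma vacZ n a : vac n a = a *: vac n 1.
Proof.
elim: n => [|n IH] /=; first by rewrite /GRing.scale /= mulr1.
by rewrite IH; congr (_, _) => /=; rewrite scaler0. Qed.

Lemma cre_lin n w w' a (z : ext n) :
  cre (fun i => a * w i + w' i) z = a *: cre w z + cre w' z.
Proof.
elim: n w w' z => [|n IH] w w' z /=; first by rewrite scaler0 addr0.
congr (_, _); rewrite /tl IH //=.
by rewrite scalerDl scalerBr scalerA opprD addrACA.
Qed.

Lemma cre_sq n w (z : ext n) : cre w (cre w z) = 0.
Proof.
elim: n w z => //= n IH w z.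
by rewrite IH linearB linearZ /= IH subr0 subrr.
Qed.

(** Polarisation of [cre_sq]. *)
Lemma cre_anti n w w' (z : ext n) : cre w (cre w' z) = - cre w' (cre w z).
Proof.
apply/eqP; rewrite -addr_eq0; apply/eqP.
have := cre_sq (fun i => 1 * w i + w' i) z.
by rewrite cre_lin scale1r cre_lin scale1r !linearD /= !cre_sq add0r addr0.
Qed.

Lemma contr_sq n f (z : ext n) : contr f (contr f z) = 0.
Proof.
elim: n f z => //= n IH f z.
rewrite (linearD (contr _)) (linearZ_LR (contr _)) (linearN (contr _)) /= !IH.
by rewrite add0r scalerN subrr !oppr0.
Qed.

(** Contraction is an antiderivation. For fixed f this is the null-homotopy of multiplication by
    sum_i f_i w_i on the Koszul complex, the source of Koszul exactness below. *)
Lemma contr_cre n f w (z : ext n) :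
  contr f (cre w z) + cre w (contr f z) = (\sum_i f i * w i) *: z.
Proof.
elim: n f w z => [|n IH] f w z /=; first by rewrite big_ord0 scale0r addr0.
rewrite big_ord_recl !scalerDl; case: z => a b /=; congr (_, _) => /=.
  rewrite -(IH (tl f) (tl w)) (linearD (cre _)) (linearZ_LR (cre _)) /=.
  by rewrite scalerBr scalerA addrACA subrK addrC.
rewrite -(IH (tl f) (tl w)) (linearB (contr _)) (linearZ_LR (contr _)) /=.
rewrite scalerDr scalerA (linearN (cre _)) opprK opprB -(addrA (w ord0 *: _)).
by rewrite (addrA (_ - _)) subrK addrCA (mulrC (w ord0)).
Qed.

Lemma prj0_cre n w (z : ext n) : prj 0 (cre w z) = 0.
Proof. by elim: n w z => //= n IH w z; rewrite IH. Qed.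

Lemma prj_cre n k w (z : ext n) : prj k.+1 (cre w z) = cre w (prj k z).
Proof.
elim: n k w z => [|n IH] k w z //=.
rewrite (linearB (prj _)) (linearZ_LR (prj _)) /= IH.
case: k => [|k]; last by rewrite IH.
by rewrite prj0_cre (linear0 (cre _)).
Qed.

Lemma contr_prj0 n f (z : ext n) : contr f (prj 0 z) = 0.
Proof.
elim: n f z => //= n IH f z.
by rewrite IH scaler0 addr0 (linear0 (contr _)) oppr0.
Qed.

Lemma contr_prj n k f (z : ext n) : contr f (prj k.+1 z) = prj k (contr f z).
Proof.
elim: n k f z => [|n IH] k f z /=; first by case: k.
rewrite (linearD (prj _)) (linearZ_LR (prj _)) /= IH.
case: k => [|k]; last by rewrite (linearN (prj _)) /= IH.
by rewrite contr_prj0 oppr0.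
Qed.

Lemma prj_id n k (z : ext n) : prj k (prj k z) = prj k z.
Proof. by elim: n k z => [|n IH] [|k] z //=; rewrite !IH. Qed.

Lemma prj_vac n a : prj 0 (vac n a) = vac n a.
Proof. by elim: n a => //= n IH a; rewrite IH. Qed.

Lemma prj0P {n} (z : ext n) : exists a, prj 0 z = vac n a.
Proof.
elim: n z => [|n IH] z /=; first by exists z.
by have [a ->] := IH z.1; exists a.
Qed.

Lemma prj1P {n} (z : ext n) : exists w, prj 1 z = cre w (vac n 1).
Proof.
elim: n z => [|n IH] z /=; first by exists (fun=> 0).
have [w ->] := IH z.1; have [a ->] := prj0P z.2.
exists (fun i => if unlift ord0 i is Some j then w j else a).
have -> : tl (fun i => if unlift ord0 i is Some j then w j else a) = w.
  by apply/funext => i; rewrite /tl liftK.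
by rewrite unlift_none (linear0 (cre _)) subr0 (vacZ _ a).
Qed.

Lemma prj_gt n k (z : ext n) : (n < k)%N -> prj k z = 0.
Proof.
elim: n k z => [|n IH] [|k] z //= nk; rewrite !IH //.
exact: ltnW.
Qed.

Fixpoint vol n : ext n := match n with 0 => 1 | m.+1 => (0, vol m) end.

Lemma prj_volP {n} (z : ext n) : exists a, prj n z = a *: vol n.
Proof.
elim: n z => [|n IH] z /=; first by exists z; rewrite /GRing.scale /= mulr1.
have [a ->] := IH z.2; exists a; rewrite prj_gt //.
by congr (_, _) => /=; rewrite scaler0.
Qed.

Fixpoint Lam m n : ('I_m -> 'I_n -> R) -> ext m -> ext n :=
  match m with
  | 0 => fun _ z => vac n z
  | m'.+1 => fun G z => Lam (tl G) z.1 + cre (G ord0) (Lam (tl G) z.2)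
  end.

Lemma LamP m n G : linear (@Lam m n G).
Proof.
elim: m G => [|m IH] G a x y; first exact: vacP.
rewrite /= !IH (linearD (cre _)) (linearZ_LR (cre _)) /= scalerDr; exact: addrACA.
Qed.
HB.instance Definition _ m n G :=
  GRing.isLinear.Build R (ext m) (ext n) _ (@Lam m n G) (LamP G).

Lemma eq_Lam m n (G G' : 'I_m -> 'I_n -> R) z :
  (forall j i, G j i = G' j i) -> Lam G z = Lam G' z.
Proof. by move=> GG'; congr Lam; apply/funext => j; apply/funext => i. Qed.

Lemma eq_cre n (w w' : 'I_n -> R) z : w =1 w' -> cre w z = cre w' z.
Proof. by move=> /funext ->. Qed.

Lemma eq_contr n (w w' : 'I_n -> R) z : w =1 w' -> contr w z = contr w' z.
Proof. by move=> /funext ->. Qed.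

Lemma cre0 n (z : ext n) : cre (fun=> 0) z = 0.
Proof.
elim: n z => //= n IH z; rewrite scale0r.
by rewrite (_ : tl _ = fun=> 0) // !IH subrr.
Qed.

Lemma Lam_vac m n (G : 'I_m -> 'I_n -> R) a : Lam G (vac m a) = vac n a.
Proof. by elim: m G => //= m IH G; rewrite IH linear0 linear0 addr0. Qed.

Lemma Lam_cre m n (G : 'I_m -> 'I_n -> R) w z :
  Lam G (cre w z) = cre (fun i => \sum_j w j * G j i) (Lam G z).
Proof.
elim: m G w z => [|m IH] G w z /=.
  by rewrite vac0 -[LHS](cre0 (vac n z)); apply: eq_cre => i; rewrite big_ord0.
rewrite [RHS](@eq_cre _ _ (fun i => w ord0 * G ord0 i + \sum_j tl w j * tl G j i)); last first.
  by move=> i; rewrite big_ord_recl.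
rewrite cre_lin IH (linearB (Lam _)) (linearZ_LR (Lam _)) /= IH.
rewrite !(linearD (cre _)) (linearN (cre _)) (linearZ_LR (cre _)) /= cre_sq addr0.
by rewrite -cre_anti addrCA.
Qed.

(** Naturality: the form f is pulled back along G. In the inductive step [contr_cre] trades the
    contraction of the new vector [G ord0] for its pairing with f. *)
Lemma contr_Lam m n f (G : 'I_m -> 'I_n -> R) z :
  contr f (Lam G z) = Lam G (contr (fun j => \sum_i f i * G j i) z).
Proof.
elim: m G z => [|m IH] G z /=; first by rewrite contr_vac vac0.
rewrite (linearD (contr _)) (linearD (Lam _)) (linearN (Lam _)) (linearN (cre _)) /=.
rewrite (linearZ_LR (Lam _)) /= !IH -(contr_cre f (G ord0)) IH -addrA; congr (_ + _).
by rewrite addrK.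
Qed.

Lemma Lam_comp m n p (H : 'I_m -> 'I_n -> R) (G : 'I_n -> 'I_p -> R) z :
  Lam G (Lam H z) = Lam (fun j i => \sum_k H j k * G k i) z.
Proof.
elim: m H z => [|m IH] H z /=; first exact: Lam_vac.
by rewrite (linearD (Lam _)) /= Lam_cre !IH.
Qed.

(** Vectors without e_0 component generate inside the first summand; the induction for [Lam1] needs
    this. *)
Lemma Lam_lift m n (G : 'I_m -> 'I_n.+1 -> R) z : (forall j, G j ord0 = 0) ->
  Lam G z = (Lam (fun j => tl (G j)) z, 0).
Proof.
elim: m G z => [|m IH] G z G0 //=; rewrite !IH //= => [|j|j]; rewrite ?/tl ?G0 //.
by congr (_, _) => /=; rewrite scale0r (linear0 (cre _)) subrr addr0.
Qed.

Lemma Lam1 n (z : ext n) : Lam (fun j i => (j == i)%:R) z = z.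
Proof.
elim: n z => [|n IH] z //=; rewrite !Lam_lift //=.
rewrite (_ : (fun j : 'I_n => tl (tl _ j)) = (fun j i => (j == i)%:R)); last first.
  by apply/funext => j; apply/funext => i; rewrite /tl (inj_eq lift_inj).
rewrite !IH (_ : tl _ = fun=> 0) //; case: z => a b.
rewrite cre0 scale1r (linear0 (cre _)) subr0.
by congr (_, _) => /=; rewrite ?addr0 ?add0r.
Qed.

Lemma prj_Lam m n k (G : 'I_m -> 'I_n -> R) z : prj k (Lam G z) = Lam G (prj k z).
Proof.
elim: m k G z => [|m IH] k G z /=.
  case: k => [|k]; first exact: prj_vac.
  rewrite vac0; elim: n z {G} => [|n IH] //= z; rewrite IH.
  by case: k {IH} => [|k] //; rewrite (linear0 (prj _)).
rewrite linearD /= IH; case: k => [|k]; first by rewrite prj0_cre !linear0.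
by rewrite prj_cre IH.
Qed.

(** Coefficientwise membership. For an ideal Q it expresses vanishing modulo Q without a quotient
    ring; for a graded piece Q it says that the coefficients are homogeneous. *)
Fixpoint vals n (Q : R -> Prop) : ext n -> Prop :=
  match n with 0 => Q | m.+1 => fun z => vals Q z.1 /\ vals Q z.2 end.

End Exterior.

Section ExteriorMap.
Variables R R' : comNzRingType.

Fixpoint emap n (A : R -> R') : ext R n -> ext R' n :=
  match n with 0 => A | m.+1 => fun z => (emap A z.1, emap A z.2) end.

Lemma emapP n (A : {additive R -> R'}) : additive (@emap n A).
Proof.
elim: n => [|n IH] x y /=; first exact: raddfB.
by congr (_, _) => /=; rewrite IH.
Qed.
HB.instance Definition _ n (A : {additive R -> R'}) :=
  GRing.isZmodMorphism.Build (ext R n) (ext R' n) (@emap n A) (@emapP n A).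

Lemma eq_emap n (A B : R -> R') : A =1 B -> @emap n A =1 emap B.
Proof. by move=> /funext ->. Qed.

(** The pair A, B covers operators that are not ring morphisms: besides G and the scalar-linear
    operators, the projection to a degree, where multiplication by a homogeneous element turns A
    into the projection B to a lower degree. *)
Lemma emapZ n (A B : R -> R') c c' :
  (forall a, A (c * a) = c' * B a) ->
  forall z : ext R n, emap A (c *: z) = c' *: emap B z.
Proof. by move=> Ac; elim: n => [|n IH] z /=; [exact: Ac | rewrite !IH]. Qed.

Lemma emap_cre n (A : {additive R -> R'}) w w' :
  (forall i a, A (w i * a) = w' i * A a) ->
  forall z : ext R n, emap A (cre w z) = cre w' (emap A z).
Proof.
elim: n w w' => [|n IH] w w' Aw z /=; first exact: raddf0.
rewrite (raddfB (emap A)) /= (emapZ (Aw ord0)) !(IH _ (tl w')) // => i a; exact: Aw.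
Qed.

Lemma emap_contr n (A B : {additive R -> R'}) f f' :
  (forall i a, A (f i * a) = f' i * B a) ->
  forall z : ext R n, emap A (contr f z) = contr f' (emap B z).
Proof.
elim: n f f' => [|n IH] f f' Af z /=; first exact: raddf0.
rewrite (raddfD (emap A)) (raddfN (emap A)) /= (emapZ (Af ord0)) !(IH _ (tl f')) // => i a.
all: exact: Af.
Qed.

Lemma emap_vac n (A : {additive R -> R'}) a : emap A (vac n a) = vac n (A a).
Proof. by elim: n => //= n ->; rewrite raddf0. Qed.

Lemma emap_Lam m n (A : {additive R -> R'}) (G G' : 'I_m -> 'I_n -> _) :
  (forall j i a, A (G j i * a) = G' j i * A a) ->
  forall z : ext R m, emap A (Lam G z) = Lam G' (emap A z).
Proof.
elim: m G G' => [|m IH] G G' AG z /=; first exact: emap_vac.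
rewrite (raddfD (emap A)) /= (emap_cre (AG ord0)) !(IH _ (tl G')) // => j i a.
all: exact: AG.
Qed.

Lemma emap_prj n k (A : {additive R -> R'}) (z : ext R n) :
  emap A (prj k z) = prj k (emap A z).
Proof.
by elim: n k z => [|n IH] [|k] z //=; rewrite ?IH //= raddf0.
Qed.

End ExteriorMap.

Lemma emap_comp (R R' R'' : comNzRingType) n (A : R -> R') (B : R' -> R'') (z : ext R n) :
  emap B (emap A z) = emap (B \o A) z.
Proof. by elim: n z => //= n IH z; rewrite !IH. Qed.

Lemma emap_id (R : comNzRingType) n (z : ext R n) : emap id z = z.
Proof. by elim: n z => //= n IH [a b]; rewrite !IH. Qed.

(** * Koszul complexes of sequences containing a regular sequence in their ideal *)

Section Ideals.
Variable R : comNzRingType.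
Implicit Types (I : R -> Prop) (y : R).

Definition ideal I := [/\ I 0, forall a b, I a -> I b -> I (a + b)
  & forall a b, I b -> I (a * b)].

Definition addI I y : R -> Prop := fun f => exists a, I (f - a * y).

Lemma ideal_addI I y : ideal I -> ideal (addI I y).
Proof.
move=> [I0 ID IM]; split; first by exists 0; rewrite mul0r subr0.
  by move=> a b [c Ic] [d Id]; exists (c + d); rewrite mulrDl opprD addrACA; apply: ID.
by move=> a b [c Ic]; exists (a * c); rewrite -mulrA -mulrBr; apply: IM.
Qed.

Lemma ideal0 : ideal (fun f => f = 0).
Proof. by split=> // [a b -> ->|a b ->]; rewrite ?addr0 ?mulr0. Qed.

Variable I : R -> Prop.
Hypothesis Iid : ideal I.

Lemma vals0 n : vals I (0 : ext R n).
Proof. by elim: n => //=; case: Iid. Qed.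

Lemma valsD n (z z' : ext R n) : vals I z -> vals I z' -> vals I (z + z').
Proof.
elim: n z z' => [|n IH] /= z z'; first by case: Iid => _ + _; apply.
by move=> [? ?] [? ?]; split; apply: IH.
Qed.

Lemma valsZ n a (z : ext R n) : vals I z -> vals I (a *: z).
Proof.
elim: n z => [|n IH] /= z; first by case: Iid => _ _; apply.
by move=> [? ?]; split; apply: IH.
Qed.

Lemma vals_scale n a (z : ext R n) : I a -> vals I (a *: z).
Proof.
move=> Ia; elim: n z => [|n IH] /= z; last by split; apply: IH.
by rewrite /GRing.scale /= mulrC; case: Iid => _ _; apply.
Qed.

Lemma valsN n (z : ext R n) : vals I z -> vals I (- z).
Proof. by rewrite -scaleN1r; apply: valsZ. Qed.

Lemma valsB n (z z' : ext R n) : vals I z -> vals I z' -> vals I (z - z').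
Proof. by move=> Iz Iz'; apply/valsD/valsN. Qed.

Lemma vals_cre n w (z : ext R n) : vals I z -> vals I (cre w z).
Proof.
elim: n w z => [|n IH] w z /=; first by move=> _; case: Iid.
by move=> [? ?]; split; [apply: IH | apply: valsB; [apply: valsZ|apply: IH]].
Qed.

Lemma vals_contr n f (z : ext R n) : vals I z -> vals I (contr f z).
Proof.
elim: n f z => [|n IH] f z /=; first by move=> _; case: Iid.
by move=> [? ?]; split; [apply: valsD; [apply: IH|apply: valsZ] | apply/valsN/IH].
Qed.

Lemma vals_vol n a : vals I (a *: vol R n) -> I a.
Proof. by elim: n => [|n IH] /= => [|[_ /IH]]; rewrite /GRing.scale /= ?mulr1. Qed.

Lemma vals_addI n y (z : ext R n) :
  vals (addI I y) z -> exists b, vals I (z - y *: b).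
Proof.
elim: n z => [|n IH] /= z.
  by move=> [a Ia]; exists a; rewrite /GRing.scale /= mulrC.
by move=> [/IH [b1 ?] /IH [b2 ?]]; exists (b1, b2).
Qed.

Lemma vals_scale_addI n y (z : ext R n) : vals (addI I y) (y *: z).
Proof.
elim: n z => [|n IH] /= z; last by split.
by exists z; rewrite /GRing.scale /= mulrC subrr; case: Iid.
Qed.

Lemma sub_addI y f : I f -> addI I y f.
Proof. by exists 0; rewrite mul0r subr0. Qed.

Lemma vals_reg n y (z : ext R n) :
  (forall f, I (y * f) -> I f) -> vals I (y *: z) -> vals I z.
Proof.
move=> reg; elim: n z => [|n IH] /= z; first exact: reg.
by move=> [/IH ? /IH].
Qed.

End Ideals.

Lemma vals_sub (R : comNzRingType) (P Q : R -> Prop) n (z : ext R n) :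
  (forall f, P f -> Q f) -> vals P z -> vals Q z.
Proof. by move=> PQ; elim: n z => [|n IH] /= z; [exact: PQ | move=> [/IH ? /IH]]. Qed.

(** Regularity in the weak sense: the final quotient may be zero. *)
Fixpoint regular_seq (R : comNzRingType) (I : R -> Prop) (s : seq R) : Prop :=
  if s is y :: s' then (forall f, I (y * f) -> I f) /\ regular_seq (addI I y) s'
  else True.

(* Multiplication by y = sum_i f_i w_i is null-homotopic on the Koszul complex of
   f, via exterior multiplication by w; so, y being regular modulo I, a cycle
   modulo I whose product with w is a boundary modulo (I, y) is a boundary
   modulo I. *)
Lemma koszul_descent (R : comNzRingType) n (f : 'I_n -> R) (ws : seq ('I_n -> R))
    (I : R -> Prop) (z : ext R n) :
  ideal I -> regular_seq I [seq \sum_i f i * w i | w <- ws : seq ('I_n -> R)] ->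
  vals I (contr f z) ->
  (exists v, vals (foldl (@addI R) I [seq \sum_i f i * w i | w <- ws : seq ('I_n -> R)])
     (foldl (fun z w => cre w z) z ws - contr f v)) ->
  exists v, vals I (z - contr f v).
Proof.
elim: ws I z => [|w ws IH] I z Iid //= [reg regs] Iz Ivz.
set y := \sum_i f i * w i in reg regs Ivz *.
have Iid' := ideal_addI y Iid.
have E : contr f (cre w z) = y *: z - cre w (contr f z) by rewrite -contr_cre addrK.
have [|v /vals_addI [b Ib]] := IH _ (cre w z) Iid' regs _ Ivz.
  rewrite E; apply: (valsB Iid').
    exact: vals_scale_addI.
  exact/(vals_sub (@sub_addI _ I y))/(vals_cre Iid).
(* Contracting [cre w z - contr f v - y *: b], whose coefficients lie in I, leaves y (z - contr f b)
   modulo I, and y cancels. *)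
exists b; apply: (vals_reg reg); rewrite scalerBr.
have -> : y *: z - y *: contr f b
    = contr f (cre w z - contr f v - y *: b) + cre w (contr f z).
  rewrite !(linearB (contr _)) (linearZ_LR (contr _)) /= contr_sq subr0 E.
  by rewrite addrAC subrK.
by apply: valsD => //; [apply: vals_contr | apply: vals_cre].
Qed.

Lemma vals_eq0 (R : comNzRingType) n (z : ext R n) : vals (fun f => f = 0) z -> z = 0.
Proof. by elim: n z => [|n IH] //= [a b] [/IH /= -> /IH /= ->]. Qed.

Definition gen (R : comNzRingType) n (f : 'I_n -> R) (g : R) : Prop :=
  exists a, g = \sum_i f i * a i.

Lemma ideal_gen (R : comNzRingType) n (f : 'I_n -> R) : ideal (gen f).
Proof.
split; first by exists (fun=> 0); rewrite big1 // => i _; rewrite mulr0.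
  move=> _ _ [a ->] [b ->]; exists (fun i => a i + b i).
  by rewrite -big_split; apply: eq_bigr => i _; rewrite mulrDr.
move=> c _ [a ->]; exists (fun i => c * a i).
by rewrite mulr_sumr; apply: eq_bigr => i _; rewrite mulrCA.
Qed.

Lemma gen_self (R : comNzRingType) n (f : 'I_n -> R) j : gen f (f j).
Proof.
exists (fun i => (i == j)%:R); rewrite (bigD1 j) //= eqxx mulr1 big1 ?addr0 // => i.
by move=> /negbTE ->; rewrite mulr0.
Qed.

Lemma contr_vac1 (R : comNzRingType) n (f w : 'I_n -> R) :
  contr f (cre w (vac n 1)) = vac n (\sum_i f i * w i).
Proof. by rewrite -[LHS]addr0 -{1}(linear0 (cre w)) -(contr_vac f 1) contr_cre -vacZ. Qed.

(** Only the component of v in exterior degree 1 contributes to degree 0. *)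
Lemma gen_contr (R : comNzRingType) n (f : 'I_n -> R) g v :
  vac n g = contr f v -> gen f g.
Proof.
move=> E; have [w Ew] := prj1P v; exists w; apply: (@vac_inj _ n).
by rewrite -contr_vac1 -Ew contr_prj -E prj_vac.
Qed.

(** * Monomial ideals generated by powers of the variables *)

Section PowersOfVariables.
Variables (K : fieldType) (l N : nat).
Local Notation S := {mpoly K[l]}.

(* The monomial ideal (x_i^N, i in T). *)
Definition pow_ideal (T : seq 'I_l) (f : S) : Prop :=
  forall m, m \in msupp f -> has (fun i => N <= m i)%N T.

Lemma pow_idealE T (f : S) :
  pow_ideal T f <-> forall m : 'X_{1..l}, ~~ has (fun i => N <= m i)%N T -> f@_m = 0.
Proof.
split=> H m; last by apply: contraLR => /H; rewrite mcoeff_msupp negbK => /eqP.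
by apply: contraNeq; rewrite -mcoeff_msupp => /H.
Qed.

Lemma ideal_pow_ideal T : ideal (pow_ideal T).
Proof.
split; first by move=> m; rewrite msupp0.
  by move=> a b /pow_idealE Ia /pow_idealE Ib; apply/pow_idealE => m Tm; rewrite mcoeffD Ia // Ib // addr0.
move=> a b Ib m /msuppM_le /allpairsP [[m1 m2] /= [_ /Ib /hasP [i iT Ni] ->]].
by apply/hasP; exists i => //; rewrite mnmDE (leq_trans Ni) // leq_addl.
Qed.

Lemma pow_ideal_nil : pow_ideal [::] = (fun f => f = 0).
Proof.
apply/funext => f; apply/propext; split => [H|-> m]; last by rewrite msupp0.
by apply/mpolyP => m; rewrite mcoeff0; move/pow_idealE: H; apply.
Qed.

Lemma coeff_XnM (i : 'I_l) (f : S) m :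
  ('X_i ^+ N * f)@_m = if (N <= m i)%N then f@_(m - U_(i) *+ N)%MM else 0.
Proof.
rewrite mpolyXn mulrC; case: leqP => [Nm|mN].
  have le : (U_(i) *+ N <= m)%MM.
    apply/mnm_lepP => j; rewrite mulmnE mnm1E; case: eqP => [<-|_]; rewrite ?mul1n ?mul0n //.
  by rewrite -{1}(submK le) addmC mcoeffMX.
apply: contraTeq mN; rewrite -mcoeff_msupp => /msuppM_le /allpairsP [[m1 m2] /=].
rewrite msuppX inE => -[_ /eqP -> ->].
by rewrite -leqNgt mnmDE mulmnE mnm1E eqxx mul1n leq_addl.
Qed.

Lemma addI_pow_ideal T i : addI (pow_ideal T) ('X_i ^+ N) = pow_ideal (rcons T i).
Proof.
apply/funext => f; apply/propext; split.
  case=> a /pow_idealE H; apply/pow_idealE => m; rewrite has_rcons negb_or => /andP [mi mT].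
  have := H m mT; rewrite mcoeffB mulrC coeff_XnM.
  by rewrite (negbTE mi) subr0.
move=> H; have [/= A0 AD AM] := ideal_addI ('X_i ^+ N) (ideal_pow_ideal T).
rewrite (mpolyE f) big_seq; apply: (big_ind (addI (pow_ideal T) ('X_i ^+ N))) => // m mf.
rewrite -mul_mpolyC; apply: (AM); move: (H m mf); rewrite has_rcons => /orP [Nm|hT].
  exists 'X_[m - U_(i) *+ N]; rewrite mpolyXn -mpolyXD submK ?subrr.
    by case: (ideal_pow_ideal T).
  by apply/mnm_lepP => j; rewrite mulmnE mnm1E; case: eqP => [<-|_]; rewrite ?mul1n ?mul0n.
by apply: sub_addI => m'; rewrite msuppX inE => /eqP ->.
Qed.

Lemma pow_ideal_reg T i (f : S) : i \notin T ->
  pow_ideal T ('X_i ^+ N * f) -> pow_ideal T f.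
Proof.
move=> iT /pow_idealE H; apply/pow_idealE => m mT.
have := H (m + U_(i) *+ N)%MM; rewrite coeff_XnM addmK mnmDE mulmnE mnm1E eqxx mul1n.
rewrite leq_addl; apply; apply: contraNN mT => /hasP [j jT]; rewrite mnmDE mulmnE mnm1E.
case: eqP => [ij|_]; first by rewrite ij jT in iT.
by rewrite mul0n addn0 => Nj; apply/hasP; exists j.
Qed.

Lemma pow_regular_seq T s : uniq (T ++ s) ->
  regular_seq (pow_ideal T) [seq 'X_i ^+ N | i <- s].
Proof.
elim: s T => [|i s IH] T //= u; split.
  move=> f; apply: pow_ideal_reg; move: u; rewrite cat_uniq => /and3P[_ + _].
  by rewrite negb_or => /andP [].
by rewrite addI_pow_ideal; apply: IH; rewrite cat_rcons.
Qed.

Lemma foldl_addI_pow T s :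
  foldl (@addI S) (pow_ideal T) [seq 'X_i ^+ N | i <- s] = pow_ideal (T ++ s).
Proof. by elim: s T => [|i s IH] T; rewrite ?cats0 //= addI_pow_ideal IH cat_rcons. Qed.

End PowersOfVariables.

Lemma prj_foldl_cre (R : comNzRingType) n k (z : ext R n) (ws : seq ('I_n -> R)) :
  prj (k + size ws) (foldl (fun z w => cre w z) z ws)
    = foldl (fun z w => cre w z) (prj k z) ws.
Proof.
elim: ws k z => [|w ws IH] k z /=; first by rewrite addn0.
by rewrite addnS -addSn IH prj_cre.
Qed.

Lemma foldl_creZ (R : comNzRingType) n a (z : ext R n) (ws : seq ('I_n -> R)) :
  foldl (fun z w => cre w z) (a *: z) ws = a *: foldl (fun z w => cre w z) z ws.
Proof. by elim: ws z => //= w ws IH z; rewrite linearZ_LR IH. Qed.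

(** The primitive v need not be homogeneous: by [contr_prj] its component of degree k + 2 is a
    primitive as well. *)
Definition koszul_exact (R : comNzRingType) n (f : 'I_n -> R) :=
  forall k (z : ext R n), prj k.+1 z = z -> contr f z = 0 -> exists v, z = contr f v.

(** * Koszul exactness and the socle over a polynomial ring *)

Section KoszulPolynomials.
Variables (K : fieldType) (l N : nat).
Local Notation S := {mpoly K[l]}.
Variables (f : 'I_l -> S).
Hypothesis fN : forall i, gen f ('X_i ^+ N).

Lemma gen_rows : exists ws : seq ('I_l -> S),
  [seq \sum_i f i * w i | w <- ws : seq ('I_l -> S)] = [seq 'X_i ^+ N | i <- enum 'I_l].
Proof.
have [W WE] := choice fN; exists [seq W i | i <- enum 'I_l].
by rewrite -map_comp; apply: eq_map => i /=; rewrite WE.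
Qed.

Lemma koszul_exact_gen : koszul_exact f.
Proof.
have [ws wsE] := gen_rows.
move=> k z zk dz.
have Z0 : vals (fun f : S => f = 0) (0 : ext S l) by exact: (vals0 (ideal0 S)).
have [||||v] := @koszul_descent _ _ f ws (fun f => f = 0) z.
- exact: ideal0.
- by rewrite wsE -(@pow_ideal_nil K l N); apply: pow_regular_seq; rewrite enum_uniq.
- by rewrite dz.
(* The l exterior multiplications raise the degree k + 1 of z above l, so the product is zero. *)
- exists 0; rewrite -zk -prj_foldl_cre prj_gt; last first.
    rewrite -(size_map (fun w : 'I_l -> S => \sum_i f i * w i)) wsE size_map size_enum_ord.
    by rewrite addSn ltnS leq_addl.
  rewrite (linear0 (contr f)) subrr wsE -(@pow_ideal_nil K l N) foldl_addI_pow.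
  by apply: vals0; apply: ideal_pow_ideal.
by move=> /vals_eq0 /eqP; rewrite subr_eq0 => /eqP ->; exists v.
Qed.

(* The image of a in the monomial complete intersection S/(x_i^N) under the
   injection S/(f) -> S/(x_i^N) given by multiplication by theta; the socle of the
   latter is spanned by the product of the x_i^(N-1). *)
Lemma socle_gen : exists phi : S -> K,
  (forall a g h, phi (a *: g + h) = a * phi g + phi h) /\
  forall a, (forall i, gen f ('X_i * a)) -> phi a = 0 -> gen f a.
Proof.
have [ws wsE] := gen_rows.
pose I : S -> Prop := @pow_ideal K l N (enum 'I_l).
have Iid : ideal I by apply: ideal_pow_ideal.
(* E is the product of the rows w, so its coefficient [theta] is, up to sign, the determinant of the
   matrix expressing the x_i^N through f. *)
pose E := foldl (fun z w => cre w z) (vac l (1 : S)) ws.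
have szws : size ws = l.
  by rewrite -(size_map (fun w : 'I_l -> S => \sum_i f i * w i)) wsE size_map size_enum_ord.
have Etop : prj l E = E.
  by have := prj_foldl_cre 0 (vac l (1 : S)) ws; rewrite add0n szws prj_vac.
have [theta Eth] := prj_volP E; rewrite Etop in Eth.
(* Descent from the cycle [vac l a], whose product with all the rows is a E. *)
have inj a : I (a * theta) -> gen f a.
  move=> Ia; have [||||v] := @koszul_descent _ _ f ws (fun f => f = 0) (vac l a).
  - exact: ideal0.
  - by rewrite wsE -(@pow_ideal_nil K l N); apply: pow_regular_seq; rewrite enum_uniq.
  - by rewrite contr_vac; exact: (vals0 (ideal0 S)).
  - exists 0; rewrite (linear0 (contr f)) subr0 wsE -(@pow_ideal_nil K l N) foldl_addI_pow.
    by rewrite vacZ foldl_creZ -/E Eth scalerA; apply: vals_scale.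
  by move=> /vals_eq0 /eqP; rewrite subr_eq0 => /eqP /gen_contr.
(* Cramer's rule: e_i /\ E is zero for degree reasons, so [contr_cre] gives f_i E = e_i /\ contr f
   E, and contr f E vanishes modulo I because every f . w is a power x_j^N. *)
have If i : I (f i * theta).
  suff IE : vals I (contr f E).
    apply: (@vals_vol _ _ l); rewrite -scalerA -Eth.
    have := contr_cre f (fun j => (j == i)%:R) E.
    rewrite (bigD1 i) //= eqxx mulr1 big1 ?addr0; last by move=> j /negbTE ->; rewrite mulr0.
    move=> <-; rewrite -Etop -prj_cre prj_gt // (linear0 (contr f)) add0r Etop.
    exact: vals_cre.
  have wsI : {in [seq \sum_i f i * w i | w <- ws : seq ('I_l -> S)], forall y, I y}.
    rewrite wsE => _ /mapP [j _ ->] m; rewrite mpolyXn msuppX inE => /eqP ->.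
    apply/hasP; exists j; first by rewrite mem_enum.
    by rewrite mulmnE mnm1E eqxx mul1n.
  have: vals I (contr f (vac l (1 : S))) by rewrite contr_vac; apply: vals0.
  rewrite /E; elim: (ws) wsI (vac l _) => //= w s IH wsI z Iz.
  apply: IH => [y ys|]; first by apply: wsI; rewrite inE ys orbT.
  have -> : contr f (cre w z) = (\sum_i f i * w i) *: z - cre w (contr f z).
    by rewrite -contr_cre addrK.
  apply: valsB => //; last exact: vals_cre.
  have Iy : I (\sum_i f i * w i) by apply: wsI; rewrite inE eqxx.
  exact: vals_scale.
exists (fun a => (a * theta)@_[multinom N.-1 | i < l]); split=> [a g h|a aS phia].
  by rewrite mulrDl -scalerAl mcoeffD mcoeffZ.
have Igen g : gen f g -> I (g * theta).
  case: (Iid) => I0 ID IM [b ->]; rewrite mulr_suml; apply: (big_ind I) => // i _.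
  by rewrite mulrAC mulrC; apply: IM.
apply: inj; apply/pow_idealE => m /hasPn mN.
(* At the socle exponent the coefficient is [phi a]. At any other exponent outside I some m_i is
   below N - 1; then x_i m is still outside I, and its coefficient in x_i a theta, an element of I,
   is the one sought. *)
have [->|/eqP mne] := eqVneq m [multinom N.-1 | i < l]; first by [].
have /existsP [i mi] : [exists i, m i != N.-1].
  apply/existsPn => me; apply: mne; apply/mnmP => i; rewrite mnmE.
  by apply/eqP; rewrite -[_ == _]negbK me.
have /pow_idealE /(_ (U_(i) + m)%MM) := Igen _ (aS i).
rewrite -mulrA mulrC mcoeffMX; apply; apply/hasPn => j _.
have := mN j; rewrite mem_enum => /(_ isT); rewrite -!ltnNge mnmDE mnm1E.
case: eqP => [<- mj|//]; rewrite add1n; case: ltngtP mj mi => //.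
by case: (N) => // n; rewrite !ltnS ltn_neqAle => -> _ ->.
Qed.

End KoszulPolynomials.

(** * Traces on subquotients *)

Section TraceMod.
Variables (K : fieldType) (V : lmodType K).
Implicit Types (W I : V -> Prop).

Definition submod I := I 0 /\ forall a x y, I x -> I y -> I (a *: x + y).

Definition lc n (e : 'I_n -> V) (c : 'cV[K]_n) : V := \sum_i c i 0 *: e i.

Lemma lcP n (e : 'I_n -> V) : linear (lc e).
Proof.
move=> a c d; rewrite /lc scaler_sumr -big_split; apply: eq_bigr => i _ /=.
by rewrite !mxE scalerDl scalerA.
Qed.
HB.instance Definition _ n (e : 'I_n -> V) :=
  GRing.isLinear.Build K 'cV[K]_n V _ (lc e) (lcP e).

(* e is a basis of W modulo W :&: I. *)
Definition basis_mod W I n (e : 'I_n -> V) :=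
  [/\ forall j, W (e j), forall c, I (lc e c) -> c = 0
    & forall s, W s -> exists c, I (s - lc e c)].

(* t is the trace of g on W / (W :&: I). *)
Definition trace_mod W I (g : V -> V) (t : K) := exists n (e : 'I_n -> V) (G : 'M_n),
  [/\ basis_mod W I e, forall j, I (g (e j) - lc e (col j G)) & t = \tr G].

Variables (W I : V -> Prop).
Hypothesis Isub : submod I.

Lemma submodD x y : I x -> I y -> I (x + y).
Proof. by move=> Ix Iy; rewrite -[x]scale1r; apply: (proj2 Isub). Qed.
Lemma submodZ a x : I x -> I (a *: x).
Proof. by move=> Ix; rewrite -[_ *: _]addr0; apply: (proj2 Isub) => //; case: Isub. Qed.
Lemma submodN x : I x -> I (- x).
Proof. by rewrite -scaleN1r; apply: submodZ. Qed.
Lemma submod_sum (T : finType) (F : T -> V) : (forall i, I (F i)) -> I (\sum_i F i).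
Proof. by move=> IF; apply: (big_ind I) => //; [case: Isub | exact: submodD]. Qed.

Lemma lc_mod n n' (e : 'I_n -> V) (e' : 'I_n' -> V) (P : 'M_(n, n')) :
  (forall j, I (e' j - lc e (col j P))) -> forall c, I (lc e' c - lc e (P *m c)).
Proof.
move=> eP c; have -> : P *m c = \sum_j c j 0 *: col j P.
  by apply/colP => i; rewrite !mxE summxE; apply: eq_bigr => j _; rewrite !mxE mulrC.
rewrite (linear_sum (lc e)) {1}/lc /= -sumrB; apply: submod_sum => j.
by rewrite linearZ_LR -scalerBr; apply: submodZ.
Qed.

Lemma basis_mod_coord n n' (e : 'I_n -> V) (e' : 'I_n' -> V) :
  basis_mod W I e -> (forall j, W (e' j)) ->
  exists P : 'M_(n, n'), forall j, I (e' j - lc e (col j P)).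
Proof.
move=> [_ _ span] We'; have [c cE] := choice (fun j => span _ (We' j)).
exists (\matrix_(i, j) c j i 0) => j.
by rewrite (_ : col _ _ = c j) //; apply/colP => i; rewrite !mxE.
Qed.

Lemma basis_mod_inj n (e : 'I_n -> V) c d :
  basis_mod W I e -> I (lc e c - lc e d) -> c = d.
Proof. by move=> [_ free _]; rewrite -linearB => /free /eqP; rewrite subr_eq0 => /eqP. Qed.

Lemma eq_mulmx_cV m n (A B : 'M[K]_(m, n)) : (forall c : 'cV_n, A *m c = B *m c) -> A = B.
Proof.
move=> AB; apply/matrixP => i j; have /colP /(_ i) := AB (delta_mx j 0).
by rewrite -!colE !mxE.
Qed.

Lemma submod_trans x y z : I (x - y) -> I (y - z) -> I (x - z).
Proof. by move=> xy yz; rewrite -(subrKA y); apply: submodD. Qed.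

Lemma submod_sym x y : I (x - y) -> I (y - x).
Proof. by move=> /submodN; rewrite opprB. Qed.

Lemma basis_mod_change n n' (e : 'I_n -> V) (e' : 'I_n' -> V) :
  basis_mod W I e -> basis_mod W I e' ->
  exists P Q, [/\ P *m Q = 1%:M, Q *m P = 1%:M,
    forall c, I (lc e' c - lc e (P *m c)) & forall c, I (lc e c - lc e' (Q *m c))].
Proof.
move=> be be'; have [P /lc_mod PE] := basis_mod_coord be (let: And3 h _ _ := be' in h).
have [Q /lc_mod QE] := basis_mod_coord be' (let: And3 h _ _ := be in h).
exists P, Q; split=> //; apply: eq_mulmx_cV => c; rewrite mul1mx -mulmxA.
  apply: (basis_mod_inj be); apply: submod_sym.
  exact: submod_trans (QE c) (PE _).
apply: (basis_mod_inj be'); apply: submod_sym.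
exact: submod_trans (PE c) (QE _).
Qed.

Lemma trace_mod_uniq (g : {linear V -> V}) t t' : (forall x, I x -> I (g x)) ->
  trace_mod W I g t -> trace_mod W I g t' -> t = t'.
Proof.
move=> Ig [n [e [G [be /lc_mod GE ->]]]] [n' [e' [G' [be' /lc_mod GE' ->]]]].
have gE m (x : 'I_m -> V) c : g (lc x c) = lc (fun j => g (x j)) c.
  by rewrite linear_sum; apply: eq_bigr => i _; rewrite linearZ.
have [P [Q [PQ QP PE QE]]] := basis_mod_change be be'.
(* Both sides give the coordinates of [g (lc e' c)] in the basis e. *)
have PG : P *m G' = G *m P.
  apply: eq_mulmx_cV => c; rewrite -!mulmxA; apply: (basis_mod_inj be).
  apply: (submod_trans (y := g (lc e' c))).
    apply: submod_sym; rewrite gE; exact: submod_trans (GE' c) (PE _).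
  apply: submod_trans (GE (P *m c)).
  by rewrite -gE -linearB; apply: Ig.
by rewrite -[G]mulmx1 -PQ mulmxA -PG mxtrace_mulC mulmxA QP mul1mx.
Qed.

Lemma trace_mod_exists (g : V -> V) N (s : 'I_N -> V) :
  (forall x, W x -> W (g x)) ->
  (forall j, W (s j)) -> (forall x, W x -> exists c, I (x - lc s c)) ->
  exists t, trace_mod W I g t.
Proof.
move=> Wg Ws span.
have [n [e be]] : exists n (e : 'I_n -> V), basis_mod W I e.
  elim: N s Ws span => [|N IH] s Ws span.
    by exists 0, s; split=> // c _; apply/colP; case.
  have [free|/existsNP [c /not_implyP [Ic cn0]]] :=
    pselect (forall c, I (lc s c) -> c = 0).
    by exists N.+1, s; split.
  have [k ck] : exists k, c k 0 != 0.
    apply: contra_notP cn0 => nk; apply/colP => k; rewrite mxE.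
    by apply/eqP; apply: contra_notT nk => ck; exists k.
  apply: (IH (fun j => s (lift k j))) => // x /span [d Id].
  (* Subtracting d_k / c_k times the relation c eliminates the vector s_k. *)
  exists (\col_j (d (lift k j) 0 - d k 0 / c k 0 * c (lift k j) 0)).
  have -> : x - lc (fun j => s (lift k j))
        (\col_j (d (lift k j) 0 - d k 0 / c k 0 * c (lift k j) 0))
      = x - lc s d + (d k 0 / c k 0) *: lc s c.
    rewrite -addrA; congr (_ + _); rewrite -(linearN (lc s)) -(linearZ_LR (lc s)) -(linearD (lc s)) /=.
    rewrite /lc (bigD1_ord k) //= !mxE mulrVK ?unitfE // addNr scale0r add0r -sumrN.
    by apply: eq_bigr => j _; rewrite !mxE -scaleNr; congr (_ *: _); rewrite opprB addrC.
  by apply: submodD => //; apply: submodZ.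
have [G GE] := basis_mod_coord be (fun j => Wg _ (let: And3 h _ _ := be in h j)).
by exists (\tr G), n, e, G.
Qed.

End TraceMod.

(** * Hilbert series of graded complete intersections *)

Section Homogeneous.
Variables (K : fieldType) (l : nat).
Local Notation S := {mpoly K[l]}.
Implicit Types (f g : S) (I : S -> Prop).

(** The test on m is not redundant: natural subtraction truncates, and for m < r the product with an
    element of degree r has no component of degree m. *)
Definition shiftpi r m f : S := if (r <= m)%N then pihomog mdeg (m - r) f else 0.

Lemma shiftpiP r m : additive (shiftpi r m).
Proof. by move=> f g; rewrite /shiftpi; case: ifP; rewrite ?subrr // pihomogB. Qed.
HB.instance Definition _ r m :=
  GRing.isZmodMorphism.Build S S (shiftpi r m) (@shiftpiP r m).

Lemma pihomogM r m f g : f \is r.-homog ->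
  pihomog mdeg m (f * g) = f * shiftpi r m g.
Proof.
move=> fr; rewrite {1}(pihomog_partitionE (mf := mdeg) (leqnn (mmeasure mdeg g))).
rewrite mulr_sumr raddf_sum /=.
rewrite (eq_bigr (fun d : 'I_(mmeasure mdeg g) =>
    if (r + d == m)%N then f * pihomog mdeg d g else 0)); last first.
  move=> d _; have h : f * pihomog mdeg d g \is (r + d).-homog.
    by apply: dhomogM => //; apply: pihomogP.
  by case: eqP => [<-|/eqP ne]; [rewrite pihomog_dE | rewrite (pihomog_ne0 ne)].
rewrite -big_mkcond /shiftpi; case: leqP => rm; last first.
  rewrite big1 ?mulr0 // => d /eqP dm.
  by move: rm; rewrite -dm ltnNge leq_addr.
rewrite (eq_bigl (fun d : 'I__ => d == (m - r)%N :> nat)); last first.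
  by move=> d; rewrite -(eqn_add2l r d) subnKC.
have [lt|ge] := ltnP (m - r) (mmeasure mdeg g).
  by rewrite (big_pred1 (Ordinal lt)).
rewrite big1 => [|d /eqP dm]; last by move: (ltn_ord d); rewrite dm ltnNge ge.
rewrite pihomogE big1_seq ?mulr0 // => mm /andP [/eqP dmm mg].
by have := mmeasure_mnm_lt mdeg mg; rewrite dmm ltnNge ge.
Qed.

Lemma shiftpi_homog r m f : (r <= m)%N -> shiftpi r m f \is (m - r).-homog.
Proof. by rewrite /shiftpi => ->; apply: pihomogP. Qed.

Lemma emap_pihomog n m (z : ext S n) :
  vals (fun f => f \is m.-homog) z -> emap (pihomog mdeg m) z = z.
Proof.
elim: n z => [|n IH] /= z; first exact: pihomog_dE.
by case: z => a b [/IH /= -> /IH /= ->].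
Qed.

Lemma vals_emap n (P : S -> Prop) (A : S -> S) (z : ext S n) :
  (forall f, P (A f)) -> vals P (emap A z).
Proof. by move=> PA; elim: n z => [|n IH] /= z; [exact: PA | split; apply: IH]. Qed.

Lemma vals_0 n (P : S -> Prop) : P 0 -> vals P (0 : ext S n).
Proof. by move=> P0; elim: n. Qed.

Lemma vals_cre_vac n (P : S -> Prop) (w : 'I_n -> S) :
  P 0 -> (forall i, P (w i)) -> vals P (cre w (vac n 1)).
Proof.
move=> P0; elim: n w => [|n IH] w Pw //=; split; first by apply: IH => i; apply: Pw.
rewrite (linear0 (cre _)) subr0 -vacZ; move: (Pw ord0); move: (w ord0) => a Pa.
by elim: n {IH w Pw} => //= n IH; split=> //; apply: vals_0.
Qed.

(* Unlike exactness in all degrees, this form passes to [tl f] by an elementary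
   induction on the degree m. *)
Definition hkoszul n (f : 'I_n -> S) := forall m k (z : ext S n),
  vals (fun f => f \is m.-homog) z -> prj k.+1 z = z -> contr f z = 0 ->
  exists v, z = contr f v.

Lemma hkoszul_nil (f : 'I_0 -> S) : hkoszul f.
Proof. by move=> m k z _ /= <- _; exists 0. Qed.

(** A primitive (w0, w1) of (z, 0) gives z = contr w0 + f_0 w1 with w1 a cycle for the tail. After
    restriction to degree m the coefficients of w1 have degree m - r < m, so by induction w1 is a
    boundary, and then so is z. *)
Lemma hkoszul_tl n (f : 'I_n.+1 -> S) r : (forall i, f i \is r.-homog) ->
  (0 < r)%N -> hkoszul f -> hkoszul (tl f).
Proof.
move=> fr r0 kf m; elim/ltn_ind: m => m IH k z zm zk dz.
have [|||[w0 w1] /= [E0 /esym/eqP]] := kf m k (z, 0).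
- by split=> //; apply/(vals_0 n)/dhomog0.
- by rewrite /= zk (linear0 (prj _)).
- by rewrite /= dz scaler0 addr0 (linear0 (contr _)) oppr0.
rewrite oppr_eq0 => /eqP dw1.
pose A := (pihomog mdeg m : {additive S -> S}).
pose B := (shiftpi r m : {additive S -> S}).
have AB i a : A (tl f i * a) = tl f i * B a by apply: pihomogM; apply: fr.
have AB0 a : A (f ord0 * a) = f ord0 * B a by apply: pihomogM; apply: fr.
have Ez : z = contr (tl f) (emap B (prj k.+2 w0)) + f ord0 *: emap B (prj k.+1 w1).
  rewrite -(emap_contr AB) -(emapZ AB0) -(raddfD (emap A)) contr_prj.
  by rewrite -(linearZ_LR (prj _)) -(linearD (prj _)) /= -E0 zk emap_pihomog.
suff [u Eu] : exists u, emap B (prj k.+1 w1) = contr (tl f) u.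
  exists (emap B (prj k.+2 w0) + f ord0 *: u).
  by rewrite Ez Eu (linearD (contr _)) (linearZ_LR (contr _)).
have [rm|mr] := leqP r m.
  apply: (IH (m - r)%N _ k); first by rewrite ltn_subrL r0 (leq_trans r0 rm).
  - by apply: vals_emap => a; apply: shiftpi_homog.
  - by rewrite -emap_prj prj_id.
  by rewrite -(emap_contr AB) contr_prj dw1 (linear0 (prj _)) (raddf0 (emap A)).
exists 0; rewrite (linear0 (contr _)); elim: (n) (prj k.+1 w1) => [|n' IH'] /= y.
  by rewrite /shiftpi leqNgt mr.
by rewrite !IH'.
Qed.

(** A relation f_0 g = sum_i f_i a_i makes (g, - a) a cycle of exterior degree 1, once a is cut down
    to degree m. The e_0 component of a boundary has coefficients in the ideal of the remaining
    f_i. *)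
Lemma hkoszul_regular n (f : 'I_n.+1 -> S) r m g : (forall i, f i \is r.-homog) ->
  hkoszul f -> g \is m.-homog -> gen (tl f) (f ord0 * g) -> gen (tl f) g.
Proof.
move=> fr kf gm [a E].
pose w i := if unlift ord0 i is Some j then - shiftpi r (r + m) (a j) else g.
have [|||v /= [_ E2]] := kf m 0%N (cre w (vac _ 1)).
- apply: vals_cre_vac => [|i]; first exact: dhomog0.
  rewrite /w; case: unlift => [j|//]; rewrite dhomogN.
  by have := @shiftpi_homog r (r + m) (a j); rewrite leq_addr addKn; apply.
- by rewrite prj_cre prj_vac.
- rewrite contr_vac1 big_ord_recl {1}/w unlift_none.
  rewrite -[f ord0 * g](pihomog_dE (mf := mdeg) (d := (r + m)%N)); last exact: dhomogM.
  rewrite E raddf_sum -big_split /= big1 ?vac0 // => i _.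
  by rewrite /w liftK mulrN (@pihomogM r) ?subrr //; apply: fr.
move: E2; rewrite (linear0 (cre _)) subr0 -vacZ /w unlift_none -(linearN (contr _)).
exact: gen_contr.
Qed.

Definition homogeneous I := forall m f, I f -> I (pihomog mdeg m f).

Lemma ideal_submod I : ideal I -> submod I.
Proof. by move=> [I0 ID IM]; split=> // a x y Ix Iy; rewrite -mul_mpolyC; apply/ID/Iy/IM. Qed.

Lemma homogeneous_gen n (f : 'I_n -> S) r : (forall i, f i \is r.-homog) ->
  homogeneous (gen f).
Proof.
move=> fr m _ [a ->]; exists (fun i => shiftpi r m (a i)); rewrite raddf_sum.
by apply: eq_bigr => i _; apply: pihomogM.
Qed.

End Homogeneous.

(** * Graded traces when one homogeneous element is added to the ideal *)

Section GradedTrace.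
Variables (K : fieldType) (l : nat).
Local Notation S := {mpoly K[l]}.
Variable g : {lrmorphism S -> S}.
Hypothesis g_homog : forall m f, f \is m.-homog -> g f \is m.-homog.
Implicit Types (f : S) (I : S -> Prop).

Definition htrace I m t := trace_mod (fun f => f \is m.-homog) I g t.

Section Step.
Variables (I : S -> Prop) (v : S) (r : nat) (mu : K).
Hypotheses (Iid : ideal I) (Ihom : homogeneous I).
Hypotheses (vr : v \is r.-homog) (gv : I (g v - mu *: v)).
Hypothesis vreg : forall m f, f \is m.-homog -> I (v * f) -> I f.

Let Isub := ideal_submod Iid.

Lemma addI_homog m s : s \is m.-homog -> addI I v s ->
  exists a, I (s - v * shiftpi r m a).
Proof.
move=> sm [a /(Ihom m)]; rewrite pihomogB pihomog_dE // mulrC (pihomogM _ _ vr).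
by exists a.
Qed.

Lemma htrace_addI_lt m t : (m < r)%N -> htrace (addI I v) m t -> htrace I m t.
Proof.
move=> mr [n [e [G [[eW efree espan] eG ->]]]].
have key s : s \is m.-homog -> addI I v s -> I s.
  by move=> sm /(addI_homog sm) [a]; rewrite /shiftpi leqNgt mr mulr0 subr0.
have lcW c : lc e c \is m.-homog by apply: rpred_sum => i _; apply/rpredZ/eW.
exists n, e, G; split=> //; last first.
  by move=> j; apply: key (eG j); apply: rpredB; [apply: g_homog | exact: lcW].
split=> // [c Ic|s sm]; first exact/efree/sub_addI.
have [c Ic] := espan _ sm; exists c; apply: key Ic.
exact: rpredB sm (lcW c).
Qed.

(** Multiplication by v embeds (S/I) in degree m - r into (S/I) in degree m with cokernel the
    quotient by I + (v). As g (v f) = mu v (g f) modulo I, the matrix of g in the basis made of e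
    and v e' is block triangular with diagonal blocks G and mu G'. *)
Lemma htrace_addI m t t' : (r <= m)%N ->
  htrace (addI I v) m t -> htrace I (m - r)%N t' -> htrace I m (t + mu * t').
Proof.
move=> rm [n [e [G [[eW efree espan] eG ->]]]] [n' [e' [G' [be' eG' ->]]]].
have [eW' efree' espan'] := be'.
have key s : s \is m.-homog -> addI I v s -> exists c, I (s - v * lc e' c).
  move=> sm /(addI_homog sm) [a Ia].
  have [c Ic] := espan' _ (shiftpi_homog a rm); exists c.
  by apply: (submod_trans Isub Ia); rewrite -mulrBr; case: Iid => _ _; apply.
have lcW c : lc e c \is m.-homog by apply: rpred_sum => i _; apply/rpredZ/eW.
have [H HE] := choice (fun j => key _ (rpredB (g_homog (eW j)) (lcW _)) (eG j)).
pose E (k : 'I_(n + n')) := match split k with inl j => e j | inr j => v * e' j end.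
have lcE c : lc E c = lc e (usubmx c) + v * lc e' (dsubmx c).
  rewrite /lc big_split_ord /= mulr_sumr; congr (_ + _); apply: eq_bigr => j _; rewrite !mxE.
    by rewrite /E (unsplitK (inl j)).
  by rewrite /E (unsplitK (inr j)) scalerAr.
exists (n + n')%N, E, (block_mx G 0 (\matrix_(i, j) H j i 0) (mu *: G')); split.
- split.
  + move=> k; rewrite /E; case: split => j; first exact: eW.
    by rewrite -(subnKC rm); apply: dhomogM.
  + move=> c; rewrite lcE => Ic.
    have c1 : usubmx c = 0.
      apply: efree; exists (- lc e' (dsubmx c)).
      by rewrite mulNr opprK mulrC.
    have c2 : dsubmx c = 0.
      apply: efree'; apply: (@vreg (m - r)).
        by apply: rpred_sum => i _; apply/rpredZ/eW'.
      by move: Ic; rewrite c1 (linear0 (lc e)) add0r.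
    by rewrite -[c]vsubmxK c1 c2 col_mx0.
  + move=> s sm; have [c Ic] := espan _ sm.
    have [d Id] := key _ (rpredB sm (lcW c)) Ic.
    exists (col_mx c d); rewrite lcE col_mxKu col_mxKd.
    by rewrite opprD addrA.
- set B := block_mx _ _ _ _ => k; rewrite lcE -(splitK k) /E; case: (split k) => j.
    rewrite (unsplitK (inl j)) /=.
    have -> : usubmx (col (lshift n' j) B) = col j G.
      by apply/colP => i; rewrite -[G in RHS](block_mxKul G 0 (\matrix_(i, j) H j i 0) (mu *: G')) !mxE.
    have -> : dsubmx (col (lshift n' j) B) = H j.
      apply/colP => i; transitivity (dlsubmx B i j); first by rewrite !mxE.
      by rewrite block_mxKdl mxE.
    by rewrite opprD addrA.
  rewrite (unsplitK (inr j)) /=.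
  have -> : usubmx (col (rshift n j) B) = 0.
    apply/colP => i; transitivity (ursubmx B i j); first by rewrite !mxE.
    by rewrite block_mxKur !mxE.
  have -> : dsubmx (col (rshift n j) B) = mu *: col j G'.
    apply/colP => i; transitivity (drsubmx B i j); first by rewrite !mxE.
    by rewrite block_mxKdr !mxE.
  rewrite (linear0 (lc e)) add0r (linearZ_LR (lc e')) /= rmorphM.
  have -> : g v * g (e' j) - v * (mu *: lc e' (col j G'))
    = g (e' j) * (g v - mu *: v) + (mu *: v) * (g (e' j) - lc e' (col j G')).
    rewrite !mulrBr -!scalerAl -scalerAr addrA [g (e' j) * _]mulrC.
    by rewrite (mulrC (g (e' j))) -scalerAl subrK.
  by case: (Iid) => _ ID IM; apply: ID; apply: IM.
by rewrite mxtrace_block linearZ.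
Qed.

End Step.
End GradedTrace.

(** * Generating series of graded traces *)

Section HilbertSeries.
Variables (K : numClosedFieldType) (l : nat).
Local Notation S := {mpoly K[l]}.
Variable g : {lrmorphism S -> S}.
Hypothesis g_homog : forall m f, f \is m.-homog -> g f \is m.-homog.
Implicit Types (I : S -> Prop).

Lemma dhomog_msize_le m (f : S) : f \is m.-homog -> (msize f <= m.+1)%N.
Proof.
move=> /dhomogP fm; rewrite msizeE; apply/bigmax_leqP_seq => x xf _.
by rewrite fm.
Qed.

Lemma htrace_exists I m : ideal I -> exists t, htrace g I m t.
Proof.
move=> Iid; pose B : finType := 'X_{1..l < m.+1}.
pose s (k : 'I_#|B|) : S := if mdeg (enum_val k) == m then 'X_[enum_val k] else 0.
apply: (@trace_mod_exists _ _ _ _ (ideal_submod Iid) _ _ s).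
- exact: g_homog.
- by move=> j; rewrite /s; case: ifP => [mj|_]; rewrite ?dhomogX ?mj ?dhomog0.
move=> f fm; exists (\col_k f@_(enum_val k : B)).
suff E : f = lc s (\col_k f@_(enum_val k : B)) by rewrite -E subrr; case: Iid.
rewrite {1}(mpolywE (dhomog_msize_le fm)) /lc (reindex (@enum_val B predT)); last first.
  by apply: onW_bij; exact: enum_val_bij.
apply: eq_big => [k //|k _]; rewrite mxE /s; case: eqP => // /eqP mk.
by rewrite (dhomog_nemf_coeff fm mk) !scale0r.
Qed.

Lemma gen_tl n (f : 'I_n.+1 -> S) : gen f = addI (gen (tl f)) (f ord0).
Proof.
apply/funext => h; apply/propext; split=> [[a ->]|[b [a E]]].
  by exists (a ord0); exists (tl a); rewrite big_ord_recl mulrC addrAC subrr add0r.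
exists (fun i => if unlift ord0 i is Some j then a j else b).
rewrite big_ord_recl unlift_none -[LHS](subrK (b * f ord0)) E addrC mulrC.
by congr (_ + _); apply: eq_bigr => i _; rewrite liftK.
Qed.

Lemma gen_nil (f : 'I_0 -> S) : gen f = (fun h => h = 0).
Proof.
by apply/funext => h; apply/propext; split=> [[a ->]|->]; [|exists (fun=> 0)]; rewrite big_ord0.
Qed.

Lemma gen_stable n (f : 'I_n -> S) : (forall j, gen f (g (f j))) ->
  forall h, gen f h -> gen f (g h).
Proof.
move=> gf _ [a ->]; have [I0 ID IM] := ideal_gen f.
rewrite rmorph_sum; apply: (big_ind (gen f)) => // i _.
by rewrite rmorphM mulrC; exact/IM/gf.
Qed.

(** Congruence modulo X^M, in place of an identity of power series: the traces on C[h] do not vanish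
    in large degrees. *)
Definition eqX M (p q : {poly K}) := forall i, (i < M)%N -> p`_i = q`_i.

Lemma eqXM M p q p' q' : eqX M p q -> eqX M p' q' -> eqX M (p * p') (q * q').
Proof.
move=> pq pq' i iM; rewrite !coefM; apply: eq_bigr => j _.
by rewrite pq ?pq' //; [apply: leq_ltn_trans (leq_subr _ _) _ | apply: leq_ltn_trans iM; rewrite -ltnS].
Qed.

(** By triangularity the tail of f spans a g-stable space and f_0 is an eigenvector modulo it, so
    restoring f_0 to the ideal multiplies the series by 1 - T_00 X^r. *)
Lemma htrace_series n (f : 'I_n -> S) (T : 'M[K]_n) r :
  (forall i, f i \is r.-homog) -> (0 < r)%N || (n <= 1)%N ->
  (forall j, g (f j) = \sum_i T i j *: f i) ->
  (forall i j : 'I_n, (i < j)%N -> T i j = 0) ->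
  hkoszul f -> forall t t0,
  (forall m, htrace g (fun h => h = 0) m (t0 m)) ->
  (forall m, htrace g (gen f) m (t m)) ->
  forall M, eqX M (\poly_(m < M) t m)
    ((\prod_i (1 - T i i *: 'X^r)) * \poly_(m < M) t0 m).
Proof.
elim: n f T => [|n IH] f T fr r1 gf Ttrig kf t t0 ht0 ht M.
  move=> i iM; rewrite big_ord0 mul1r !coef_poly iM.
  apply: (@trace_mod_uniq _ _ _ _ (ideal_submod (ideal0 S)) g) (ht0 i).
    by move=> x ->; rewrite raddf0.
  by rewrite -(gen_nil f); exact: ht.
have gtl j : gen (tl f) (g (tl f j)).
  exists (fun i => (T (lift ord0 i) (lift ord0 j))%:MP).
  rewrite /tl gf big_ord_recl Ttrig // scale0r add0r.
  by apply: eq_bigr => i _; rewrite mulrC mul_mpolyC.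
have g0 : gen (tl f) (g (f ord0) - T ord0 ord0 *: f ord0).
  exists (fun i => (T (lift ord0 i) ord0)%:MP).
  rewrite gf big_ord_recl addrAC subrr add0r.
  by apply: eq_bigr => i _; rewrite mulrC mul_mpolyC.
(* If r = 0 there is a single f_0 and the tail is empty. *)
have ktl : hkoszul (tl f).
  case: n {IH} f T fr r1 gf Ttrig kf ht gtl g0 => [|n] f T fr r1 *; first exact: hkoszul_nil.
  by apply: (hkoszul_tl fr) => //; rewrite orbF in r1.
have trl i : tl f i \is r.-homog by apply: fr.
have [t' ht'] := choice (fun m => @htrace_exists _ m (ideal_gen (tl f))).
have tE m : t' m = t m + (if (r <= m)%N then T ord0 ord0 * t' (m - r)%N else 0).
  have gS := gen_stable gtl.
  apply: (trace_mod_uniq (ideal_submod (ideal_gen (tl f))) gS (ht' m)).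
  have := ht m; rewrite gen_tl.
  have reg := fun m h => @hkoszul_regular _ _ _ f r m h fr kf.
  case: leqP => rm htm; last first.
    rewrite addr0; exact: (htrace_addI_lt g_homog (homogeneous_gen trl) (fr ord0) rm htm).
  exact: (htrace_addI g_homog (ideal_gen (tl f)) (homogeneous_gen trl) (fr ord0) g0 reg rm htm (ht' _)).
have pE : eqX M (\poly_(m < M) t m)
    ((1 - T ord0 ord0 *: 'X^r) * \poly_(m < M) t' m).
  move=> i iM; rewrite mulrBl mul1r coefB -scalerAl coefZ coefXnM !coef_poly iM tE.
  case: ltnP => ri; first by rewrite mulr0 subr0 addr0.
  by rewrite (leq_ltn_trans (leq_subr _ _) iM) addrK.
move=> i iM; rewrite (pE i iM) big_ord_recl -mulrA; apply: eqXM iM => // {}i iM.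
pose T' := \matrix_(i, j) T (lift ord0 i) (lift ord0 j).
rewrite (eq_bigr (fun i0 => 1 - T' i0 i0 *: 'X^r)) => [|k _]; last by rewrite mxE.
apply: (IH (tl f) T' trl _ _ _ ktl t' t0 ht0 ht' M i iM).
- by move: r1; case: (r) => // /=; case: (n).
- move=> j; rewrite /tl gf big_ord_recl Ttrig // scale0r add0r.
  by apply: eq_bigr => k _; rewrite mxE.
by move=> j k jk; rewrite mxE Ttrig.
Qed.

Lemma gen_coeff0 r (z : 'I_l -> S) h : (0 < r)%N ->
  (forall i, z i \is r.-homog) -> gen z h -> h@_0%MM = 0.
Proof.
move=> r0 z1 [a ->]; rewrite raddf_sum big1 // => i _ /=.
rewrite (mcoeffM (z i)) big1 // => k /eqP E.
have : mdeg k.1 != r.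
  have : mdeg (k.1 + k.2)%MM == 0%N by rewrite -E mdeg0.
  by rewrite mdegD addn_eq0 => /andP [/eqP -> _]; rewrite eq_sym -lt0n.
by move=> /(dhomog_nemf_coeff (z1 i)) ->; rewrite mul0r.
Qed.

Lemma htrace_linear_forms (z : 'I_l -> S) m :
  (forall i, z i \is 1.-homog) -> (forall i, gen z 'X_i) ->
  htrace g (gen z) m (m == 0%N)%:R.
Proof.
move=> z1 zX; have zid := ideal_gen z; have [z0 zD zM] := zid.
have zpos k : (0 < mdeg k)%N -> gen z 'X_[k].
  rewrite mdegE lt0n sum_nat_eq0 => /forallPn [i /=]; rewrite -lep1mP => ik.
  by rewrite -(submK ik) mpolyXD; apply: zM.
case: m => [|m].
  exists 1%N, (fun=> 1), 1%:M; split; last by rewrite mxtrace1.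
    split=> [j|c|s s0]; first exact: dhomog1.
      move=> /(gen_coeff0 (ltn0Sn 0) z1); rewrite /lc big_ord1 mcoeffZ mcoeff1 eqxx mulr1 => c0.
      by apply/colP => i; rewrite ord1 c0 mxE.
    exists (const_mx s@_0%MM); rewrite /lc big_ord1 mxE.
    suff -> : s = s@_0%MM *: 1 by rewrite mcoeffZ mcoeff1 eqxx mulr1 subrr.
    apply/mpolyP => k; rewrite mcoeffZ mcoeff1; case: eqP => [->|/eqP k0]; first by rewrite mulr1.
    by rewrite mulr0 (dhomog_nemf_coeff s0) // mdeg_eq0.
  by move=> j; rewrite rmorph1 /lc big_ord1 !mxE !ord1 eqxx scale1r subrr.
exists 0%N, (fun=> 0), 0; split; last by rewrite mxtrace0.
  split=> [j|c _|s sm]; [exact: dhomog0 | by apply/colP; case|].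
  exists 0; rewrite (linear0 (lc _)) subr0 (mpolyE s) big_seq.
  apply: (big_ind (gen z)) => // k ks; rewrite -mul_mpolyC; apply/zM/zpos.
  by have/dhomogP -> := sm.
by case.
Qed.

Lemma horner_prod_linear n (T : 'M[K]_n) r s :
  (forall i j : 'I_n, (i < j)%N -> T i j = 0) ->
  (\prod_i (1 - T i i *: 'X^r)).[s] = \det (1%:M - s ^+ r *: T).
Proof.
move=> trT; rewrite det_trig; last first.
  apply/is_trig_mxP => i j ij; rewrite !mxE trT // mulr0 subr0.
  by rewrite -val_eqE /= ltn_eqF.
rewrite horner_prod; apply: eq_bigr => i _.
by rewrite !hornerE !mxE eqxx mulrC.
Qed.

(** With t0 the series of g on C[h], dividing by f gives t = prod (1 - T_ii X^r) t0 and dividing by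
    z gives 1 = prod (1 - T'_ii X) t0; t0 is eliminated. *)
Lemma complete_intersection_series (f z : 'I_l -> S) (T T' : 'M[K]_l) r t M :
  (forall i, f i \is r.-homog) -> (0 < r)%N || (l <= 1)%N ->
  (forall j, g (f j) = \sum_i T i j *: f i) ->
  (forall i j : 'I_l, (i < j)%N -> T i j = 0) ->
  hkoszul f -> (forall i, z i \is 1.-homog) -> (forall i, gen z 'X_i) ->
  (forall j, g (z j) = \sum_i T' i j *: z i) ->
  (forall i j : 'I_l, (i < j)%N -> T' i j = 0) ->
  (forall m, htrace g (gen f) m (t m)) -> (forall m, (M <= m)%N -> t m = 0) ->
  (\poly_(m < M) t m) * \prod_i (1 - T' i i *: 'X) = \prod_i (1 - T i i *: 'X^r).
Proof.
move=> fr r1 gf trT kf z1 zX gz trT' ht tM.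
have kz : hkoszul z.
  move=> m k v _; apply: (@koszul_exact_gen _ _ 1 z) => i.
  by rewrite expr1.
have [t0 ht0] := choice (fun m => @htrace_exists _ m (ideal0 S)).
have hz m := htrace_linear_forms m z1 zX.
apply/polyP => i.
set p := (\poly_(m < M) t m); set q := \prod_i _; set w := \prod_i _.
(* The truncation must see all of t and also the coefficient i being compared. *)
pose N := (maxn M i.+1); have iN : (i < N)%N by rewrite leq_max ltnSn orbT.
have pN : p = \poly_(m < N) t m.
  apply/polyP => j; rewrite !coef_poly /N leq_max; case: ltnP => //= jM.
  by rewrite tM // if_same.
have oneN : (1 : {poly K}) = \poly_(m < N) (m == 0%N)%:R.
  apply/polyP => j; rewrite coef_poly coef1; case: ltnP => // Nj; case: eqP => // j0.
  by move: (leq_trans iN Nj); rewrite j0.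
have /(_ N) Ef := htrace_series fr r1 gf trT kf ht0 ht.
have /(_ N) Ez := htrace_series z1 isT gz trT' kz ht0 hz.
have E1 : eqX N (p * q) (w * (\poly_(m < N) t0 m) * q) by rewrite pN; apply: eqXM.
have E2 : eqX N (w * 1) (w * (q * \poly_(m < N) t0 m)).
  by apply: eqXM => //; rewrite oneN.
by rewrite (E1 i iN) -mulrA (mulrC _ q) -(E2 i iN) mulr1.
Qed.

End HilbertSeries.

(** * Modules over presented algebras and relations in the Cherednik algebra *)

Section PresentedAlgebraModule.
Variables (K : comPzRingType) (X : Type) (rel : aterm K X -> aterm K X -> Prop).
Variables (V : zmodType) (sc : K -> V -> V) (op : X -> V -> V).

Fixpoint aeval (a : aterm K X) (z : V) : V :=
  match a with
  | AGen x => op x z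
  | ACst k => sc k z
  | AAdd a b => aeval a z + aeval b z
  | AMul a b => aeval a (aeval b z)
  end.

Record is_palg_action : Prop := PalgAction {
  paction1 : forall z, sc 1 z = z;
  pactionD : forall k k' z, sc (k + k') z = sc k z + sc k' z;
  pactionM : forall k k' z, sc (k * k') z = sc k (sc k' z);
  pactionB : forall k z z', sc k (z + z') = sc k z + sc k z';
  paction_opD : forall x z z', op x (z + z') = op x z + op x z';
  paction_opZ : forall x k z, op x (sc k z) = sc k (op x z);
  paction_rel : forall a b, rel a b -> forall z, aeval a z = aeval b z }.

(** An alias of V indexed by the proof that the relations hold: V may carry a module structure
    already, and here the coefficients of C[h] act besides H. *)
Definition palg_module (_ : is_palg_action) : Type := V.

Variable H : is_palg_action.
HB.instance Definition _ := GRing.Zmodule.on (palg_module H).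

Lemma aevalD a z z' : aeval a (z + z') = aeval a z + aeval a z'.
Proof.
elim: a z z' => [x|k|a IHa b IHb|a IHa b IHb] z z' /=.
- exact: (paction_opD H).
- exact: (pactionB H).
- by rewrite IHa IHb addrACA.
- by rewrite IHb IHa.
Qed.

Lemma aevalZ a k z : aeval a (sc k z) = sc k (aeval a z).
Proof.
elim: a z => [x|k'|a IHa b IHb|a IHa b IHb] z /=.
- exact: (paction_opZ H).
- by rewrite -!(pactionM H) mulrC.
- by rewrite IHa IHb (pactionB H).
- by rewrite IHb IHa.
Qed.

Lemma sc0 z : sc 0 z = 0.
Proof. by apply: (addrI (sc 0 z)); rewrite -(pactionD H) !addr0. Qed.

Lemma aeval_cong a b : acong rel a b -> forall z, aeval a z = aeval b z.
Proof.
elim=> {a b} /=.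
- by move=> a b /(paction_rel H).
- by [].
- by move=> a b _ IH z; rewrite IH.
- by move=> b a c _ IH _ IH' z; rewrite IH IH'.
- by move=> a a' b b' _ IH _ IH' z; rewrite IH IH'.
- by move=> a a' b b' _ IH _ IH' z; rewrite IH IH'.
- by move=> a b c z; rewrite addrA.
- by move=> a b z; rewrite addrC.
- by move=> a z; rewrite sc0 add0r.
- by move=> a z; rewrite -[X in _ + X](paction1 H) -(pactionD H) addNr !sc0.
- by [].
- by move=> a z; rewrite (paction1 H).
- by [].
- by move=> a b c z; rewrite aevalD.
- by move=> k k' z; rewrite (pactionD H).
- by move=> k k' z; rewrite (pactionM H).
- by move=> k a z; rewrite aevalZ.
Qed.

Definition pscale (h : palg rel) (z : palg_module H) : palg_module H := aeval (repr h) z.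

Lemma pscale_pi a z : pscale (\pi_(palg rel) a) z = aeval a z.
Proof. exact/aeval_cong/palg_reprP. Qed.

Fact pscaleA h k z : pscale h (pscale k z) = pscale (h * k) z.
Proof.
elim/quotW: h => a; elim/quotW: k => b.
have -> : \pi_(palg rel) a * \pi_(palg rel) b = \pi_(palg rel) (AMul a b) :> palg rel.
  exact: pmul_pi.
by rewrite !pscale_pi.
Qed.
Fact pscale1 : left_id 1 pscale.
Proof. by move=> z; rewrite [LHS]pscale_pi /= (paction1 H). Qed.
Fact pscaleDr : right_distributive pscale +%R.
Proof. by move=> h z z'; apply: aevalD. Qed.
Fact pscaleDl z : {morph pscale^~ z : h k / h + k}.
Proof.
move=> h k; elim/quotW: h => a; elim/quotW: k => b.
have -> : \pi_(palg rel) a + \pi_(palg rel) b = \pi_(palg rel) (AAdd a b) :> palg rel.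
  exact: padd_pi.
by rewrite !pscale_pi.
Qed.
HB.instance Definition _ := GRing.Zmodule_isLmodule.Build (palg rel) (palg_module H)
  pscaleA pscale1 pscaleDr pscaleDl.

End PresentedAlgebraModule.

Section CherednikRelations.
Variables (R : realType) (l : nat) (D : cherednik_datum R l).
Local Notation C := R[i].
Local Notation refl := (fun s : D => complex_reflection (crep D s)).
Local Notation H := (cherednik D).
Local Notation hc := (hc D).
Local Notation hx := (hx D).
Local Notation hy := (hy D).
Local Notation pi := (\pi_(palg (@crel R l D))).

Lemma piD a b : pi (AAdd a b) = pi a + pi b :> H.
Proof. exact/esym/padd_pi. Qed.
Lemma piM a b : pi (AMul a b) = pi a * pi b :> H.
Proof. exact/esym/pmul_pi. Qed.
Lemma pi_rel a b : crel a b -> pi a = pi b :> H.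
Proof. by move=> ab; apply/eqP/palg_eqP/ac_rel. Qed.
Lemma pi_cong a b : acong (@crel R l D) a b -> pi a = pi b :> H.
Proof. by move=> ab; apply/eqP/palg_eqP. Qed.

Lemma hc1 : hc 1 = 1. Proof. by []. Qed.
Lemma hcD a b : hc (a + b) = hc a + hc b.
Proof. by rewrite -piD; apply/pi_cong/ac_cstD. Qed.
Lemma hcM a b : hc (a * b) = hc a * hc b.
Proof. by rewrite -piM; apply/pi_cong/ac_cstM. Qed.
Lemma hcB a b : hc (a - b) = hc a - hc b.
Proof. by apply/eqP; rewrite eq_sym subr_eq -hcD subrK. Qed.
HB.instance Definition _ := GRing.isZmodMorphism.Build C H hc hcB.
Lemma hc_is_monoid_morphism : monoid_morphism hc.
Proof. by split=> //; exact: hcM. Qed.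
HB.instance Definition _ := GRing.isMonoidMorphism.Build C H hc hc_is_monoid_morphism.
Lemma hcC a (h : H) : hc a * h = h * hc a.
Proof. by elim/quotW: h => b; rewrite -!piM; apply/pi_cong/ac_cstC. Qed.

Lemma hg1 : hg 1%g = 1 :> H. Proof. exact/pi_rel/cr_one. Qed.
Lemma hxP a x x' : hx (a *: x + x') = hc a * hx x + hx x'.
Proof. by rewrite -piM -piD; apply/pi_rel/cr_xlin. Qed.
Lemma hyP a y y' : hy (a *: y + y') = hc a * hy y + hy y'.
Proof. by rewrite -piM -piD; apply/pi_rel/cr_ylin. Qed.
Lemma hg_x (g : D) x : hg g * hx x = hx (x *m crep D (g^-1)%g) * hg g.
Proof. by rewrite -!piM; apply/pi_rel/cr_gx. Qed.
Lemma hxx x x' : hx x * hx x' = hx x' * hx x.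
Proof. by rewrite -!piM; apply/pi_rel/cr_xx. Qed.
Lemma hyx y x : hy y * hx x = hx x * hy y + (hc (pair x y) -
  \sum_(s : D | refl s) hc (cparam s * pair (calpha s) y * pair x (calphav s)) * hg s).
Proof.
have := pi_rel (@cr_yx R l D y x).
rewrite !(piD, piM) (big_morph (\pi_(palg (@crel R l D))) piD (erefl _)).
rewrite -[pi (ACst (-1))]/(hc (-1)) raddfN /= hc1 !mulN1r => E.
have -> : hy y * hx x = hx x * hy y + (hy y * hx x - hx x * hy y) by rewrite addrC subrK.
congr (_ + _); rewrite [LHS]E; congr (_ - _).
by apply: eq_bigr => s _; rewrite piM.
Qed.

Lemma hxD x x' : hx (x + x') = hx x + hx x'.
Proof. by rewrite -[x in LHS]scale1r hxP hc1 mul1r. Qed.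
Lemma hxB x x' : hx (x - x') = hx x - hx x'.
Proof. by apply/eqP; rewrite eq_sym subr_eq -hxD subrK. Qed.
HB.instance Definition _ := GRing.isZmodMorphism.Build 'rV[C]_l H hx hxB.
Lemma hxZ a x : hx (a *: x) = hc a * hx x.
Proof. by rewrite -[a *: x]addr0 hxP raddf0 addr0. Qed.
Lemma hyD y y' : hy (y + y') = hy y + hy y'.
Proof. by rewrite -[y in LHS]scale1r hyP hc1 mul1r. Qed.
Lemma hyB y y' : hy (y - y') = hy y - hy y'.
Proof. by apply/eqP; rewrite eq_sym subr_eq -hyD subrK. Qed.
HB.instance Definition _ := GRing.isZmodMorphism.Build 'cV[C]_l H hy hyB.
Lemma hyZ a y : hy (a *: y) = hc a * hy y.
Proof. by rewrite -[a *: y]addr0 hyP raddf0 addr0. Qed.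

End CherednikRelations.

(** * Dunkl operators *)

Section Reflections.
Variables (R : realType) (l : nat) (D : cherednik_datum R l).
Local Notation C := R[i].
Local Notation refl := (fun s : D => complex_reflection (crep D s)).
Implicit Types (x : 'rV[C]_l) (y : 'cV[C]_l) (g s : D).

Lemma crep1 : crep D 1%g = 1%:M. Proof. exact: repr_mx1. Qed.
Lemma crepM g h : crep D (g * h)%g = crep D g *m crep D h.
Proof. by rewrite repr_mxM ?inE. Qed.
Lemma crepKV g : crep D g *m crep D g^-1%g = 1%:M.
Proof. by rewrite -crepM mulgV crep1. Qed.
Lemma crepVK g : crep D g^-1%g *m crep D g = 1%:M.
Proof. by rewrite -crepM mulVg crep1. Qed.
Lemma crep_unit g : crep D g \in unitmx.
Proof. by case: (mulmx1_unit (crepKV g)). Qed.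

Lemma pairDl x x' y : pair (x + x') y = pair x y + pair x' y.
Proof. by rewrite /pair mulmxDl mxE. Qed.
Lemma pairDr x y y' : pair x (y + y') = pair x y + pair x y'.
Proof. by rewrite /pair mulmxDr mxE. Qed.
Lemma pairZl a x y : pair (a *: x) y = a * pair x y.
Proof. by rewrite /pair -scalemxAl mxE. Qed.
Lemma pairZr a x y : pair x (a *: y) = a * pair x y.
Proof. by rewrite /pair -scalemxAr mxE. Qed.
Lemma pairNl x y : pair (- x) y = - pair x y.
Proof. by rewrite /pair mulNmx mxE. Qed.
Lemma pairNr x y : pair x (- y) = - pair x y.
Proof. by rewrite /pair mulmxN mxE. Qed.
Lemma pairBl x x' y : pair (x - x') y = pair x y - pair x' y.
Proof. by rewrite pairDl pairNl. Qed.
Lemma pairBr x y y' : pair x (y - y') = pair x y - pair x y'.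
Proof. by rewrite pairDr pairNr. Qed.
Lemma pair0l y : pair 0 y = 0. Proof. by rewrite /pair mul0mx mxE. Qed.
Lemma pair0r x : pair x 0 = 0. Proof. by rewrite /pair mulmx0 mxE. Qed.
Lemma pair_mul x (A : 'M_l) y : pair (x *m A) y = pair x (A *m y).
Proof. by rewrite /pair mulmxA. Qed.
Lemma pair_delta x i : pair x (delta_mx i 0) = x 0 i.
Proof. by rewrite /pair -colE mxE. Qed.
Lemma pairE x y : pair x y = \sum_i x 0 i * y i 0.
Proof. by rewrite /pair mxE. Qed.

Lemma pair_nondeg y y' : (forall x, pair x y = pair x y') -> y = y'.
Proof. by move=> E; apply/colP => i; have := E (delta_mx 0 i); rewrite /pair -!rowE !mxE. Qed.

Section OneReflection.
Variable s : D.
Hypothesis rs : refl s.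

Lemma calpha_neq0 : calpha s != 0.
Proof.
apply: contra_eq_neq (cpair2 rs) => ->; rewrite pair0l eq_sym.
by rewrite pnatr_eq0.
Qed.

Lemma clam_neq0 : clam s != 0.
Proof.
apply: contra_neq calpha_neq0 => l0; have := calphaE rs; rewrite l0 scale0r.
move/(congr1 (mulmx^~ (crep D s))); rewrite -mulmxA -crepM mulVg crep1 mulmx1 mul0mx.
by [].
Qed.

Lemma calphavVE : crep D s^-1%g *m calphav s = clam s *: calphav s.
Proof.
have := congr1 (mulmx (clam s *: crep D s^-1%g)) (calphavE rs).
rewrite -scalemxAl mulmxA crepVK mul1mx => ->.
by rewrite -scalemxAl -scalemxAr scalerA mulfV ?clam_neq0 // scale1r.
Qed.

(** The image of 1 - s on the dual space is a line by the rank condition and contains alpha_s;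
    pairing with alpha_s^v gives the coefficient. *)
Lemma reflect_x x :
  x - x *m crep D s^-1%g = ((1 - clam s) / 2 * pair x (calphav s)) *: calpha s.
Proof.
have r1 : \rank (1%:M - crep D s^-1%g) = 1%N.
  have -> : 1%:M - crep D s^-1%g = (- (1%:M - crep D s)) *m crep D s^-1%g.
    by rewrite opprB mulmxBl crepKV mul1mx.
  rewrite mxrankMfree ?row_free_unit ?crep_unit // mxrank_opp.
  by case/andP: rs => _ /eqP.
have l1 : 1 - clam s != 0 by rewrite subr_eq0 eq_sym clam_neq1.
have sub : (calpha s <= 1%:M - crep D s^-1%g)%MS.
  have -> : calpha s = (1 - clam s)^-1 *: calpha s *m (1%:M - crep D s^-1%g).
    rewrite -scalemxAl mulmxBr mulmx1 calphaE // -{2}[calpha s]scale1r -scalerBl.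
    by rewrite scalerA mulVf // scale1r.
  exact: submxMl.
have sub' : (1%:M - crep D s^-1%g <= calpha s)%MS.
  by rewrite -(geq_leqif (mxrank_leqif_sup sub)) r1 lt0n mxrank_eq0 calpha_neq0.
have /sub_rVP [k kE] : (x *m (1%:M - crep D s^-1%g) <= calpha s)%MS.
  exact: submx_trans (submxMl _ _) sub'.
rewrite mulmxBr mulmx1 in kE; rewrite kE; congr (_ *: _).
have := congr1 (fun z => pair z (calphav s)) kE.
rewrite pairBl pair_mul calphavVE pairZr pairZl cpair2 // => E.
have two0 : (2 : C) != 0 by rewrite pnatr_eq0.
by apply: (mulIf two0); rewrite -E mulrAC divfK // mulrBl mul1r.
Qed.

Lemma reflect_y y :
  y - crep D s *m y = (- (1 - clam s) / 2 / clam s * pair (calpha s) y) *: calphav s.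
Proof.
apply: pair_nondeg => x; rewrite pairBr -pair_mul -pairBl.
have := reflect_x (x *m crep D s); rewrite -mulmxA crepKV mulmx1 => E.
rewrite -[x - _]opprB E -scaleNr pairZl pairZr pair_mul calphavE // pairZr.
by rewrite !mulNr !mulrA [in RHS]mulrAC.
Qed.

Lemma trace_reflection : \tr (1%:M - crep D s^-1%g) = 1 - clam s.
Proof.
have -> : 1%:M - crep D s^-1%g = ((1 - clam s) / 2) *: (calphav s *m calpha s).
  apply/row_matrixP => i; rewrite !rowE mulmxBr mulmx1 reflect_x -scalemxAr mulmxA.
  by rewrite -scalerA /pair [_ *m calphav s]mx11_scalar mul_scalar_mx mxE.
rewrite linearZ /= mxtrace_mulC [_ *m _]mx11_scalar -[_ 0 0]/(pair _ _) cpair2 //.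
by rewrite mxtrace_scalar mulr1n divfK // pnatr_eq0.
Qed.

End OneReflection.

Lemma refl_conj g s : refl s -> refl (s ^ g)%g.
Proof.
have crepJ : crep D (s ^ g)%g = crep D g^-1%g *m crep D s *m crep D g.
  by rewrite conjgE !crepM mulmxA.
rewrite /complex_reflection => /andP [/asboolP [P Pu Pd] /eqP r1]; apply/andP; split.
  have Qu : P *m crep D g \in unitmx by rewrite unitmx_mul Pu crep_unit.
  apply/asboolP; exists (P *m crep D g); first exact: Qu.
  rewrite /similar_to conjumx // crepJ -!mulmxA (mulmxA (crep D g)) crepKV mul1mx.
  have -> : crep D g *m invmx (P *m crep D g) = invmx P.
    apply: (can_inj (mulKmx Pu)); rewrite mulmxV // mulmxA mulmxV //.
  by move: Pd; rewrite /similar_to conjumx // mulmxA.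
have -> : 1%:M - crep D (s ^ g)%g = crep D g^-1%g *m (1%:M - crep D s) *m crep D g.
  by rewrite mulmxBr mulmx1 mulmxBl crepVK crepJ.
rewrite mxrankMfree ?row_free_unit ?crep_unit //.
by rewrite eqmxMfull ?row_full_unit ?crep_unit // r1.
Qed.

(** [clam] is chosen for each s separately; the trace of 1 - s^-1 recovers it. *)
Lemma clam_conj g s : refl s -> clam (s ^ g)%g = clam s.
Proof.
move=> rs; have rsg := refl_conj g rs.
have E : \tr (1%:M - crep D (s ^ g)^-1%g) = \tr (1%:M - crep D s^-1%g).
  rewrite !raddfB /= -conjVg conjgE !crepM mulmxA mxtrace_mulC mulmxA crepKV mul1mx //.
by move: E; rewrite !trace_reflection // => /addrI /oppr_inj.
Qed.

Definition kap s : C := 2 * cparam s / (1 - clam s).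

Lemma kap_conj g s : refl s -> kap (s ^ g)%g = kap s.
Proof. by move=> rs; rewrite /kap clam_conj // cparam_conj. Qed.

(* The coefficient of s in -[y, x]. *)
Definition cxy s x y : C := kap s * pair (x - x *m crep D s^-1%g) y.

Lemma cxyE s x y : refl s ->
  cxy s x y = cparam s * pair (calpha s) y * pair x (calphav s).
Proof.
move=> rs; rewrite /cxy reflect_x // pairZl /kap.
have l1 : 1 - clam s != 0 by rewrite subr_eq0 eq_sym clam_neq1.
have two0 : (2 : C) != 0 by rewrite pnatr_eq0.
by rewrite [RHS]mulrAC !mulrA divfK // (mulrC 2) mulfK.
Qed.

(** The form of [cxy] through 1 - s serves here: the chosen alpha_s and alpha_s^v need not be
    permuted by conjugation. *)
Lemma cxy_conj g s x y : refl s ->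
  cxy (s ^ g)%g x y = cxy s (x *m crep D g^-1%g) (crep D g *m y).
Proof.
move=> rs; rewrite /cxy kap_conj //; congr (_ * _).
rewrite -[in RHS]pair_mul mulmxBl -!mulmxA crepVK mulmx1; congr (pair (_ - _) _).
by rewrite -conjVg conjgE !crepM.
Qed.

Lemma sum_refl_conj (T : nmodType) g (F : D -> T) :
  \sum_(s | refl s) F s = \sum_(s | refl s) F (s ^ g)%g.
Proof.
rewrite (reindex_inj (conjg_inj g)); apply: eq_bigl => s.
apply/idP/idP; last exact: refl_conj.
by move=> /(refl_conj g^-1%g); rewrite conjgK.
Qed.

End Reflections.

Section PolynomialOperators.
Variables (R : realType) (l : nat) (D : cherednik_datum R l).
Local Notation C := R[i].
Local Notation S := {mpoly C[l]}.
Local Notation refl := (fun s : D => complex_reflection (crep D s)).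
Implicit Types (x : 'rV[C]_l) (y : 'cV[C]_l) (g s : D) (f : S).

Lemma mpoly_mulX_ind (P : S -> Prop) :
  (forall f h, P f -> P h -> P (f + h)) -> (forall i f, P f -> P ('X_i * f)) ->
  (forall c, P c%:MP) -> forall f, P f.
Proof.
move=> PD PX PC; have PM (k : 'X_{1..l}) c : P (c%:MP * 'X_[k]).
  rewrite (multinomUE_id k) -big_enum /=.
  elim: (enum _) => [|i t IH]; first by rewrite big_nil mpolyX0 mulr1.
  rewrite big_cons mpolyXD mulrCA -mpolyXn.
  by elim: (k i) => [|n IHn]; rewrite ?mul1r // exprS -mulrA; apply: PX.
move=> f; rewrite (mpolyE f); apply: (big_ind P) => //.
  by rewrite -(mpolyC0 l); apply: PC.
by move=> k _; rewrite -mul_mpolyC; apply: PM.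
Qed.

(* Sealed, to keep unification from unfolding the operators. *)
Fact lin_key : {F : 'rV[C]_l -> S | F = fun x => \sum_i x 0 i *: 'X_i}.
Proof. by eexists. Qed.
Definition lin x : S := sval lin_key x.

Lemma linE x : lin x = \sum_i x 0 i *: 'X_i.
Proof. by rewrite /lin; rewrite (svalP lin_key). Qed.

Lemma linP : linear lin.
Proof.
move=> a x x'; rewrite !linE scaler_sumr -big_split; apply: eq_bigr => i _ /=.
by rewrite !mxE scalerDl scalerA.
Qed.
HB.instance Definition _ := GRing.isLinear.Build C 'rV[C]_l S _ lin linP.

Lemma lin_delta i : lin (delta_mx 0 i) = 'X_i.
Proof.
rewrite linE (bigD1 i) //= mxE !eqxx scale1r big1 ?addr0 // => j ji.
by rewrite mxE (negbTE ji) andbF scale0r.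
Qed.

Lemma lin_homog x : lin x \is 1.-homog.
Proof. by rewrite linE; apply: rpred_sum => i _; apply/rpredZ; rewrite dhomogX; exact/eqP/mdeg1. Qed.

Lemma lin_eq0 x : lin x = 0 -> x = 0.
Proof.
move=> x0; apply/rowP => i; have := congr1 (mcoeff U_(i)) x0.
rewrite linE raddf_sum mcoeff0 mxE (bigD1 i) //= mcoeffZ mcoeffXU eqxx mulr1 big1 ?addr0 //.
by move=> j /negbTE ji; rewrite mcoeffZ mcoeffXU ji mulr0.
Qed.

Fact gS_key : {F : D -> S -> S |
  F = fun g => comp_mpoly [tuple lin (row i (crep D g^-1%g)) | i < l]}.
Proof. by eexists. Qed.
Definition gS g : S -> S := sval gS_key g.

Lemma gSE g : gS g = comp_mpoly [tuple lin (row i (crep D g^-1%g)) | i < l].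
Proof. by rewrite /gS; rewrite (svalP gS_key). Qed.

Lemma gS_is_linear g : linear (gS g).
Proof. rewrite gSE; exact: linearP. Qed.
Lemma gS_is_monoid_morphism g : monoid_morphism (gS g).
Proof. rewrite gSE; split; [exact: rmorph1 | exact: rmorphM]. Qed.
HB.instance Definition _ g := GRing.isLinear.Build C S S _ (gS g) (gS_is_linear g).
HB.instance Definition _ g :=
  GRing.isMonoidMorphism.Build S S (gS g) (gS_is_monoid_morphism g).

Lemma gS_X g i : gS g 'X_i = lin (row i (crep D g^-1%g)).
Proof. by rewrite gSE comp_mpolyXU -tnth_nth tnth_mktuple. Qed.

Lemma gS_lin g x : gS g (lin x) = lin (x *m crep D g^-1%g).
Proof.
rewrite linE linear_sum /= (mulmx_sum_row x) linear_sum /=.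
by apply: eq_bigr => i _; rewrite !linearZ /= gS_X.
Qed.

Lemma gS_C g c : gS g c%:MP = c%:MP.
Proof. by rewrite gSE comp_mpolyC. Qed.

Lemma gS1 f : gS 1%g f = f.
Proof.
elim/mpoly_mulX_ind: f => [f h Ef Eh|i f Ef|c].
- by rewrite rmorphD /= Ef Eh.
- by rewrite rmorphM /= Ef gS_X invg1 crep1 rowE mulmx1 lin_delta.
- exact: gS_C.
Qed.

Lemma gSM g h f : gS (g * h)%g f = gS g (gS h f).
Proof.
elim/mpoly_mulX_ind: f => [f k Ef Ek|i f Ef|c].
- by rewrite !rmorphD /= Ef Ek.
- by rewrite !rmorphM /= Ef !gS_X gS_lin -row_mul -crepM invMg.
- by rewrite !gS_C.
Qed.

Lemma gS_homog g m f : f \is m.-homog -> gS g f \is m.-homog.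
Proof.
have gX (k : 'X_{1..l}) : gS g 'X_[k] \is (mdeg k).-homog.
  rewrite gSE comp_mpolyX mdegE -big_enum -[in X in X.-homog]big_enum /=.
  elim: (enum _) => [|i t IH]; first by rewrite !big_nil dhomog1.
  rewrite !big_cons; apply: dhomogM => //; rewrite tnth_mktuple -[X in X.-homog]mul1n.
  exact/dhomogMn/lin_homog.
move=> /dhomogP fm; rewrite (mpolyE f) linear_sum big_seq.
by apply: rpred_sum => k /fm <-; rewrite linearZ; apply/rpredZ/gX.
Qed.

Fact dS_key : {F : 'cV[C]_l -> S -> S | F = fun y f => \sum_i y i 0 *: mderiv i f}.
Proof. by eexists. Qed.
Definition dS y f : S := sval dS_key y f.

Lemma dSE y f : dS y f = \sum_i y i 0 *: mderiv i f.
Proof. by rewrite /dS; rewrite (svalP dS_key). Qed.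

Lemma dSP y : linear (dS y).
Proof.
move=> a f h; rewrite !dSE scaler_sumr -big_split; apply: eq_bigr => i _ /=.
by rewrite linearP scalerDr !scalerA mulrC.
Qed.
HB.instance Definition _ y := GRing.isLinear.Build C S S _ (dS y) (dSP y).

Lemma dS_lin y x f : dS y (lin x * f) = lin x * dS y f + (pair x y)%:MP * f.
Proof.
have -> : (pair x y)%:MP = \sum_i (x 0 i * y i 0)%:MP :> S.
  by rewrite pairE (raddf_sum (@mpolyC l C : {additive C -> S})).
rewrite [LHS]dSE.
transitivity (\sum_i (lin x * (y i 0 *: mderiv i f) + (x 0 i * y i 0)%:MP * f)); last first.
  by rewrite big_split /= -mulr_sumr -mulr_suml dSE.
apply: eq_bigr => i _ /=.
rewrite mderivM scalerDr addrC -scalerAr; congr (_ + _).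
have -> : (lin x)^`M(i) = (x 0 i)%:MP.
  rewrite linE linear_sum (bigD1 i) //= linearZ /= mderivX mnm1E eqxx scale1r.
  rewrite (_ : (U_(i) - U_(i))%MM = 0%MM) ?mpolyX0 -?mul_mpolyC; last by apply/mnmP => j; rewrite mnmBE mnm0E subnn.
  rewrite mulr1 big1 ?addr0 // => j ji.
  by rewrite linearZ /= mderivX mnm1E (negbTE ji) scale0r scaler0.
by rewrite !mul_mpolyC scalerA mulrC.
Qed.

Lemma dS_C y c : dS y c%:MP = 0.
Proof. by rewrite dSE big1 // => i _; rewrite mderivC scaler0. Qed.

Lemma divdiff_lin_aux (L A B f h f' h' : S) a :
  L * A = f - f' -> L * B = h - h' -> L * (a *: A + B) = a *: f + h - (a *: f' + h').
Proof.
move=> EA EB; rewrite mulrDr -scalerAr EA EB.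
by rewrite scalerBr opprD addrACA.
Qed.

(** The twisted Leibniz rule X f - X' f' = X (f - f') + (X - X') f', divided by L. *)
Lemma divdiff_mul_aux (L A X X' f f' : S) k :
  L * A = f - f' -> X - X' = k *: L -> L * (X * A + k%:MP * f') = X * f - X' * f'.
Proof.
move=> EA EX; rewrite mulrDr mulrCA EA [L * _]mulrCA mulrA mul_mpolyC -EX.
by rewrite mulrBr mulrBl addrA subrK.
Qed.

(** The operator (1 - s) / alpha_s. It is set to 0 when s is not a reflection, so that it is linear
    for every s. *)
Fact divdiff_key : {F : D -> S -> S | F = fun s f => if `[< refl s >] then
  xget 0 [set q | lin (calpha s) * q = f - gS s f]%classic else 0}.
Proof. by eexists. Qed.
Definition divdiff s f : S := sval divdiff_key s f.

Lemma divdiff_def s f : divdiff s f = if `[< refl s >] then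
  xget 0 [set q | lin (calpha s) * q = f - gS s f]%classic else 0.
Proof. by rewrite /divdiff; rewrite (svalP divdiff_key). Qed.

Lemma divdiff_uniq s f q : refl s -> lin (calpha s) * q = f - gS s f -> divdiff s f = q.
Proof.
move=> rs E; rewrite !divdiff_def asboolT //; case: xgetP => [q' _ /= E'|/(_ q)]; last by rewrite /= E.
apply: (mulfI (x := lin (calpha s))); last by rewrite E E'.
by apply: contra_neq (calpha_neq0 rs) => /lin_eq0.
Qed.

Lemma divdiffE s f : refl s -> lin (calpha s) * divdiff s f = f - gS s f.
Proof.
move=> rs; suff [q E] : exists q, lin (calpha s) * q = f - gS s f by rewrite (divdiff_uniq rs E).
elim/mpoly_mulX_ind: f => [f h [q E] [q' E']|i f [q E]|c].
- by exists (q + q'); rewrite mulrDr E E' rmorphD opprD addrACA.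
- exists ('X_i * q + ((1 - clam s) / 2 * pair (delta_mx 0 i) (calphav s))%:MP * gS s f).
  rewrite (rmorphM (gS s)); apply: (divdiff_mul_aux E).
  have := congr1 lin (reflect_x rs (delta_mx 0 i)).
  by rewrite linearB linearZ /= -gS_lin lin_delta.
- by exists 0; rewrite mulr0 gS_C subrr.
Qed.

Lemma divdiffP s : linear (divdiff s).
Proof.
move=> a f h; have [rs|nrs] := pselect (refl s); last by rewrite !divdiff_def asboolF // scaler0 addr0.
apply: (divdiff_uniq rs).
rewrite (linearP (gS s)); apply: divdiff_lin_aux; exact: divdiffE.
Qed.
HB.instance Definition _ s := GRing.isLinear.Build C S S _ (divdiff s) (divdiffP s).

Lemma divdiff_lin s x f : refl s -> divdiff s (lin x * f)
  = lin x * divdiff s f + ((1 - clam s) / 2 * pair x (calphav s))%:MP * gS s f.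
Proof.
move=> rs; apply: (divdiff_uniq rs).
rewrite (rmorphM (gS s)); apply: (divdiff_mul_aux (divdiffE f rs)).
by have := congr1 lin (reflect_x rs x); rewrite linearB linearZ /= -gS_lin.
Qed.

Lemma divdiff_C s c : divdiff s c%:MP = 0.
Proof.
have [rs|nrs] := pselect (refl s); last by rewrite !divdiff_def asboolF.
by apply: (divdiff_uniq rs); rewrite mulr0 gS_C subrr.
Qed.

Lemma dS_homog y m f : f \is m.+1.-homog -> dS y f \is m.-homog.
Proof.
move=> /dhomogP fm; rewrite dSE; apply: rpred_sum => i _; apply: rpredZ.
apply/dhomogP => k; rewrite mcoeff_msupp mcoeff_deriv => k0.
have /fm : (k + U_(i))%MM \in msupp f.
  by rewrite mcoeff_msupp; apply: contraNneq k0 => ->; rewrite mul0rn.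
by move=> E; have : mdeg (k + U_(i))%MM = m.+1 := E; rewrite mdegD mdeg1 addn1 => -[].
Qed.

Lemma divdiff_homog s m f : f \is m.+1.-homog -> divdiff s f \is m.-homog.
Proof.
have [rs|nrs] := pselect (refl s); last by rewrite !divdiff_def asboolF // dhomog0.
move=> fm; have E := divdiffE f rs.
(* The degree m part of the quotient is again a quotient, and quotients are unique. *)
suff -> : divdiff s f = pihomog mdeg m (divdiff s f) by apply: pihomogP.
apply: (divdiff_uniq rs).
have := pihomogM m.+1 (divdiff s f) (lin_homog (calpha s)).
rewrite E pihomogB (pihomog_dE fm) (pihomog_dE (gS_homog s fm)).
by rewrite /shiftpi /= subSS subn0 => <-.
Qed.

End PolynomialOperators.

Lemma emap_eq0 (R R' : comNzRingType) n (A : R -> R') (z : ext R n) :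
  (forall a, A a = 0) -> emap A z = 0.
Proof. by move=> A0; elim: n z => [|n IH] z //=; rewrite !IH. Qed.

Lemma emapZD (R R' : comNzRingType) n (A B E : R -> R') c c' c'' :
  (forall a, A (c * a) = c' * B a + c'' * E a) ->
  forall z : ext R n, emap A (c *: z) = c' *: emap B z + c'' *: emap E z.
Proof. by move=> H; elim: n => [|n IH] z /=; [exact: H | rewrite !IH]. Qed.

Lemma emap_lincomb (R R' : comNzRingType) n (A B : R -> R') c (z : ext R n) :
  emap (fun f => c * A f + B f) z = c *: emap A z + emap B z.
Proof. by elim: n z => [|n IH] z //=; rewrite !IH. Qed.

Lemma ext_mpoly_ind (R : realType) l n (P : ext {mpoly R[i][l]} n -> Prop) :
  (forall z z', P z -> P z' -> P (z + z')) -> (forall i z, P z -> P ('X_i *: z)) ->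
  (forall v, P (emap (@mpolyC l R[i]) v)) -> forall z, P z.
Proof.
elim: n P => [|n IH] P PD PX PC; first exact: (mpoly_mulX_ind PD PX PC).
move=> [a b]; have -> : (a, b) = (a, 0) + (0, b) :> ext _ n.+1.
  by congr (_, _) => /=; rewrite ?addr0 ?add0r.
have e0 : emap (@mpolyC l R[i]) (0 : ext R[i] n) = 0.
  exact: (raddf0 (emap (@mpolyC l R[i] : {additive R[i] -> {mpoly R[i][l]}}))).
apply: (PD).
  apply: (IH (fun a => P (a, 0))) => [z z' Pz Pz'|i z Pz|v].
  - suff -> : (z + z', 0) = (z, 0) + (z', 0) :> ext _ n.+1 by apply: PD.
    by congr (_, _) => /=; rewrite addr0.
  - suff -> : ('X_i *: z, 0) = 'X_i *: ((z, 0) : ext _ n.+1) by apply: PX.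
    by congr (_, _) => /=; rewrite scaler0.
  - by have := PC (v, 0); rewrite /= e0.
apply: (IH (fun b => P (0, b))) => [z z' Pz Pz'|i z Pz|v].
- suff -> : (0, z + z') = (0, z) + (0, z') :> ext _ n.+1 by apply: PD.
  by congr (_, _) => /=; rewrite addr0.
- suff -> : (0, 'X_i *: z) = 'X_i *: ((0, z) : ext _ n.+1) by apply: PX.
  by congr (_, _) => /=; rewrite scaler0.
- by have := PC (0, v); rewrite /= e0.
Qed.

Lemma opprB_ACA (V : zmodType) (a b c d : V) : a - b - (c - d) = a - c - (b - d).
Proof. by rewrite !opprB addrACA [RHS]addrACA; congr (_ + _); rewrite addrC. Qed.

Section DunklModule.
Variables (R : realType) (l : nat) (D : cherednik_datum R l).
Local Notation C := R[i].
Local Notation S := {mpoly C[l]}.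
Local Notation refl := (fun s : D => complex_reflection (crep D s)).
Variables (m : nat) (rho : mx_representation C [set: D] m).
Local Notation M := (ext S m).
Local Notation cst := (emap (@mpolyC l C)).
Implicit Types (x : 'rV[C]_l) (y : 'cV[C]_l) (g s : D) (f : S) (z : M).

(** The indices are swapped because [Lam G] sends e_j to the vector [G j], here column j of the
    matrix of g. *)
Definition rhoC g (j i : 'I_m) : C := rho g i j.
Definition rhoS g (j i : 'I_m) : S := (rho g i j)%:MP.

(* On C[h] (x) /\C^m, g acts diagonally by gM, and y by the Dunkl operator
   d_y - sum_s 2 c_s / (1 - lambda_s) <alpha_s, y> (1 - s) / alpha_s, where s acts
   on the second factor as well and (1 - s) / alpha_s on the first. *)
Definition gM g z : M := emap (gS g) (Lam (rhoS g) z).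
Definition yM y z : M := emap (dS y) z -
  \sum_(s | refl s) (kap s * pair (calpha s) y)%:MP *: emap (divdiff s) (Lam (rhoS s) z).

Lemma gMP g : additive (gM g).
Proof.
move=> z z'; rewrite /gM (raddfB (Lam _)).
exact: (raddfB (emap (gS g : {additive S -> S}))).
Qed.
HB.instance Definition _ g := GRing.isZmodMorphism.Build M M (gM g) (gMP g).

Lemma gMD g z z' : gM g (z + z') = gM g z + gM g z'. Proof. exact: raddfD. Qed.
Lemma gMB g z z' : gM g (z - z') = gM g z - gM g z'. Proof. exact: raddfB. Qed.
Lemma gM0 g : gM g 0 = 0. Proof. exact: raddf0. Qed.

Lemma gMZ g f z : gM g (f *: z) = gS g f *: gM g z.
Proof.
by rewrite /gM (linearZ_LR (Lam _)) (emapZ (B := gS g) (c' := gS g f)) // => a; rewrite rmorphM.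
Qed.

Lemma Lam_rhoS_cst g v : Lam (rhoS g) (cst v) = cst (Lam (rhoC g) v).
Proof.
apply/esym; apply: (emap_Lam (A := (@mpolyC l C : {additive C -> S}))) => j i a.
exact: mpolyCM.
Qed.

Lemma gM_cst g v : gM g (cst v) = cst (Lam (rhoC g) v).
Proof.
rewrite /gM Lam_rhoS_cst emap_comp; apply: eq_emap => a /=; exact: gS_C.
Qed.

Lemma gM1 z : gM 1%g z = z.
Proof.
rewrite /gM (eq_emap (B := id)); last exact: gS1.
rewrite emap_id -[RHS]Lam1; apply: eq_Lam => j i.
by rewrite /rhoS repr_mx1 mxE eq_sym raddfMn.
Qed.

Lemma emap_LamC (A : {linear S -> S}) g z :
  emap A (Lam (rhoS g) z) = Lam (rhoS g) (emap A z).
Proof. by apply: emap_Lam => j i a; rewrite /rhoS !mul_mpolyC; exact: (linearZ_LR A). Qed.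

Lemma gMM g h z : gM (g * h)%g z = gM g (gM h z).
Proof.
rewrite /gM; have <- := emap_LamC (gS h) g (Lam (rhoS h) z).
rewrite emap_comp (_ : Lam (rhoS g) (Lam _ z) = Lam (rhoS (g * h)%g) z).
  by apply: eq_emap => a /=; rewrite gSM.
rewrite Lam_comp; apply: eq_Lam => j i.
rewrite /rhoS repr_mxM ?inE // mxE raddf_sum; apply: eq_bigr => k _.
by rewrite mulrC /= mpolyCM.
Qed.

Lemma yMP y : additive (yM y).
Proof.
move=> z z'; rewrite /yM (raddfB (emap (dS y : {additive S -> S}))).
rewrite [RHS]opprB_ACA -sumrB; congr (_ - _); apply: eq_bigr => s _ /=.
rewrite (raddfB (Lam _)) (raddfB (emap (divdiff s : {additive S -> S}))) /=.
by rewrite scalerBr.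
Qed.
HB.instance Definition _ y := GRing.isZmodMorphism.Build M M (yM y) (yMP y).

Lemma yMD y z z' : yM y (z + z') = yM y z + yM y z'. Proof. exact: raddfD. Qed.
Lemma yMB y z z' : yM y (z - z') = yM y z - yM y z'. Proof. exact: raddfB. Qed.
Lemma yM0 y : yM y 0 = 0. Proof. exact: raddf0. Qed.

(** The relation for [y, x]: the derivation d_y contributes the pairing, and the twisted Leibniz
    terms give the sum over s, as kap_s (1 - lambda_s) / 2 = c_s. *)
Lemma yM_lin y x z : yM y (lin x *: z) = lin x *: yM y z + (pair x y)%:MP *: z
  - \sum_(s | refl s) (cxy s x y)%:MP *: gM s z.
Proof.
rewrite /yM (emapZD (dS_lin y x)) emap_id scalerBr.
set A := emap (dS y) z; set P := _ *: z.
rewrite -addrA (addrAC _ _ P) -[RHS]addrA -[RHS]addrA; congr (_ + _).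
congr (_ + _); rewrite -opprD scaler_sumr; congr (- _); rewrite -big_split.
apply: eq_bigr => s rs /=.
rewrite (linearZ_LR (Lam _)) /= (emapZD (divdiff_lin x ^~ rs)) scalerDr.
rewrite !scalerA [_ * lin x]mulrC; congr (_ + _ *: _).
rewrite -mpolyCM cxyE //; congr (_%:MP); rewrite /kap.
have l1 : 1 - clam s != 0 by rewrite subr_eq0 eq_sym clam_neq1.
have two0 : (2 : C) != 0 by rewrite pnatr_eq0.
rewrite mulrA; congr (_ * _); rewrite mulrAC; congr (_ * _).
by rewrite mulrA divfK // (mulrC 2) mulfK.
Qed.

Lemma yM_cst y v : yM y (cst v) = 0.
Proof.
rewrite /yM emap_comp emap_eq0 => [|a]; last exact: dS_C.
rewrite sub0r big1 ?oppr0 // => s _.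
by rewrite Lam_rhoS_cst emap_comp emap_eq0 ?scaler0 // => a; exact: divdiff_C.
Qed.

Lemma yMZ y c z : yM y (c%:MP *: z) = c%:MP *: yM y z.
Proof.
rewrite /yM (emapZ (B := dS y) (c' := c%:MP)) => [|a]; last by rewrite !mul_mpolyC linearZ.
rewrite scalerBr scaler_sumr; congr (_ - _); apply: eq_bigr => s _.
rewrite (linearZ_LR (Lam _)) /= (emapZ (B := divdiff s) (c' := c%:MP)) => [|a]; last by rewrite !mul_mpolyC linearZ.
by rewrite !scalerA mulrC.
Qed.

Lemma yM_linear a y y' z : yM (a *: y + y') z = a%:MP *: yM y z + yM y' z.
Proof.
rewrite /yM (eq_emap (B := fun f => a%:MP * dS y f + dS y' f)); last first.
  move=> f; rewrite !dSE mulr_sumr -big_split; apply: eq_bigr => i _.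
  by rewrite !mxE scalerDl mul_mpolyC scalerA.
rewrite emap_lincomb scalerBr addrACA -opprD; congr (_ - _).
rewrite scaler_sumr -big_split; apply: eq_bigr => s _ /=.
rewrite scalerA -scalerDl -mpolyCM -mpolyCD pairDr pairZr.
by rewrite mulrDr (mulrCA (kap s)).
Qed.

(** Operator identities are checked on constants once the vanishing of the difference T is known to
    pass from z to x_i z. *)
Lemma op_eq0 (T : M -> M) : (forall z z', T (z + z') = T z + T z') ->
  (forall z i, T z = 0 -> T (lin (delta_mx 0 i) *: z) = 0) ->
  (forall v, T (cst v) = 0) -> forall z, T z = 0.
Proof.
move=> TD TX TC; apply: ext_mpoly_ind => [z z' Tz Tz'|i z Tz|//].
  by rewrite TD Tz Tz' addr0.
by rewrite -lin_delta TX.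
Qed.

Lemma gM_yM g y z : gM g (yM y z) = yM (crep D g *m y) (gM g z).
Proof.
apply/eqP; rewrite -subr_eq0; apply/eqP; move: z.
apply: op_eq0 => [z z'|z i Tz|v].
- by rewrite ?(gMD, yMD) opprD addrACA.
- move/eqP: Tz; rewrite subr_eq0 => /eqP Tz; set x := delta_mx 0 i.
  rewrite (yM_lin y) (gMZ g (lin x)) gS_lin yM_lin gMB gMD !gMZ gS_lin Tz gS_C.
  rewrite -pair_mul -mulmxA crepVK mulmx1; apply/eqP; rewrite subr_eq0; apply/eqP.
  congr (_ - _); rewrite (raddf_sum (gM g)) [RHS](sum_refl_conj g^-1%g).
  apply: eq_bigr => s rs /=; rewrite gMZ gS_C cxy_conj // invgK.
  rewrite -!gMM conjgE invgK -!mulgA mulVg mulg1; congr (_%:MP *: _).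
  by rewrite -mulmxA crepVK mulmx1 mulmxA crepVK mul1mx.
- by rewrite yM_cst gM0 gM_cst yM_cst subr0.
Qed.

Lemma yM_vec0 z : yM 0 z = 0.
Proof. by have := yM_linear 1 0 0 z; rewrite scale1r addr0 scale1r => /eqP; rewrite addrC -subr_eq subrr => /eqP. Qed.

Lemma yMvD y y' z : yM (y + y') z = yM y z + yM y' z.
Proof. by rewrite -[y in LHS]scale1r yM_linear scale1r. Qed.

Lemma yMvZ a y z : yM (a *: y) z = a%:MP *: yM y z.
Proof. by rewrite -[a *: y]addr0 yM_linear yM_vec0 addr0. Qed.

Lemma yM_comm y y' z : yM y (yM y' z) = yM y' (yM y z).
Proof.
apply/eqP; rewrite -subr_eq0; apply/eqP; move: z.
apply: op_eq0 => [z z'|z i Tz|v].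
- by rewrite ?(gMD, yMD) opprD addrACA.
- move/eqP: Tz; rewrite subr_eq0 => /eqP Tz; set x := delta_mx 0 i.
  have E (w w' : 'cV[C]_l) : yM w (yM w' (lin x *: z)) =
      (lin x *: yM w (yM w' z) + ((pair x w)%:MP *: yM w' z + (pair x w')%:MP *: yM w z))
      - \sum_(s | refl s) ((cxy s x w)%:MP *: gM s (yM w' z) + (cxy s x w')%:MP *: yM w (gM s z)).
    rewrite yM_lin yMB yMD yM_lin yMZ (raddf_sum (yM w)) /=.
    have -> : \sum_(s | refl s) ((cxy s x w)%:MP *: gM s (yM w' z) + (cxy s x w')%:MP *: yM w (gM s z))
      = \sum_(s | refl s) (cxy s x w)%:MP *: gM s (yM w' z)
        + \sum_(s | refl s) yM w ((cxy s x w')%:MP *: gM s z).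
      by rewrite -big_split; apply: eq_bigr => s _; rewrite yMZ.
    by rewrite opprD !addrA; congr (_ - _); rewrite addrAC.
  rewrite !E Tz [X in _ - (_ + X - _)]addrC.
  set S1 := \sum_(s | _) _; set S2 := \sum_(s | _) _.
  suff -> : S1 = S2 by rewrite subrr.
  apply: eq_bigr => s rs; rewrite !gM_yM -!yMvZ -!yMvD; congr yM.
  (* Both sides are multiples of alpha_s^v whose coefficient, up to a common factor, is the
     symmetric expression (y, alpha_s) (y', alpha_s) (x, alpha_s^v). *)
  have: cxy s x y *: (y' - crep D s *m y') = cxy s x y' *: (y - crep D s *m y).
    rewrite !reflect_y // !scalerA !cxyE //; congr (_ *: _).
    rewrite (mulrAC _ (pair _ y) (pair x _)) (mulrAC _ (pair _ y') (pair x _)).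
    by rewrite mulrACA [RHS]mulrACA [pair _ y * _]mulrC.
  rewrite !scalerBr => /eqP; rewrite subr_eq addrAC eq_sym subr_eq => /eqP E1.
  by rewrite [RHS]addrC -E1 addrC.
by rewrite !yM_cst !yM0 subr0.
Qed.

Local Notation H := (cherednik D).

Definition dunkl_op (a : cgen D) : M -> M :=
  match a with CG g => gM g | CX x => fun z => lin x *: z | CY y => yM y end.

Lemma dunkl_action : is_palg_action (@crel R l D) (fun (c : C) z => c%:MP *: z) dunkl_op.
Proof.
split=> [z|k k' z|k k' z|k z z'|[g|x|y] z z'|[g|x|y] k z|_ _ [] /=].
- exact: scale1r.
- by rewrite mpolyCD scalerDl.
- by rewrite mpolyCM scalerA.
- exact: scalerDr.
- exact: gMD.
- exact: scalerDr.
- exact: yMD.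
- by rewrite /= gMZ gS_C.
- by rewrite /= !scalerA mulrC.
- exact: yMZ.
- by move=> z; rewrite gM1 scale1r.
- by move=> g h z; rewrite gMM.
- by move=> a x x' z; rewrite linearP scalerDl scalerA mul_mpolyC.
- by move=> a y y' z; rewrite yM_linear.
- by move=> g x z; rewrite gMZ gS_lin.
- by move=> g y z; rewrite gM_yM.
- by move=> x x' z; rewrite !scalerA mulrC.
- by move=> y y' z; rewrite yM_comm.
move=> y x z.
have -> : aeval (fun (c : C) (z : M) => c%:MP *: z) dunkl_op
   (\big[@AAdd C (cgen D)/@ACst C (cgen D) 0]_(s : D | refl s)
    AMul (ACst (cparam s * pair (calpha s) y * pair x (calphav s))) (AGen (CG s))) z
    = \sum_(s | refl s) (cxy s x y)%:MP *: gM s z.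
  rewrite (big_morph (fun a => aeval (fun (c : C) (z : M) => c%:MP *: z) dunkl_op a z)
    (id1 := 0) (op1 := +%R)) //=; last by rewrite scale0r.
  by apply: eq_bigr => s rs; rewrite cxyE.
have -> : (-1)%:MP = -1 :> S by rewrite mpolyCN.
by rewrite yM_lin !scaleN1r [LHS]addrC -!addrA addKr.
Qed.

Definition dunkl_module : lmodType H := palg_module dunkl_action.

End DunklModule.

(** * Standard modules *)

Section ModuleLift.
Variables (R : pzRingType) (X : Type) (rel : mterm R X -> mterm R X -> Prop).
Variables (V : lmodType R) (f : X -> V).
Hypothesis fP : mrespects rel f.

Lemma mlift_linear : linear (mlift f : pmod rel -> V).
Proof.
move=> h; elim/quotW=> a; elim/quotW=> b.
have -> : h *: \pi_(pmod rel) a + \pi_(pmod rel) b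
    = \pi_(pmod rel) (MAdd (MScale h a) b) :> pmod rel.
  by rewrite [X in X + _]mscale_pi [LHS]madd_pi.
by rewrite !mlift_pi.
Qed.
HB.instance Definition _ := GRing.isLinear.Build R (pmod rel) V _ (mlift f) mlift_linear.

Definition mlift_lin : {linear pmod rel -> V} := mlift f.

End ModuleLift.

Section StandardTheory.
Variables (R : realType) (l : nat) (D : cherednik_datum R l).
Local Notation C := R[i].
Local Notation S := {mpoly C[l]}.
Local Notation H := (cherednik D).
Local Notation refl := (fun s : D => complex_reflection (crep D s)).
Local Notation hc := (hc D).
Local Notation hx := (hx D).
Local Notation hy := (hy D).

Section Standard.
Variables (T : lmodType C) (act : D -> T -> T).
Local Notation tens := (tens act).

Lemma tens_scale h v : tens h v = h *: tens 1 v.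
Proof.
rewrite [RHS]mscale_pi; apply/eqP/pmod_eqP/mc_sym/mc_rel.
by rewrite -[h in X in tensor_rel _ _ X]mulr1; apply: tr_left.
Qed.

Lemma tens_rel a b : tensor_rel act a b ->
  \pi_(pmod (tensor_rel act)) a = \pi_(pmod (tensor_rel act)) b.
Proof. by move=> ab; apply/eqP/pmod_eqP/mc_rel. Qed.

Lemma tens1D v v' : tens 1 (v + v') = tens 1 v + tens 1 v'.
Proof. by rewrite [RHS]madd_pi; apply: tens_rel; apply: tr_addr. Qed.

Lemma tens1Z a v : tens 1 (a *: v) = hc a *: tens 1 v.
Proof. by rewrite -tens_scale; apply/esym/tens_rel; rewrite -[hc a]mul1r; apply: tr_cst. Qed.

Lemma tens1_act g v : tens 1 (act g v) = hg g *: tens 1 v.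
Proof. by rewrite -tens_scale; apply/esym/tens_rel; rewrite -[hg g]mul1r; apply: tr_grp. Qed.

Lemma tens10 : tens 1 0 = 0.
Proof. by rewrite -(scale0r (0 : T)) tens1Z raddf0 scale0r. Qed.

Lemma tens1_y y v : hy y *: tens 1 v = 0.
Proof.
rewrite -tens_scale -tens10; apply/tens_rel.
by rewrite -[hy y]mul1r; apply: tr_y.
Qed.

(* By normal ordering, 1 (x) T generates M_c(T) under the x's alone. *)
Lemma standard_ind (P : standard act -> Prop) :
  (forall z z', P z -> P z' -> P (z + z')) ->
  (forall i z, P z -> P (hx (delta_mx 0 i) *: z)) ->
  (forall v, P (tens 1 v)) -> forall z, P z.
Proof.
pose closed (P : standard act -> Prop) := [/\ forall z z', P z -> P z' -> P (z + z'),
  forall i z, P z -> P (hx (delta_mx 0 i) *: z) & forall v, P (tens 1 v)].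
(* Q is the least closed predicate. Unlike P, it may be tested against translated predicates such as
   [fun w => Q (hg g *: w)], which proves it stable under H. *)
pose Q z := forall P, closed P -> P z.
move=> PD PX PT z; suff QT : Q z by apply: (QT P).
clear PD PX PT P.
have QD z' z'' : Q z' -> Q z'' -> Q (z' + z'').
  by move=> Qz' Qz'' P cP; case: (cP) => PD _ _; apply: (PD); [apply: Qz' | apply: Qz''].
have Qx i z' : Q z' -> Q (hx (delta_mx 0 i) *: z').
  by move=> Qz' P cP; case: (cP) => _ PX _; apply: PX; apply: Qz'.
have Qt v : Q (tens 1 v) by move=> P [].
have Q0 : Q 0 by rewrite -tens10.
have Qc c z' : Q z' -> Q (hc c *: z').
  move=> Qz' P [PD PX PT]; apply: (Qz' (fun w => P (hc c *: w))); split.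
  - by move=> a b Pa Pb; rewrite scalerDr; apply: (PD).
  - by move=> i a Pa; rewrite scalerA hcC -scalerA; apply: PX.
  - by move=> v; rewrite -tens1Z.
have Qsum (I : Type) (r : seq I) (p : pred I) (F : I -> standard act) :
    (forall i, p i -> Q (F i)) -> Q (\sum_(i <- r | p i) F i).
  by move=> QF; apply: (big_ind Q).
have QX x z' : Q z' -> Q (hx x *: z').
  move=> Qz'; rewrite (row_sum_delta x) raddf_sum scaler_suml /=.
  by apply: (Qsum) => i _; rewrite hxZ -scalerA; exact: Qc (Qx i _ Qz').
have QG g z' : Q z' -> Q (hg g *: z').
  move=> Qz'; apply: (Qz' (fun w => Q (hg g *: w))); split.
  - by move=> a b Pa Pb; rewrite scalerDr; apply: (QD).
  - by move=> i a Pa; rewrite scalerA hg_x -scalerA; exact: QX.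
  - by move=> v; rewrite -tens1_act.
have QY y z' : Q z' -> Q (hy y *: z').
  move=> Qz'; suff [] : Q z' /\ Q (hy y *: z') by [].
  (* Moving y past x leaves terms c w and c g w without y, so Q w is carried along. *)
  apply: (Qz' (fun w => Q w /\ Q (hy y *: w))); split.
  - by move=> a b [Qa Pa] [Qb Pb]; split; rewrite ?scalerDr; apply: (QD).
  - move=> i a [Qa Pa]; split; first exact: Qx.
    rewrite scalerA hyx scalerDl -scalerA; apply: (QD); first exact: Qx.
    rewrite scalerBl -scaleN1r scalerA; apply: (QD); first exact: Qc.
    rewrite -(hc1 D) -raddfN -scalerA; apply: (Qc); rewrite scaler_suml.
    by apply: (Qsum) => s _; rewrite -scalerA; exact: Qc (QG s _ Qa).
  - by move=> v; split=> //; rewrite tens1_y.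
have QH h z' : Q z' -> Q (h *: z').
  elim/quotW: h => a; elim: a z' => [[g|x|y]|c|a IHa b IHb|a IHa b IHb] z' Qz'.
  - exact: QG.
  - exact: QX.
  - exact: QY.
  - exact: Qc.
  - by rewrite piD scalerDl; apply: (QD); [apply: IHa|apply: IHb].
  - by rewrite piM -scalerA; exact: IHa (IHb _ Qz').
elim/quotW: z => a; elim: a => [[h v]||a IHa b IHb|h a IHa].
- rewrite -[X in Q X]/(tens h v) tens_scale; exact: QH.
- exact: Q0.
- by have := QD _ _ IHa IHb; rewrite [X in Q X -> _]madd_pi.
- by have := QH h _ IHa; rewrite [X in Q X -> _]mscale_pi.
Qed.

(** Frobenius reciprocity: M_c(T) is induced, so a map out of it is a G-equivariant map from T to
    the vectors killed by all y. *)
Lemma standard_lift (V : lmodType H) (d : T -> V) :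
  (forall v v', d (v + v') = d v + d v') -> (forall a v, d (a *: v) = hc a *: d v) ->
  (forall g v, d (act g v) = hg g *: d v) -> (forall y v, hy y *: d v = 0) ->
  {f : {linear standard act -> V} | forall v, f (tens 1 v) = d v}.
Proof.
move=> dD dZ dG dY.
have d0 : d 0 = 0 by rewrite -(scale0r (0 : T)) dZ raddf0 scale0r.
have fP : mrespects (tensor_rel act) (fun p : H * T => p.1 *: d p.2).
  move=> _ _ [h h' v|h h' v|h v v'|h a v|h g v|h y v] /=.
  - by rewrite scalerA.
  - by rewrite scalerDl.
  - by rewrite dD scalerDr.
  - by rewrite dZ scalerA.
  - by rewrite dG scalerA.
  - by rewrite -scalerA dY d0.
exists (mlift_lin fP) => v.
by rewrite [LHS](mlift_gen _ fP) scale1r.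
Qed.

End Standard.
End StandardTheory.

(** * A basis-free description of exterior powers *)

Lemma pmod_ind (R : pzRingType) (X : Type) (rel : mterm R X -> mterm R X -> Prop)
    (P : pmod rel -> Prop) :
  P 0 -> (forall u v, P u -> P v -> P (u + v)) -> (forall a u, P u -> P (a *: u)) ->
  (forall x, P (mgen rel x)) -> forall u, P u.
Proof.
move=> P0 PD PZ PG; elim/quotW; elim=> [x||a IHa b IHb|h a IHa].
- exact: PG.
- exact: P0.
- by have := PD _ _ IHa IHb; rewrite [X in P X -> _]madd_pi.
- by have := PZ h _ IHa; rewrite [X in P X -> _]mscale_pi.
Qed.

Section ExteriorPowers.
Variables (K : comNzRingType) (l : nat).
Local Notation U := 'cV[K]_l.
Local Notation Ex k := (ext_power U k).
Local Notation wdg := (@wedge K U _).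

Lemma wedge_linear k (w : {ffun 'I_k -> U}) i a x y :
  wdg (upd w i (a *: x + y)) = a *: wdg (upd w i x) + wdg (upd w i y).
Proof.
have -> : a *: wdg (upd w i x) + wdg (upd w i y) = \pi_(pmod (@ext_rel K U k))
    (MAdd (MScale a (MGen (upd w i x))) (MGen (upd w i y))) :> Ex k.
  by rewrite [X in X + _]mscale_pi [LHS]madd_pi.
exact/eqP/pmod_eqP/mc_rel/ext_multilinear.
Qed.

Lemma wedge_alt k (w : {ffun 'I_k -> U}) i j : i != j -> w i = w j -> wdg w = 0.
Proof. by move=> ij wij; apply/eqP/pmod_eqP/mc_rel/(ext_alternating ij wij). Qed.

Definition fcons k (x : U) (w : {ffun 'I_k -> U}) : {ffun 'I_k.+1 -> U} :=
  [ffun i => if unlift ord0 i is Some j then w j else x].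

Lemma fcons0 k x (w : {ffun 'I_k -> U}) : fcons x w ord0 = x.
Proof. by rewrite ffunE unlift_none. Qed.
Lemma fconsS k x (w : {ffun 'I_k -> U}) i : fcons x w (lift ord0 i) = w i.
Proof. by rewrite ffunE liftK. Qed.

Lemma fcons_upd k x (w : {ffun 'I_k -> U}) i y :
  fcons x (upd w i y) = upd (fcons x w) (lift ord0 i) y.
Proof.
apply/ffunP => j; case: (unliftP ord0 j) => [j' ->|->].
  by rewrite [RHS]ffunE !fconsS ffunE (inj_eq lift_inj).
by rewrite [RHS]ffunE !fcons0.
Qed.

Lemma fcons_upd0 k x y (w : {ffun 'I_k -> U}) : fcons x w = upd (fcons y w) ord0 x.
Proof.
apply/ffunP => j; case: (unliftP ord0 j) => [j' ->|->].
  by rewrite [RHS]ffunE !fconsS.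
by rewrite [RHS]ffunE !fcons0 eqxx.
Qed.

Lemma fcons_tl k (w : {ffun 'I_k.+1 -> U}) :
  w = fcons (w ord0) [ffun i => w (lift ord0 i)].
Proof.
apply/ffunP => j; case: (unliftP ord0 j) => [j' ->|->].
  by rewrite fconsS ffunE.
by rewrite fcons0.
Qed.

Lemma wedge_fcons_respects k x :
  mrespects (@ext_rel K U k) (fun w => wdg (fcons x w)).
Proof.
move=> _ _ [w i a y z|w i j ij wij] /=; first by rewrite !fcons_upd wedge_linear.
by apply: (@wedge_alt _ _ (lift ord0 i) (lift ord0 j)); rewrite ?(inj_eq lift_inj) ?fconsS.
Qed.

Fact wedgel_key k x : {f : {linear Ex k -> Ex k.+1} | forall w, f (wdg w) = wdg (fcons x w)}.
Proof.
by exists (mlift_lin (@wedge_fcons_respects k x)) => w;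
  exact: (mlift_gen _ (@wedge_fcons_respects k x)).
Qed.
Definition wedgel k x : {linear Ex k -> Ex k.+1} := sval (wedgel_key k x).

Lemma wedgelE k x (w : {ffun 'I_k -> U}) : wedgel k x (wdg w) = wdg (fcons x w).
Proof. exact: (svalP (wedgel_key k x)). Qed.

Lemma wedgel_lin k a x y (t : Ex k) :
  wedgel k (a *: x + y) t = a *: wedgel k x t + wedgel k y t.
Proof.
elim/pmod_ind: t => [|u v Eu Ev|b u Eu|w].
- by rewrite !(linear0 (wedgel k _)) scaler0 addr0.
- by rewrite !(linearD (wedgel k _)) /= Eu Ev scalerDr addrACA.
- by rewrite !(linearZ_LR (wedgel k _)) /= Eu scalerDr !scalerA mulrC.
- rewrite !wedgelE (fcons_upd0 (a *: x + y) 0 w) wedge_linear.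
  by rewrite -(fcons_upd0 x 0 w) -(fcons_upd0 y 0 w).
Qed.

Lemma wedgel0 k (t : Ex k) : wedgel k 0 t = 0.
Proof.
have := wedgel_lin 1 0 0 t; rewrite scale1r addr0 scale1r => /eqP.
by rewrite -subr_eq subrr eq_sym => /eqP.
Qed.

Lemma wedgel_sq k x (t : Ex k) : wedgel k.+1 x (wedgel k x t) = 0.
Proof.
elim/pmod_ind: t => [|u v Eu Ev|b u Eu|w]; first by rewrite !(linear0 (wedgel _ _)).
- by rewrite !(linearD (wedgel _ _)) /= Eu Ev addr0.
- by rewrite !(linearZ_LR (wedgel _ _)) /= Eu scaler0.
- rewrite !wedgelE; apply: (@wedge_alt _ _ ord0 (lift ord0 ord0)); first by [].
  by rewrite fconsS !fcons0.
Qed.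

Lemma wedgel_anti k x y (t : Ex k) :
  wedgel k.+1 x (wedgel k y t) = - wedgel k.+1 y (wedgel k x t).
Proof.
apply/eqP; rewrite -addr_eq0; apply/eqP; have := wedgel_sq (1 *: x + y) t.
rewrite !wedgel_lin !scale1r !(linearD (wedgel _ _)) /= !wedgel_sq add0r addr0.
by rewrite addrC.
Qed.

Definition colf (x : U) : 'I_l -> K := fun i => x i 0.

Fixpoint cwedge k : ('I_k -> U) -> ext K l :=
  match k with 0 => fun _ => vac l 1 | k'.+1 => fun w => cre (colf (w ord0)) (cwedge (tl w)) end.

Lemma cwedge_cre k (w : 'I_k -> U) j : cre (colf (w j)) (cwedge w) = 0.
Proof.
elim: k w j => [|k IH] w j /=; first by case: j.
case: (unliftP ord0 j) => [j' ->|->]; last exact: cre_sq.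
by rewrite cre_anti -/(tl w j') IH linear0 oppr0.
Qed.

Lemma cwedge_respects k : mrespects (@ext_rel K U k) (fun w => cwedge w).
Proof.
move=> _ _ [w i a x y|w i j ij wij] /=.
  elim: k w i => [|k IH] w i /=; first by case: i.
  case: (unliftP ord0 i) => [i' ->|->].
    pose w' := [ffun j => w (lift ord0 j)].
    have tlE z : tl (upd w (lift ord0 i') z) = upd w' i' z.
      by apply/funext => j; rewrite /tl !ffunE (inj_eq lift_inj).
    have w0E z : upd w (lift ord0 i') z ord0 = w ord0 by rewrite ffunE.
    by rewrite !tlE !w0E IH linearP.
  have tlE z : tl (upd w ord0 z) = tl w by apply/funext => j; rewrite /tl ffunE.
  rewrite !tlE !ffunE eqxx -cre_lin.
  by apply: eq_cre => j; rewrite /colf !mxE.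
elim: k w i j ij wij => [|k IH] w i j; first by case: i.
case: (unliftP ord0 i) => [i' ->|->]; case: (unliftP ord0 j) => [j' ->|->] //=.
- rewrite (inj_eq lift_inj) => ij wij.
  pose w' := [ffun j => w (lift ord0 j)].
  have -> : tl w = w' by apply/funext => q; rewrite /tl ffunE.
  by rewrite (IH w' i' j') ?linear0 // !ffunE.
- by move=> _ <-; exact: (cwedge_cre (tl w) i').
- by move=> _ ->; exact: (cwedge_cre (tl w) j').
Qed.

Fact Phi_key k : {f : {linear Ex k -> ext K l} | forall w : {ffun 'I_k -> U}, f (wdg w) = cwedge w}.
Proof.
by exists (mlift_lin (@cwedge_respects k)) => w;
  exact: (mlift_gen _ (@cwedge_respects k)).
Qed.
Definition Phi k : {linear Ex k -> ext K l} := sval (Phi_key k).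

Lemma Phi_wedge k (w : {ffun 'I_k -> U}) : Phi k (wdg w) = cwedge w.
Proof. exact: (svalP (Phi_key k)). Qed.

Lemma Phi_wedgel k x t : Phi k.+1 (wedgel k x t) = cre (colf x) (Phi k t).
Proof.
elim/pmod_ind: t => [|u v Eu Ev|b u Eu|w].
- by rewrite !linear0.
- by rewrite !(linearD (wedgel _ _), linearD (Phi _), linearD (cre _)) /= Eu Ev.
- by rewrite !(linearZ_LR (wedgel _ _), linearZ_LR (Phi _), linearZ_LR (cre _)) /= Eu.
- rewrite wedgelE !Phi_wedge /= fcons0; congr (cre _ (cwedge _)).
  by apply/funext => j; rewrite /tl fconsS.
Qed.

(** The vectors G replace the standard basis so that the recursion can drop the first of them; for
    the standard basis this is the inverse of [Phi] on exterior degree k. *)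
Fixpoint Psi m : ('I_m -> U) -> forall k, ext K m -> Ex k :=
  match m return ('I_m -> U) -> forall k, ext K m -> Ex k with
  | 0 => fun _ k z => if k is 0 then z *: wdg [ffun=> 0] else 0
  | m'.+1 => fun G k z => Psi (tl G) k z.1 +
      match k with 0 => 0 | k'.+1 => wedgel k' (G ord0) (Psi (tl G) k' z.2) end
  end.

Lemma PsiP m (G : 'I_m -> U) k : linear (Psi G k).
Proof.
elim: m G k => [|m IH] G [|k] a x y /=.
- by rewrite scalerDl scalerA.
- by rewrite scaler0 addr0.
- by rewrite !addr0 IH.
- by rewrite !IH linearP scalerDr addrACA.
Qed.
HB.instance Definition _ m (G : 'I_m -> U) k :=
  GRing.isLinear.Build K (ext K m) (Ex k) _ (Psi G k) (PsiP G k).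

Lemma Psi0_cre m (G : 'I_m -> U) w z : Psi G 0 (cre w z) = 0.
Proof. by elim: m G w z => [|m IH] G w z /=; rewrite ?scale0r ?IH ?addr0. Qed.

Lemma Psi_cre m (G : 'I_m -> U) k w z :
  Psi G k.+1 (cre w z) = wedgel k (\sum_i w i *: G i) (Psi G k z).
Proof.
elim: m G k w z => [|m IH] G k w z; first by rewrite /= big_ord0 wedgel0.
rewrite big_ord_recl wedgel_lin /= IH (linearB (Psi _ _)) (linearZ_LR (Psi _ _)) /=.
rewrite (linearB (wedgel _ _)) (linearZ_LR (wedgel _ _)) /=.
case: k => [|k].
  by rewrite Psi0_cre (linear0 (wedgel _ _)) subr0 !addr0 addrC.
rewrite IH !(linearD (wedgel _ _)) /= wedgel_sq addr0.
set s := \sum_i _; rewrite [wedgel _ (G ord0) (wedgel _ s _)]wedgel_anti opprK.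
by rewrite addrCA.
Qed.

Lemma Psi_Phi k (t : Ex k) : Psi (fun i => delta_mx i 0) k (Phi k t) = t.
Proof.
elim/pmod_ind: t => [|u v Eu Ev|b u Eu|w].
- by rewrite !linear0.
- by rewrite (linearD (Phi _)) linearD /= Eu Ev.
- by rewrite (linearZ_LR (Phi _)) linearZ_LR /= Eu.
rewrite -[mgen _ w]/(wdg w) Phi_wedge; elim: k w => [|k IH] w.
  have -> : cwedge w = vac l 1 by [].
  have vE m (G : 'I_m -> U) : Psi G 0 (vac m 1) = wdg [ffun=> 0].
    by elim: m G => [|m IH] G /=; rewrite ?scale1r // IH addr0.
  by rewrite vE; congr wdg; apply/ffunP => -[].
rewrite [w]fcons_tl -[RHS]wedgelE -IH /= Psi_cre fcons0.
set w' := [ffun _ => _]; have -> : tl (fcons (w ord0) w') = w'.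
  by apply/funext => i; rewrite /tl fconsS.
congr (wedgel _ _ _).
apply/colP => i; rewrite summxE (bigD1 i) //= !mxE !eqxx mulr1 big1 ?addr0 // => j ji.
by rewrite !mxE eq_sym (negbTE ji) mulr0.
Qed.

Lemma Phi_Psi m (G : 'I_m -> U) k z :
  Phi k (Psi G k z) = Lam (fun j => colf (G j)) (prj k z).
Proof.
elim: m G k z => [|m IH] G [|k] z /=.
- rewrite (linearZ_LR (Phi _)) /= Phi_wedge /=; exact/esym/vacZ.
- by rewrite vac0 (linear0 (Phi _)).
- by rewrite addr0 (linear0 (Lam _)) (linear0 (cre _)) addr0 IH.
- by rewrite (linearD (Phi _)) /= Phi_wedgel !IH.
Qed.

Lemma Phi_Psi_delta k z : Phi k (Psi (fun i => delta_mx i 0) k z) = prj k z.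
Proof.
rewrite Phi_Psi -[RHS]Lam1; apply: eq_Lam => j i.
by rewrite /colf mxE eqxx andbT eq_sym.
Qed.

Lemma ext_map_respects k (f : {linear U -> U}) :
  mrespects (@ext_rel K U k) (fun w : {ffun 'I_k -> U} => wdg [ffun i => f (w i)]).
Proof.
move=> _ _ [w i a x y|w i j ij wij] /=.
  have updE z : [ffun j => f (upd w i z j)] = upd [ffun j => f (w j)] i (f z).
    by apply/ffunP=> j; rewrite !ffunE; case: eqP.
  by rewrite !updE linearP wedge_linear.
by apply: (wedge_alt ij); rewrite !ffunE wij.
Qed.

Lemma ext_map_linear k (f : {linear U -> U}) : linear (@ext_map K U k f).
Proof. exact: (mlift_linear (@ext_map_respects k f)). Qed.

Lemma Phi_ext_map k (A : 'M[K]_l) (t : Ex k) :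
  Phi k (ext_map (mulmx A) t) = Lam (fun j i => A i j) (Phi k t).
Proof.
have eD := ext_map_linear (k := k) (mulmx A).
elim/pmod_ind: t => [|u v Eu Ev|b u Eu|w].
- have -> : ext_map (mulmx A) (0 : Ex k) = 0.
    by have := eD (-1) 0 0; rewrite scaler0 addr0 scaleN1r addNr.
  by rewrite !linear0.
- have -> : ext_map (mulmx A) (u + v) = ext_map (mulmx A) u + ext_map (mulmx A) v.
    by have := eD 1 u v; rewrite !scale1r.
  by rewrite !(linearD (Phi _)) linearD /= Eu Ev.
- have -> : ext_map (mulmx A) (b *: u) = b *: ext_map (mulmx A) u.
    have e0 : ext_map (mulmx A) (0 : Ex k) = 0.
      by have := eD (-1) 0 0; rewrite scaler0 addr0 scaleN1r addNr.
    by have := eD b u 0; rewrite !addr0 e0 addr0.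
  by rewrite !(linearZ_LR (Phi _)) linearZ_LR /= Eu.
rewrite -[mgen _ w]/(wdg w) ext_map_wedge !Phi_wedge.
elim: k w {eD} => [|k IH] w /=; first by rewrite Lam_vac.
rewrite Lam_cre ffunE; have -> : tl [ffun i => A *m w i] = [ffun i => A *m [ffun i => w (lift ord0 i)] i].
  by apply/funext => i; rewrite /tl !ffunE.
rewrite IH; have -> : tl w = [ffun i => w (lift ord0 i)] by apply/funext => i; rewrite /tl !ffunE.
by apply: eq_cre => i; rewrite /colf !mxE; apply: eq_bigr => j _; rewrite mulrC.
Qed.

End ExteriorPowers.

(** * Standard modules as Dunkl modules *)

Section PolynomialsInCherednik.
Variables (R : realType) (l : nat) (D : cherednik_datum R l).
Local Notation C := R[i].
Local Notation S := {mpoly C[l]}.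
Local Notation H := (cherednik D).
Local Notation hc := (hc D).
Local Notation hx := (hx D).
Implicit Types (f : S) (k : 'X_{1..l}).

Definition hmon k : H := \prod_(i < l) hx (delta_mx 0 i) ^+ k i.

Lemma hx_comm x x' n n' : GRing.comm (hx x ^+ n) (hx x' ^+ n').
Proof. by apply/commrX/commr_sym/commrX; exact: hxx. Qed.

Lemma hmonU i k : hmon (U_(i) + k)%MM = hx (delta_mx 0 i) * hmon k.
Proof.
rewrite /hmon (eq_bigr (fun j => hx (delta_mx 0 j) ^+ U_(i)%MM j * hx (delta_mx 0 j) ^+ k j)); last first.
  by move=> j _; rewrite mnmDE exprD.
rewrite prodrM_comm => [|j j' _ _]; last exact: hx_comm.
congr (_ * _); rewrite (eq_bigr (fun j => if j == i then hx (delta_mx 0 j) else 1)); last first.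
  by move=> j _; rewrite mnm1E eq_sym; case: eqP; rewrite ?expr1 ?expr0.
by rewrite -big_mkcond big_pred1_eq.
Qed.

Lemma hpolyW N f : (msize f <= N)%N ->
  hpoly D f = \sum_(k : 'X_{1..l < N}) hc f@_k * hmon k.
Proof.
move=> fN; rewrite /hpoly (big_mksub 'X_{1..l < N}) ?msupp_uniq //=; first last.
  by move=> k /msize_mdeg_lt /leq_trans; apply.
rewrite big_rmcond //= => k /memN_msupp_eq0 ->.
by rewrite raddf0 mul0r.
Qed.

Lemma hpolyB f h : hpoly D (f - h) = hpoly D f - hpoly D h.
Proof.
pose N := maxn (msize (f - h)) (maxn (msize f) (msize h)).
rewrite !(@hpolyW N) ?leq_max ?leqnn ?orbT // -sumrB.
by apply: eq_bigr => k _; rewrite mcoeffB raddfB mulrBl.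
Qed.
HB.instance Definition _ := GRing.isZmodMorphism.Build S H (hpoly D) hpolyB.

Lemma hpoly_mon c k : hpoly D (c *: 'X_[k]) = hc c * hmon k.
Proof.
have kN : (mdeg k < (mdeg k).+1)%N by [].
rewrite (@hpolyW (mdeg k).+1); last by rewrite (leq_trans (msizeZ_le _ _)) // msizeX.
rewrite (bigD1 (BMultinom kN)) //= mcoeffZ mcoeffX eqxx mulr1 big1 ?addr0 //.
move=> k' k'k; rewrite mcoeffZ mcoeffX.
have -> : (k == k') = false.
  by apply: contra_neqF k'k => /eqP kE; apply: val_inj.
by rewrite mulr0 raddf0 mul0r.
Qed.

Lemma hpolyC c : hpoly D c%:MP = hc c.
Proof.
rewrite -[c%:MP]mulr1 -mpolyX0 mul_mpolyC hpoly_mon /hmon big1 ?mulr1 // => i _.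
by rewrite mnm0E.
Qed.

Lemma hpoly_mulX i f : hpoly D ('X_i * f) = hx (delta_mx 0 i) * hpoly D f.
Proof.
rewrite (mpolyE f) mulr_sumr !(raddf_sum (hpoly D)) mulr_sumr.
apply: eq_bigr => k _ /=; rewrite -scalerAr -mpolyXD !hpoly_mon hmonU.
by rewrite mulrA hcC mulrA.
Qed.

End PolynomialsInCherednik.

Section DunklAction.
Variables (R : realType) (l : nat) (D : cherednik_datum R l).
Variables (m : nat) (rho : mx_representation R[i] [set: D] m).
Local Notation M := (dunkl_module rho).
Implicit Type z : M.

Lemma dunkl_c c z : hc D c *: z = (c%:MP : {mpoly R[i][l]}) *: (z : ext _ m).
Proof. exact: (pscale_pi (H := dunkl_action rho) (ACst c) z). Qed.
Lemma dunkl_g g z : hg g *: z = gM rho g z.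
Proof. exact: (pscale_pi (H := dunkl_action rho) (AGen (CG g)) z). Qed.
Lemma dunkl_x x z : hx D x *: z = lin x *: (z : ext _ m).
Proof. exact: (pscale_pi (H := dunkl_action rho) (AGen (CX D x)) z). Qed.
Lemma dunkl_y y z : hy D y *: z = yM rho y z.
Proof. exact: (pscale_pi (H := dunkl_action rho) (AGen (CY D y)) z). Qed.

Lemma dunkl_hpoly f z : hpoly D f *: z = f *: (z : ext _ m).
Proof.
elim/mpoly_mulX_ind: f => [f h Ef Eh|i f Ef|c].
- by rewrite raddfD /= scalerDl Ef Eh [RHS]scalerDl.
- by rewrite hpoly_mulX -scalerA dunkl_x Ef lin_delta [LHS]scalerA.
- by rewrite hpolyC dunkl_c.
Qed.

End DunklAction.

Section StandardIso.
Variables (R : realType) (l : nat) (D : cherednik_datum R l).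
Local Notation C := R[i].
Local Notation S := {mpoly C[l]}.
Variables (T : lmodType C) (act : D -> T -> T).

(** The map f (x) v to f . (1 (x) psi v). It only has to be additive and commute with the x_i: by
    [standard_ind] this makes it a left inverse of the embedding into the Dunkl module. *)
Fixpoint dunkl_inv n : (ext C n -> T) -> ext S n -> standard act :=
  match n with
  | 0 => fun psi z => hpoly D z *: tens act 1 (psi 1)
  | n'.+1 => fun psi z =>
      dunkl_inv (fun a => psi (a, 0)) z.1 + dunkl_inv (fun b => psi (0, b)) z.2
  end.

Lemma dunkl_invD n (psi : ext C n -> T) z z' : dunkl_inv psi (z + z') = dunkl_inv psi z + dunkl_inv psi z'.
Proof.
elim: n psi z z' => [|n IH] psi z z' /=; first by rewrite raddfD scalerDl.
by rewrite !IH addrACA.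
Qed.

Lemma dunkl_invX n (psi : ext C n -> T) i z :
  dunkl_inv psi ('X_i *: z) = hx D (delta_mx 0 i) *: dunkl_inv psi z.
Proof.
elim: n psi z => [|n IH] psi z /=; first by rewrite hpoly_mulX scalerA.
by rewrite !IH scalerDr.
Qed.

Lemma dunkl_inv_cst n (psi : ext C n -> T) : (forall a u v, psi (a *: u + v) = a *: psi u + psi v) ->
  forall v, dunkl_inv psi (emap (@mpolyC l C) v) = tens act 1 (psi v).
Proof.
elim: n psi => [|n IH] psi psiP v /=.
  rewrite hpolyC -tens1Z; congr tens; have := psiP v 1 0.
  have psi0 : psi 0 = 0 by have := psiP (-1) 0 0; rewrite scaler0 addr0 scaleN1r addNr.
  by rewrite psi0 !addr0 => <-; rewrite [v *: 1]mulr1.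
rewrite !IH => [|a u w|a u w]; last 2 first.
- by rewrite -psiP; congr psi; congr (_, _) => /=; rewrite scaler0 addr0.
- by rewrite -psiP; congr psi; congr (_, _) => /=; rewrite scaler0 addr0.
rewrite -tens1D; congr tens; have := psiP 1 (v.1, 0) (0, v.2).
rewrite !scale1r => <-; congr psi; case: v => a b.
by congr (_, _) => /=; rewrite ?addr0 ?add0r.
Qed.

Variables (m : nat) (rho : mx_representation C [set: D] m) (k : nat).
Variables (phi : {linear T -> ext C m}) (psi : {linear ext C m -> T}).
Hypothesis phiK : cancel phi psi.
Hypothesis psiK : forall v, phi (psi v) = prj k v.
Hypothesis phi_act : forall g v, phi (act g v) = Lam (rhoC rho g) (phi v).
Local Notation cst := (emap (@mpolyC l C)).

(* M_c(T) embeds in the Dunkl module on C[h] (x) /\C^m as the part of exterior degree k. *)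
Lemma standard_iso : {theta : {linear standard act -> dunkl_module rho} |
  [/\ forall v, theta (tens act 1 v) = cst (phi v), injective theta &
    forall w, prj k w = w <-> exists z, theta z = w]}.
Proof.
have cD u v : cst (u + v) = cst u + cst v :> ext S m.
  exact: (raddfD (emap (@mpolyC l C : {additive C -> S}))).
have cZ a (v : ext C m) : cst (a *: v) = a%:MP *: cst v :> ext S m.
  by apply: (emapZ (B := @mpolyC l C)) => b; rewrite mpolyCM.
have [|a v|g v|y v|theta thetaE] := @standard_lift _ _ D T act (dunkl_module rho) (fun v => cst (phi v)).
- by move=> v v'; rewrite (raddfD phi); exact: cD.
- by rewrite dunkl_c (linearZ_LR phi); exact: cZ.
- by rewrite dunkl_g gM_cst phi_act.
- by rewrite dunkl_y yM_cst.
have thetaX i z : theta (hx D (delta_mx 0 i) *: z) = 'X_i *: (theta z : ext S m).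
  by rewrite linearZ /= dunkl_x lin_delta.
exists theta; split=> // [|w].
  apply: (can_inj (g := dunkl_inv psi)); apply: standard_ind => [z z' Ez Ez'|i z Ez|v].
  - by rewrite raddfD dunkl_invD Ez Ez'.
  - by rewrite thetaX dunkl_invX Ez.
  - by rewrite thetaE dunkl_inv_cst ?phiK // => a u w; rewrite linearP.
split=> [<-|[z <-]]; last first.
  move: z; apply: standard_ind => [z z' Ez Ez'|i z Ez|v].
  - by rewrite (raddfD theta) linearD /= Ez Ez'.
  - by rewrite thetaX linearZ /= Ez.
  - rewrite thetaE -{2}[v]phiK psiK; apply/esym.
    exact: (emap_prj k (@mpolyC l C : {additive C -> S})).
move: w; apply: ext_mpoly_ind => [w w' [z Ez] [z' Ez']|i w [z Ez]|v].
- by exists (z + z'); rewrite (raddfD theta) linearD /= Ez Ez'.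
- by exists (hx D (delta_mx 0 i) *: z); rewrite thetaX linearZ /= Ez.
- by exists (tens act 1 (psi v)); rewrite thetaE psiK (emap_prj k (@mpolyC l C : {additive C -> S})).
Qed.

End StandardIso.

(** * The BGG complex *)

Section LowDegrees.
Variable K : comNzRingType.

Fixpoint cf0 n : ext K n -> K :=
  match n with 0 => id | n'.+1 => fun z => cf0 z.1 end.

Lemma cf0P n : linear (@cf0 n : ext K n -> K^o).
Proof. by elim: n => //= n IH a x y; rewrite -IH. Qed.
HB.instance Definition _ n := GRing.isLinear.Build K (ext K n) K^o _ (@cf0 n) (@cf0P n).

Lemma vacK n : cancel (@vac K n) (@cf0 n).
Proof. by elim: n => //= n IH a; exact: IH. Qed.

Lemma cf0K n (z : ext K n) : vac n (cf0 z) = prj 0 z.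
Proof. by elim: n z => //= n IH z; rewrite IH. Qed.

Lemma cf0_prj n (z : ext K n) : cf0 (prj 0 z) = cf0 z.
Proof. by elim: n z => //= n IH z; rewrite IH. Qed.

Definition vacL l (a : K^o) : ext K l := vac l a.
HB.instance Definition _ l := GRing.isLinear.Build K K^o (ext K l) _ (@vacL l) (@vacP K l).
Definition cf0L l (z : ext K l) : K^o := cf0 z.
HB.instance Definition _ l := GRing.isLinear.Build K (ext K l) K^o _ (@cf0L l) (@cf0P l).

(** The terms [bgg 1] and [bgg 2] are built on C and U themselves, not on presented exterior powers,
    so degrees 0 and 1 get identifications of their own. *)
Definition creV l (v : 'cV[K]_l) : ext K l := cre (colf v) (vac l 1).
Definition contrV l (z : ext K l) : 'cV[K]_l :=
  \col_i cf0 (contr (fun j => (j == i)%:R) z).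

Lemma creVP l : linear (@creV l).
Proof.
move=> a u v; rewrite -cre_lin; apply: eq_cre => i.
by rewrite /colf !mxE.
Qed.
HB.instance Definition _ l := GRing.isLinear.Build K _ _ _ (@creV l) (@creVP l).

Lemma contrVP l : linear (@contrV l).
Proof. by move=> a u v; apply/colP => i; rewrite !mxE (linearP (contr _)) (linearP (@cf0 l)). Qed.
HB.instance Definition _ l := GRing.isLinear.Build K _ _ _ (@contrV l) (@contrVP l).

Lemma creVK l : cancel (@creV l) (@contrV l).
Proof.
move=> v; apply/colP => i; rewrite mxE contr_vac1 vacK (bigD1 i) //= eqxx mul1r.
by rewrite big1 ?addr0 // => j /negbTE ->; rewrite mul0r.
Qed.

Lemma contrVK l (z : ext K l) : creV (contrV z) = prj 1 z.
Proof.
have -> : contrV z = contrV (prj 1 z).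
  by apply/colP => i; rewrite !mxE contr_prj cf0_prj.
have [w ->] := prj1P z.
rewrite (_ : cre w (vac l 1) = creV (\col_i w i)) ?creVK //.
by apply: eq_cre => i; rewrite /colf mxE.
Qed.

End LowDegrees.

Section BGG.
Variables (R : realType) (l : nat) (D : cherednik_datum R l).
Local Notation C := R[i].
Local Notation S := {mpoly C[l]}.
Local Notation cst := (emap (@mpolyC l C)).
Variables (u : 'I_l -> S) (rU : mx_representation C [set: D] l).
Local Notation M := (dunkl_module rU).
Local Notation bgg := (bgg u rU).

Definition theta_spec k (theta : {linear bgg k.+1 -> M}) :=
  injective theta /\ forall w : ext S l, prj k w = w <-> exists z, theta z = w.

Lemma theta0_key : {theta : {linear bgg 1 -> M} | theta_spec (k := 0) theta /\
  forall f, theta (poly_std D f) = vac l f}.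
Proof.
have [|v|g v|theta [thetaE thetaI thetaS]] := @standard_iso R l D C^o (fun _ v => v) l rU 0
  (@vacL C l) (@cf0L C l).
- exact: vacK.
- exact: cf0K.
- by rewrite Lam_vac.
exists theta; split=> // f.
rewrite (linearZ_LR theta) /= thetaE dunkl_hpoly.
by rewrite [RHS]vacZ; congr (_ *: _); exact: (emap_vac l (@mpolyC l C : {additive C -> S})).
Qed.

Lemma theta1_key : {theta : {linear bgg 2 -> M} | theta_spec (k := 1) theta}.
Proof.
have [|v|g v|theta [thetaE thetaI thetaS]] := @standard_iso R l D 'cV[C]_l
  (fun g v => rU g *m v) l rU 1 (@creV C l) (@contrV C l).
- exact: creVK.
- exact: contrVK.
- rewrite Lam_cre Lam_vac; apply: eq_cre => i; rewrite /colf !mxE.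
  by apply: eq_bigr => j _; rewrite mulrC.
by exists theta.
Qed.

Lemma theta2_key k : {theta : {linear bgg k.+3 -> M} | theta_spec (k := k.+2) theta}.
Proof.
have [t|v|g v|theta [thetaE thetaI thetaS]] := @standard_iso R l D (ext_power 'cV[C]_l k.+2)
  (fun g v => ext_map (mulmx (rU g)) v) l rU k.+2 (@Phi C l k.+2)
   (@Psi C l l (fun i => delta_mx i 0) k.+2).
- exact: Psi_Phi.
- exact: Phi_Psi_delta.
- exact: Phi_ext_map.
by exists theta.
Qed.

Definition theta k : {linear bgg k.+1 -> M} :=
  match k return {linear bgg k.+1 -> M} with
  | 0 => sval theta0_key | 1 => sval theta1_key | k'.+2 => sval (theta2_key k')
  end.

Lemma theta_inj k : injective (theta k).
Proof.
case: k => [|[|k]] /=.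
- by case: (svalP theta0_key) => -[].
- by case: (svalP theta1_key).
- by case: (svalP (theta2_key k)).
Qed.

Lemma theta_im k (w : ext S l) : prj k w = w <-> exists z, theta k z = w.
Proof.
case: k => [|[|k]] /=.
- by case: (svalP theta0_key) => -[].
- by case: (svalP theta1_key).
- by case: (svalP (theta2_key k)).
Qed.

Lemma theta_poly f : theta 0 (poly_std D f) = vac l f.
Proof. by case: (svalP theta0_key). Qed.

End BGG.

Lemma contr_lincomb (K : comNzRingType) n (f : 'I_n -> K) (I : finType) (P : pred I)
    a b (c : I -> K) z z' (F : I -> ext K n) :
  contr f (a *: z + b *: z' - \sum_(i | P i) c i *: F i)
    = a *: contr f z + b *: contr f z' - \sum_(i | P i) c i *: contr f (F i).
Proof.
rewrite (linearB (contr f)) (linearD (contr f)) !(linearZ_LR (contr f)) (linear_sum (contr f)) /=.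
by congr (_ - _); apply: eq_bigr => i _; rewrite (linearZ_LR (contr f)).
Qed.

(** * Contraction with u commutes with the Dunkl action *)

Section KoszulDifferential.
Variables (R : realType) (l : nat) (D : cherednik_datum R l).
Local Notation C := R[i].
Local Notation S := {mpoly C[l]}.
Local Notation cst := (emap (@mpolyC l C)).

Lemma yM_prj m (rho : mx_representation C [set: D] m) y k z :
  prj k (yM rho y z) = yM rho y (prj k z).
Proof.
rewrite /yM (linearB (prj k)) (linear_sum (prj k)) /=.
rewrite (emap_prj k (dS y : {additive S -> S})); congr (_ - _).
apply: eq_bigr => s _; rewrite (linearZ_LR (prj k)) /=; congr (_ *: _).
by rewrite -(emap_prj k (divdiff s : {additive S -> S})) prj_Lam.
Qed.

Lemma yM_homog m (rho : mx_representation C [set: D] m) y r z :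
  vals (fun f => f \is r.+1.-homog) z -> emap (pihomog mdeg r) (yM rho y z) = yM rho y z.
Proof.
move=> /emap_pihomog <-.
pose A : {linear S -> S} := pihomog mdeg r.
rewrite /yM (raddfB (emap (A : {additive S -> S}))) /=.
have key (F : S -> S) : (forall f, f \is r.+1.-homog -> F f \is r.-homog) ->
    forall z' : ext S m, emap A (emap F (emap (pihomog mdeg r.+1) z')) = emap F (emap (pihomog mdeg r.+1) z').
  move=> Fh z'; rewrite !emap_comp; apply: eq_emap => f /=.
  by rewrite pihomog_dE // Fh // pihomogP.
rewrite key; last by move=> f; exact: dS_homog.
congr (_ - _); rewrite (raddf_sum (emap (A : {additive S -> S}))) /=.
apply: eq_bigr => s _; rewrite (emapZ (B := A) (c' := (kap s * pair (calpha s) y)%:MP)); last first.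
  by move=> f; rewrite !mul_mpolyC linearZ.
rewrite -(emap_LamC rho (pihomog mdeg r.+1 : {linear S -> S})) key //.
by move=> f; exact: divdiff_homog.
Qed.

Lemma vals_contr_cst (u : 'I_l -> S) r v : (forall j, u j \is r.-homog) ->
  vals (fun f => f \is r.-homog) (contr u (cst v : ext S l)).
Proof.
move=> u_deg.
have -> : contr u (cst v : ext S l) = emap (pihomog mdeg r) (contr u (cst v)).
  rewrite (emap_contr (A := pihomog mdeg r : {additive S -> S}) (B := shiftpi r r) (f' := u)); last first.
    by move=> i a; exact: (pihomogM _ _ (u_deg i)).
  congr contr; rewrite emap_comp; apply: eq_emap => a /=.
  rewrite /shiftpi leqnn subnn pihomog_dE //.
  by rewrite -[a%:MP]mulr1 mul_mpolyC; apply/rpredZ/dhomog1.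
by apply: vals_emap => f; exact: pihomogP.
Qed.

Variables (u : 'I_l -> S) (r : nat) (rU : mx_representation C [set: D] l).
Hypothesis u_deg : forall j, u j \is r.-homog.
Hypothesis u_stable : forall g j, gS g (u j) = \sum_i rU g i j *: u i.
Hypothesis u_singular : forall y j, yM rU y (vac l (u j)) = 0.
(** The u_j transform under g like the basis vectors e_j. Written through g^-1 u_i, the form u is
    the pullback of a form which g maps back to u, and [contr_Lam] applies. *)
Lemma contr_gM g z : contr u (gM rU g z) = gM rU g (contr u z).
Proof.
pose f i := gS g^-1%g (u i).
have fE i : gS g (f i) = u i by rewrite /f -gSM mulgV gS1.
have E : contr u z = contr (fun j => \sum_i f i * rhoS rU g j i) z.
  apply: eq_contr => j; rewrite -[u j](gS1 D) -(mulVg g) gSM u_stable linear_sum /=.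
  by apply: eq_bigr => i _; rewrite linearZ /= /rhoS mulrC mul_mpolyC.
rewrite /gM E -contr_Lam; apply/esym.
apply: (emap_contr (A := gS g : {additive S -> S}) (B := gS g : {additive S -> S})) => i a.
by rewrite /= rmorphM /= fE.
Qed.

Lemma yM_dhomog0 y z : vals (fun f : S => f \is 0.-homog) z -> yM rU y z = 0.
Proof.
move=> /emap_pihomog <-.
have -> : emap (pihomog mdeg 0) z = cst (emap (fun f => (pihomog mdeg 0 f)@_0) z) :> ext S l.
  rewrite emap_comp; apply: eq_emap => f /=.
  by apply/msize1_polyC/dhomog_msize_le; exact: pihomogP.
exact: yM_cst.
Qed.

Lemma contr_yM_of_cst y k : (forall v, yM rU y (contr u (prj k (cst v))) = 0) ->
  forall z, yM rU y (contr u (prj k z)) = contr u (yM rU y (prj k z)).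
Proof.
move=> Tcst; suff T0 z : yM rU y (contr u (prj k z)) - contr u (yM rU y (prj k z)) = 0.
  by move=> z; have /eqP := T0 z; rewrite subr_eq0 => /eqP.
move: z; apply: (op_eq0 (m := l)) => [z z'|z i Tz|v].
- rewrite (linearD (prj _)) (yMD rU y (prj k z)) !(linearD (contr u)) yMD /=.
  by rewrite opprD addrACA.
- move/eqP: Tz; rewrite subr_eq0 => /eqP Tz.
  rewrite (linearZ_LR (prj _)) [contr u (lin _ *: _)](linearZ_LR (contr u)) /= !yM_lin Tz.
  rewrite contr_lincomb; apply/eqP; rewrite subr_eq0; apply/eqP; congr (_ - _).
  by apply: eq_bigr => s _; rewrite contr_gM.
- by rewrite Tcst -(emap_prj _ (@mpolyC l C : {additive C -> S})) yM_cst linear0 subr0.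
Qed.

(** In exterior degree 1 the contraction of a constant is a combination of the u_j: singularity
    enters here. *)
Lemma contr_yM_prj1 y z : yM rU y (contr u (prj 1 z)) = contr u (yM rU y (prj 1 z)).
Proof.
apply: contr_yM_of_cst => v.
rewrite -(emap_prj _ (@mpolyC l C : {additive C -> S})); have [w ->] := prj1P v.
have -> : cst (cre w (vac l 1)) = cre (fun i => (w i)%:MP) (vac l 1) :> ext S l.
  rewrite (emap_cre (A := @mpolyC l C : {additive C -> S}) (w' := fun i => (w i)%:MP)); last first.
    by move=> i a; exact: mpolyCM.
  by rewrite (emap_vac l (@mpolyC l C : {additive C -> S})).
rewrite contr_vac1 (raddf_sum (@vac S l)) (raddf_sum (yM rU y)) big1 // => i _ /=.
by rewrite mulrC vacZ -scalerA yMZ -vacZ u_singular scaler0.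
Qed.

Hypothesis u_exact : koszul_exact u.

(* The vector is a Koszul cycle, hence a Koszul boundary with coefficients in (u),
   but its coefficients have degree r - 1. *)
Lemma yM_contr_cst y v k : (forall z, yM rU y (contr u (prj k.+1 z)) = contr u (yM rU y (prj k.+1 z))) ->
  yM rU y (contr u (prj k.+2 (cst v))) = 0.
Proof.
move=> IH; set Z := prj _ _; set w := yM rU y _.
have ZE : contr u Z = prj k.+1 (contr u (cst v)) by rewrite /Z contr_prj.
have wk : prj k.+1 w = w by rewrite /w ZE yM_prj prj_id.
have dw : contr u w = 0 by rewrite /w ZE -IH -ZE contr_sq yM0.
have [b wb] := u_exact wk dw.
have Zh : vals (fun f : S => f \is r.-homog) (contr u Z).
  have -> : Z = cst (prj k.+2 v) by rewrite (emap_prj _ (@mpolyC l C : {additive C -> S})).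
  exact: vals_contr_cst.
(* For r = 0 there is no degree r - 1, but then the coefficients are constants, which y kills. *)
case: r Zh u_deg => [|r'] Zh uh; first exact: yM_dhomog0.
have := yM_homog rU y Zh; rewrite -/w => <-; rewrite wb.
rewrite (emap_contr (A := pihomog mdeg r' : {additive S -> S}) (B := shiftpi r'.+1 r') (f' := u)); last first.
  by move=> i a; exact: (pihomogM _ _ (uh i)).
have -> : emap (shiftpi r'.+1 r') b = 0 by apply: emap_eq0 => a; rewrite /shiftpi ltnn.
exact: linear0.
Qed.

Lemma contr_yM_prj y k z : yM rU y (contr u (prj k z)) = contr u (yM rU y (prj k z)).
Proof.
elim: k z => [|[|k] IH] z; first by rewrite contr_prj0 yM0 -yM_prj contr_prj0.
  exact: contr_yM_prj1.
by apply: contr_yM_of_cst => v; exact: yM_contr_cst.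
Qed.

End KoszulDifferential.

(** * From the Koszul complex to the resolution *)

Section Resolution.
Variables (R : realType) (l : nat) (D : cherednik_datum R l) (r : nat).
Local Notation C := R[i].
Local Notation S := {mpoly C[l]}.
Local Notation H := (cherednik D).
Variable u : 'I_l -> S.
Hypothesis u_deg : forall j, u j \is r.-homog.
Variable rU : mx_representation C [set: D] l.
Hypothesis u_stable : forall (g : D) (j : 'I_l),
  hg g *: poly_std D (u j) = poly_std D (\sum_(i < l) rU g i j *: u i).
Hypothesis u_singular : forall (y : 'cV[R[i]]_l) (j : 'I_l),
  hy D y *: poly_std D (u j) = 0.
Local Notation M := (dunkl_module rU).
Local Notation bgg := (bgg u rU).
Local Notation theta := (theta u rU).

Lemma theta0_im (v : standard_triv D) : theta 0 v = vac l (cf0 (theta 0 v : ext S l)).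
Proof.
have [_] := theta_im u rU 0 (theta 0 v); rewrite cf0K => ->; first by [].
by exists v.
Qed.

Lemma poly_stdP v : poly_std D (cf0 (theta 0 v : ext S l)) = v.
Proof. by apply: (@theta_inj R l D u rU 0); rewrite theta_poly -theta0_im. Qed.

Lemma hx_poly_std x f : hx D x *: poly_std D f = poly_std D (lin x * f).
Proof.
apply: (@theta_inj R l D u rU 0).
by rewrite (linearZ_LR (theta 0)) /= !theta_poly dunkl_x [RHS]vacZ [vac l f]vacZ scalerA.
Qed.

Lemma hpoly_poly_std f g : hpoly D f *: poly_std D g = poly_std D (f * g).
Proof.
apply: (@theta_inj R l D u rU 0).
by rewrite (linearZ_LR (theta 0)) /= !theta_poly dunkl_hpoly [RHS]vacZ [vac l g]vacZ scalerA.
Qed.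

Lemma hg_poly_std g f : hg g *: poly_std D f = poly_std D (gS g f).
Proof.
apply: (@theta_inj R l D u rU 0).
rewrite (linearZ_LR (theta 0)) /= !theta_poly dunkl_g /gM Lam_vac.
by rewrite (emap_vac l (gS g : {additive S -> S})).
Qed.

Lemma poly_stdB f g : poly_std D (f - g) = poly_std D f - poly_std D g.
Proof. by rewrite /poly_std raddfB scalerBl. Qed.
HB.instance Definition _ :=
  GRing.isZmodMorphism.Build S (standard_triv D) (poly_std D) poly_stdB.

Lemma gS_u g j : gS g (u j) = \sum_i rU g i j *: u i.
Proof.
have := congr1 (theta 0) (u_stable g j).
by rewrite hg_poly_std !theta_poly => /vac_inj.
Qed.

Lemma yM_u y j : yM rU y (vac l (u j)) = 0.
Proof.
have := congr1 (theta 0) (u_singular y j).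
by rewrite (linearZ_LR (theta 0)) /= theta_poly dunkl_y raddf0.
Qed.

Lemma dunkl_prj k (h : H) (z : M) : prj k (h *: z : M) = h *: (prj k z : M).
Proof.
elim/quotW: h z => a; elim: a => [[g|x|y]|c|a IHa b IHb|a IHa b IHb] z.
- rewrite !dunkl_g; rewrite /gM -(emap_prj k (gS g : {additive S -> S})).
  by rewrite prj_Lam.
- by rewrite !dunkl_x linearZ.
- by rewrite !dunkl_y yM_prj.
- by rewrite !dunkl_c linearZ.
- by rewrite piD !scalerDl (linearD (prj k)) /= IHa IHb.
- by rewrite piM -!scalerA IHa IHb.
Qed.

(** One exterior degree at a time, with commutation with y assumed: degree 1 is needed to identify
    J, which precedes the proof of Koszul exactness. *)
Lemma contr_dunkl k (h : H) (z : M) :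
  (forall y z, yM rU y (contr u (prj k z)) = contr u (yM rU y (prj k z))) ->
  contr u (h *: (prj k z : M) : M) = h *: (contr u (prj k z) : M).
Proof.
move=> Hk; elim/quotW: h z => a; elim: a => [[g|x|y]|c|a IHa b IHb|a IHa b IHb] z.
- by rewrite !dunkl_g (contr_gM gS_u).
- by rewrite !dunkl_x linearZ.
- by rewrite !dunkl_y Hk.
- by rewrite !dunkl_c linearZ.
- by rewrite piD !scalerDl (linearD (contr u)) /= IHa IHb.
- by rewrite piM -!scalerA -dunkl_prj IHa dunkl_prj IHb.
Qed.

(** The reason why the H-submodule J is just the ideal (u): the image of the contraction in degree 1
    is that ideal, and it is H-stable because the contraction is H-linear there. *)
Lemma Acls_eq0_im (v : standard_triv D) :
  Aproj u v = 0 <-> exists b : ext S l, theta 0 v = contr u (prj 1 b).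
Proof.
have -> : (Aproj u v = 0) <-> span_sub (fun v => exists j, v = poly_std D (u j)) v.
  rewrite -[X in span_sub _ X]subr0; split=> [/eqP/qmod_eqP //|H].
  exact/eqP/qmod_eqP.
split.
  elim=> {v} [_ [j ->]||v w _ [b Eb] _ [b' Eb']|h v _ [b Eb]].
  - exists (cre (fun i => (i == j)%:R) (vac l 1)); rewrite prj_cre prj_vac contr_vac1.
    rewrite theta_poly (bigD1 j) //= eqxx mulr1 big1 ?addr0 // => i /negbTE ->.
    by rewrite mulr0.
  - by exists 0; rewrite raddf0 !linear0.
  - by exists (b + b'); rewrite raddfD (linearD (prj 1)) (linearD (contr u)) /= Eb Eb'.
  - by exists (h *: (b : M)); rewrite (linearZ_LR (theta 0)) /= Eb dunkl_prj contr_dunkl // => y z; exact: contr_yM_prj1 gS_u yM_u _ _.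
move=> [b E]; have [w Ew] := prj1P b.
have -> : v = \sum_i hpoly D (w i) *: poly_std D (u i).
  apply: (@theta_inj R l D u rU 0).
  rewrite E Ew contr_vac1 -(theta_poly u rU) (raddf_sum (poly_std D)); congr (theta 0 _).
  by apply: eq_bigr => i _; rewrite hpoly_poly_std mulrC.
elim/big_ind: _ => [||i _]; [exact: ss_zero|exact: ss_add|].
by apply/ss_scale/ss_gen; exists i.
Qed.

Lemma Acls_eq0 f : Acls D u f = 0 <-> gen u f.
Proof.
rewrite Acls_eq0_im theta_poly; split=> [[b]|[a ->]]; first exact: gen_contr.
by exists (cre a (vac l 1)); rewrite prj_cre prj_vac contr_vac1.
Qed.

Hypothesis u_exact : koszul_exact u.

Lemma bgg_diff_ex k (z : bgg k.+2) :
  exists z' : bgg k.+1, theta k z' = contr u (theta k.+1 z).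
Proof.
have zk : prj k.+1 (theta k.+1 z : ext S l) = theta k.+1 z.
  by apply/(theta_im u rU); exists z.
by apply/(theta_im u rU); rewrite -{1}zk contr_prj prj_id -contr_prj zk.
Qed.

Definition bgg_diff k (z : bgg k.+2) : bgg k.+1 := projT1 (cid (bgg_diff_ex z)).

Lemma bgg_diffE k (z : bgg k.+2) : theta k (bgg_diff z) = contr u (theta k.+1 z).
Proof. by rewrite /bgg_diff; case: cid. Qed.

Lemma bgg_diffP k : linear (@bgg_diff k).
Proof.
move=> h z z'; apply: (@theta_inj R l D u rU k).
rewrite bgg_diffE [LHS](congr1 (contr u) (linearP (theta k.+1) h z z')).
rewrite [RHS](linearP (theta k)) !bgg_diffE.
have zk : prj k.+1 (theta k.+1 z : ext S l) = theta k.+1 z.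
  by apply/(theta_im u rU); exists z.
rewrite -{2}zk -contr_dunkl => [|y w]; last exact: contr_yM_prj u_deg gS_u yM_u u_exact _ _ _.
by rewrite zk [LHS]raddfD.
Qed.

Lemma Aproj_linear : linear (Aproj u : standard_triv D -> Aquot D u).
Proof.
move=> h v w; rewrite /Aproj.
have -> : h *: \pi_(Aquot D u) v = \pi_(Aquot D u) (h *: v) by exact: qscale_pi.
exact/esym/qadd_pi.
Qed.

Definition bgg_map k : bgg k.+1 -> bgg k :=
  match k with 0 => Aproj u | k'.+1 => @bgg_diff k' end.

Lemma bgg_mapP k : linear (@bgg_map k).
Proof. by case: k => [|k]; [exact: Aproj_linear | exact: bgg_diffP]. Qed.
HB.instance Definition _ k := GRing.isLinear.Build H (bgg k.+1) (bgg k) _ (@bgg_map k) (@bgg_mapP k).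

Lemma bgg_exact k (v : bgg k.+1) : bgg_map v = 0 <-> exists w, @bgg_map k.+1 w = v.
Proof.
have inj0 k' (z : bgg k'.+1) : theta k' z = 0 -> z = 0.
  by rewrite -(raddf0 (theta k')) => /theta_inj.
case: k v => [|k] v /=.
  rewrite Acls_eq0_im; split=> [[b E]|[w <-]].
    have [w Ew] : exists w, theta 1 w = prj 1 b by apply/(theta_im u rU); rewrite prj_id.
    by exists w; apply: (@theta_inj R l D u rU 0); rewrite bgg_diffE Ew.
  exists (theta 1 w); rewrite bgg_diffE; congr contr; apply/esym.
  by apply/(theta_im u rU); exists w.
split=> [E|[w <-]]; last first.
  by apply: (inj0); rewrite !bgg_diffE contr_sq.
have vk : prj k.+1 (theta k.+1 v : ext S l) = theta k.+1 v by apply/(theta_im u rU); exists v.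
have [b Eb] : exists b, (theta k.+1 v : ext S l) = contr u b.
  by apply: (u_exact vk); rewrite -bgg_diffE E raddf0.
have [w Ew] : exists w, theta k.+2 w = prj k.+2 b by apply/(theta_im u rU); rewrite prj_id.
exists w; apply: (@theta_inj R l D u rU k.+1).
by rewrite bgg_diffE Ew contr_prj -Eb vk.
Qed.

Lemma bgg_resolution_holds : bgg_resolution u rU.
Proof.
exists (fun k => bgg_map (k := k)); split=> //=.
- by elim/quotW=> v; exists v.
- by move=> k _ v; exact: bgg_exact.
(* The kernel is the image of the next term, which lives in exterior degree l + 1 and is zero. *)
move=> v w /eqP; rewrite -subr_eq0 -raddfB => /eqP /bgg_exact [z Ez].
apply/eqP; rewrite -subr_eq0 -Ez; apply/eqP.
have z0 : theta l.+1 z = 0.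
  have <- : prj l.+1 (theta l.+1 z : ext S l) = theta l.+1 z by apply/(theta_im u rU); exists z.
  exact: prj_gt.
apply: (@theta_inj R l D u rU l).
by rewrite bgg_diffE z0 !linear0.
Qed.

End Resolution.

(** * The Frobenius property *)

Section FiniteQuotient.
Variables (R : realType) (l : nat) (D : cherednik_datum R l) (r : nat).
Local Notation C := R[i].
Local Notation S := {mpoly C[l]}.
Local Notation H := (cherednik D).
Local Notation hc := (hc D).
Variable u : 'I_l -> S.
Hypothesis u_deg : forall j, u j \is r.-homog.
Local Notation A := (Aquot D u).
Local Notation Acls := (Acls D u).
Hypothesis Acls_eq0 : forall f, Acls f = 0 <-> gen u f.

Lemma hpolyZ c f : hpoly D (c *: f) = hc c * hpoly D f.
Proof.
rewrite (mpolyE f) scaler_sumr !(raddf_sum (hpoly D)) mulr_sumr.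
by apply: eq_bigr => k _ /=; rewrite scalerA !hpoly_mon hcM mulrA.
Qed.

Lemma AclsP c f g : Acls (c *: f + g) = hc c *: Acls f + Acls g.
Proof.
rewrite /Defs.Acls /poly_std raddfD /= hpolyZ scalerDl -scalerA.
exact: Aproj_linear.
Qed.

Lemma Acls0 : Acls 0 = 0.
Proof. by apply/Acls_eq0; case: (ideal_gen u). Qed.
Lemma AclsZ c f : Acls (c *: f) = hc c *: Acls f.
Proof. by rewrite -[c *: f]addr0 AclsP Acls0 addr0. Qed.
Lemma AclsB f g : Acls (f - g) = Acls f - Acls g.
Proof.
have -> : f - g = (-1) *: g + f by rewrite scaleN1r addrC.
by rewrite AclsP (raddfN hc) /= -[hc 1]/(1 : H) scaleN1r addrC.
Qed.
HB.instance Definition _ := GRing.isZmodMorphism.Build S A Acls AclsB.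

Lemma Acls_eq f g : Acls f = Acls g <-> gen u (f - g).
Proof.
rewrite -Acls_eq0 AclsB; split=> [->|/eqP]; first by rewrite subrr.
by rewrite subr_eq0 => /eqP.
Qed.

Lemma Alin_linear n (e : 'I_n -> A) c z z' :
  Alin e (c *: z + z') = hc c *: Alin e z + Alin e z'.
Proof.
rewrite /Alin scaler_sumr -big_split; apply: eq_bigr => i _ /=.
by rewrite !mxE hcD hcM scalerDl scalerA.
Qed.

Lemma Alin0 n (e : 'I_n -> A) : Alin e 0 = 0.
Proof. by rewrite /Alin big1 // => i _; rewrite mxE raddf0 scale0r. Qed.

Lemma Alin_sum n (e : 'I_n -> A) (J : finType) (c : J -> C) (z : J -> 'cV_n) :
  Alin e (\sum_j c j *: z j) = \sum_j hc (c j) *: Alin e (z j).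
Proof.
rewrite -!big_enum; elim: (enum _) => [|j s IH]; first by rewrite !big_nil Alin0.
by rewrite !big_cons Alin_linear IH.
Qed.

Lemma pihomog_mem m f : gen u f -> gen u (pihomog mdeg m f).
Proof. exact: (homogeneous_gen u_deg). Qed.

(** The n + 1 powers 1, ..., x_i^n are dependent in A. As (u) is homogeneous, every term of the
    relation lies in it, so one of these powers does, and with it x_i^n. *)
Lemma finite_dim_power n (e : 'I_n -> A) : Abasis e -> forall i, gen u ('X_i ^+ n).
Proof.
move=> eb i; have /choice [z zE] : forall j : 'I_n.+1, exists z, Acls ('X_i ^+ j) = Alin e z.
  by move=> j; have [z [Ez _]] := eb (Acls ('X_i ^+ j)); exists z.
pose Z : 'M[C]_(n.+1, n) := \matrix_(j, a) z j a 0.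
have : kermx Z != 0.
  rewrite -mxrank_eq0 mxrank_ker subn_eq0 -ltnNge ltnS; exact: rank_leq_col.
case/rowV0Pn => c /sub_kermxP cZ /rV0Pn [j0 cj0].
have [_ _ IM] := ideal_gen u.
suff : gen u ('X_i ^+ j0).
  move=> /(IM ('X_i ^+ (n - j0))); rewrite -exprD subnK //.
  by rewrite -ltnS.
have /(pihomog_mem j0) : gen u (\sum_j c 0 j *: 'X_i ^+ j).
  apply/Acls_eq0; rewrite raddf_sum /=.
  under eq_bigr do rewrite AclsZ zE.
  rewrite -Alin_sum; have -> : \sum_j c 0 j *: z j = 0; last exact: Alin0.
  apply/colP => a; have /rowP /(_ a) := cZ; rewrite !mxE => <-.
  by rewrite summxE; apply: eq_bigr => j _; rewrite !mxE.
have Xh j : ('X_i ^+ j : S) \is j.-homog.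
  rewrite -[X in X.-homog]mul1n; apply: dhomogMn; rewrite dhomogX; exact/eqP/mdeg1.
rewrite raddf_sum (bigD1 j0) //= big1 ?addr0 => [|j jj0].
  rewrite linearZ /= pihomog_dE // => /(IM (c 0 j0)^-1%:MP).
  by rewrite mul_mpolyC scalerA mulVf // scale1r.
rewrite linearZ /= (pihomog_ne0 _ (Xh j)) ?scaler0 //.
Qed.

Hypothesis r_gt0 : (0 < r)%N.
Variable N : nat.
Hypothesis uN : forall i, gen u ('X_i ^+ N).

Lemma gen_large m f : (l * N < m)%N -> f \is m.-homog -> gen u f.
Proof.
have [I0 ID IM] := ideal_gen u.
move=> lm /dhomogP fm; rewrite (mpolyE f) big_seq.
apply: (big_ind (gen u)) => // k /fm km; rewrite -mul_mpolyC; apply: (IM).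
have [i ki] : exists i, (N <= k i)%N.
  apply/existsP; apply: contraLR lm; rewrite negb_exists => /forallP kN.
  rewrite -leqNgt -km /= mdegE -[X in (_ <= X * N)%N]card_ord -sum_nat_const.
  by apply: leq_sum => i _; have := kN i; rewrite -ltnNge => /ltnW.
rewrite (_ : k = (k - U_(i) *+ N) + U_(i) *+ N)%MM; last first.
  rewrite submK //; apply/mnm_lepP => j; rewrite mulmnE mnm1E.
  by case: eqP => [<-|]; rewrite ?mul1n ?mul0n.
by rewrite mpolyXD -mpolyXn; apply: (IM).
Qed.

Lemma socle_degree : exists d w, [/\ w \is d.-homog, ~ gen u w &
  forall m f, (d < m)%N -> f \is m.-homog -> gen u f].
Proof.
pose P d := `[< exists2 w, w \is d.-homog & ~ gen u w >].
have P0 : exists d, P d.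
  exists 0%N; apply/asboolP; exists 1; first exact: dhomog1.
  by move=> /(gen_coeff0 r_gt0 u_deg) /eqP; rewrite mcoeff1 eqxx oner_eq0.
have PN d : P d -> (d <= l * N)%N.
  move=> /asboolP [w wd nw]; rewrite leqNgt; apply/negP => /gen_large /(_ wd).
  exact: nw.
case: (ex_maxnP P0 PN) => d /asboolP [w wd nw] dmax; exists d, w; split=> // m f dm fm.
apply: contrapT => nf; have := dmax m; rewrite leqNgt dm => /(_ _) /negP; apply=> //.
by apply/asboolP; exists f.
Qed.

Lemma homogX i m (f : S) : f \is m.-homog -> 'X_i * f \is m.+1.-homog.
Proof. by rewrite -add1n; apply: dhomogM; rewrite dhomogX; exact/eqP/mdeg1. Qed.

(* By induction on d - m, an f of degree m killed by A[d - m] lies in the socle,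
   which is a line spanned in degree d. *)
Lemma frobenius_holds : frobenius D u.
Proof.
have [I0 ID IM] := ideal_gen u.
have [phi [phiP phi_socle]] := socle_gen uN.
have [d [w [wd nw top]]] := socle_degree.
have w_socle i : gen u ('X_i * w) by apply: (top d.+1) => //; exact: homogX.
have pw : phi w != 0 by apply/eqP => p0; apply/nw/phi_socle.
have line f : (forall i, gen u ('X_i * f)) -> gen u (f - (phi f / phi w) *: w).
  move=> sf; apply: phi_socle => [i|].
    rewrite mulrBr -scalerAr -scaleNr -mul_mpolyC; apply: (ID); [exact: sf|].
    by apply: (IM).
  by rewrite addrC -scaleNr phiP mulNr divfK // addNr.
exists d; split.
- exists (Acls w); split; first by exists w.
    by move/Acls_eq0.
  move=> _ [f fd ->]; exists (phi f / phi w); rewrite -AclsZ; apply/Acls_eq/line => i.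
  by apply: (top d.+1) => //; exact: homogX.
- by move=> m _ dm [f fm ->]; apply/Acls_eq0; exact: top fm.
move=> m f md fm fg; apply/Acls_eq0.
have {fg} : forall g, g \is (d - m).-homog -> gen u (f * g) by move=> g /fg /Acls_eq0.
have := subnK md; move: (d - m)%N => k; elim: k m f fm {md} => [|k IH] m f fm.
  by move=> _ /(_ 1 (dhomog1 _ _)); rewrite mulr1.
move=> kd fg; have sf i : gen u ('X_i * f).
  apply: (IH m.+1); [exact: homogX | by rewrite addnS -addSn |].
  by move=> g gk; rewrite mulrAC mulrC; apply: fg; exact: homogX.
have /(pihomog_mem m) := line f sf.
rewrite raddfB /= linearZ /= pihomog_dE // (pihomog_ne0 _ wd) ?scaler0 ?subr0 //.
by rewrite -kd gtn_eqF // addSn ltnS leq_addl.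
Qed.

End FiniteQuotient.

(** * The graded character *)

Lemma gen_sub (R : comNzRingType) n (f f' : 'I_n -> R) h :
  (forall j, gen f (f' j)) -> gen f' h -> gen f h.
Proof.
have [I0 ID IM] := ideal_gen f.
move=> ff' [a ->]; apply: (big_ind (gen f)) => // j _.
by rewrite mulrC; apply: (IM).
Qed.

Lemma trigonalize (K : numClosedFieldType) n (A : 'M[K]_n) :
  exists2 P, P \in unitmx & forall i j : 'I_n, (i < j)%N -> (P *m A *m invmx P) i j = 0.
Proof.
case: n A => [|n] A; first by exists 1%:M; [exact: unitmx1 | case].
have [P Pu Pt] := Schur A isT; have {}Pu := unitarymx_unit Pu.
by exists P => // i j ij; move: Pt; rewrite /similar_to conjumx // => /is_trig_mxP /(_ _ _ ij).
Qed.

Lemma det_conj (K : fieldType) n (P A : 'M[K]_n) s : P \in unitmx ->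
  \det (1%:M - s *: (P *m A *m invmx P)) = \det (1%:M - s *: A).
Proof.
move=> Pu; have -> : 1%:M - s *: (P *m A *m invmx P) = P *m (1%:M - s *: A) *m invmx P.
  by rewrite mulmxBr mulmx1 mulmxBl mulmxV // -scalemxAr -scalemxAl.
by rewrite !det_mulmx det_inv mulrAC divff ?mul1r // -unitfE -unitmxE.
Qed.

Section ChangeGenerators.
Variables (K : fieldType) (l : nat).
Local Notation S := {mpoly K[l]}.
Variables (f : 'I_l -> S) (P : 'M[K]_l).
Hypothesis Pu : P \in unitmx.

(** Changes generators so that a matrix U of g becomes P U P^-1, to be made triangular. *)
Definition mix j : S := \sum_a (invmx P) a j *: f a.

Lemma mixK a : f a = \sum_j P j a *: mix j.
Proof.
under eq_bigr do rewrite /mix scaler_sumr.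
rewrite exchange_big /=; transitivity (\sum_b (b == a)%:R *: f b).
  rewrite (bigD1 a) //= eqxx scale1r big1 ?addr0 // => b /negbTE ->.
  by rewrite scale0r.
apply: eq_bigr => b _; have := congr1 (fun A : 'M_l => A b a) (mulVmx Pu).
rewrite !mxE => <-; rewrite scaler_suml; apply: eq_bigr => j _.
by rewrite scalerA mulrC.
Qed.

Lemma gen_mix h : gen mix h <-> gen f h.
Proof.
have gsum (I : 'I_l -> S) (c : 'I_l -> K) : gen I (\sum_j c j *: I j).
  by exists (fun j => (c j)%:MP); apply: eq_bigr => j _; rewrite mulrC mul_mpolyC.
split; apply: gen_sub => j; last by rewrite mixK.
exact: gsum.
Qed.

Lemma mix_homog r : (forall j, f j \is r.-homog) -> forall j, mix j \is r.-homog.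
Proof. by move=> fr j; apply: rpred_sum => a _; apply: rpredZ. Qed.

Lemma mix_stable (g : {linear S -> S}) (U : 'M[K]_l) :
  (forall j, g (f j) = \sum_i U i j *: f i) ->
  forall j, g (mix j) = \sum_i (P *m U *m invmx P) i j *: mix i.
Proof.
move=> gf j; rewrite linear_sum /=.
transitivity (\sum_a \sum_b \sum_i (invmx P a j * U b a * P i b) *: mix i).
  apply: eq_bigr => a _; rewrite linearZ /= gf scaler_sumr; apply: eq_bigr => b _.
  by rewrite scalerA {1}mixK scaler_sumr; apply: eq_bigr => i _; rewrite scalerA.
rewrite (eq_bigr _ (fun a _ => exchange_big _ _ _ _ _ _)) exchange_big /=.
apply: eq_bigr => i _; rewrite mxE scaler_suml; apply: eq_bigr => a _.
rewrite -scaler_suml mxE; congr (_ *: _); rewrite mulr_suml; apply: eq_bigr => b _.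
by rewrite mulrC [RHS]mulrAC mulrA.
Qed.

End ChangeGenerators.

(** The denominators are multiplied out, so that s is arbitrary. The matrices become triangular
    separately, each by its own change of generators, and the determinants do not see this. *)
Lemma complete_intersection_character (K : numClosedFieldType) l
    (g : {lrmorphism {mpoly K[l]} -> {mpoly K[l]}})
    (f z : 'I_l -> {mpoly K[l]}) (U U' : 'M[K]_l) r N t M :
  (forall m f, f \is m.-homog -> g f \is m.-homog) ->
  (forall i, f i \is r.-homog) -> (0 < r)%N || (l <= 1)%N ->
  (forall j, g (f j) = \sum_i U i j *: f i) -> (forall i, gen f ('X_i ^+ N)) ->
  (forall i, z i \is 1.-homog) -> (forall i, gen z 'X_i) ->
  (forall j, g (z j) = \sum_i U' i j *: z i) ->
  (forall m, htrace g (gen f) m (t m)) -> (forall m, (M <= m)%N -> t m = 0) ->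
  forall s, (\poly_(m < M) t m).[s] * \det (1%:M - s *: U') = \det (1%:M - s ^+ r *: U).
Proof.
move=> gh fr r1 gf fN z1 zX gz ht tM s.
have [P Pu Pt] := trigonalize U; have [P' Pu' Pt'] := trigonalize U'.
have genE : gen (mix f P) = gen f by apply/funext => h; apply/propext; exact: gen_mix.
have E := complete_intersection_series (g := g) gh (mix_homog P fr) r1 (mix_stable Pu gf) Pt _
  (mix_homog P' z1) _ (mix_stable Pu' gz) Pt' _ tM.
rewrite -(det_conj U _ Pu) -(det_conj U' _ Pu') -(horner_prod_linear r s Pt).
rewrite -{2}[s]expr1 -(horner_prod_linear 1 s Pt') -hornerM; congr (_.[s]); apply: E.
- move=> m k v _; apply: (@koszul_exact_gen _ _ N) => i.
  by rewrite genE.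
- by move=> i; apply/(gen_mix z Pu').
- by move=> m; rewrite genE.
Qed.

(** * The Euler element and the grading *)

Section EulerElement.
Variables (R : realType) (l : nat) (D : cherednik_datum R l).
Local Notation C := R[i].
Local Notation S := {mpoly C[l]}.
Local Notation H := (cherednik D).
Local Notation hc := (hc D).
Local Notation hx := (hx D).
Local Notation hy := (hy D).
Local Notation refl := (fun s : D => complex_reflection (crep D s)).

Lemma hyx_cxy y x : hy y * hx x = hx x * hy y + (hc (pair x y) -
  \sum_(s | refl s) hc (cxy s x y) * hg s).
Proof.
rewrite hyx; congr (_ + (_ - _)); apply: eq_bigr => s rs.
by rewrite cxyE.
Qed.

Lemma sum_hx x : \sum_i hc (pair x (delta_mx i 0)) * hx (delta_mx 0 i) = hx x.
Proof.
rewrite [in RHS](row_sum_delta x) (raddf_sum hx); apply: eq_bigr => i _ /=.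
by rewrite hxZ pair_delta.
Qed.

(** The commutator of sum_i x_i y_i with x is x minus the sum of kap_s (x - s x) s; the reflection
    part of the Euler element is there to cancel this sum. *)
Lemma euler_x x : euler D * hx x = hx x * (euler D + 1).
Proof.
rewrite /euler; set E := \sum_i _; set c0 := hc _.
have -> : \sum_(s | refl s) hc (2 * cparam s / (1 - clam s)) * hg s
  = \sum_(s | refl s) hc (kap s) * hg s :> H by [].
set G := \sum_(s | _) _.
have Ex : E * hx x = hx x * E + hx x - \sum_(s | refl s) hc (kap s) * hx (x - x *m crep D s^-1%g) * hg s.
  rewrite /E mulr_suml mulr_sumr.
  under eq_bigr do rewrite -mulrA hyx_cxy mulrDr mulrBr mulrA (hxx D _ x) -!mulrA.
  rewrite big_split /= -addrA; congr (_ + _); rewrite sumrB; congr (_ - _).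
    by rewrite -[RHS]sum_hx; apply: eq_bigr => i _; rewrite hcC.
  rewrite (eq_bigr (fun i => \sum_(s | refl s) hx (delta_mx 0 i) *
    (hc (cxy s x (delta_mx i 0)) * hg s))) => [|i _]; last by rewrite mulr_sumr.
  rewrite exchange_big; apply: eq_bigr => s _ /=.
  rewrite -sum_hx mulr_sumr mulr_suml; apply: eq_bigr => i _.
  by rewrite mulrA -(hcC (cxy s x _) (hx (delta_mx 0 i))) /cxy hcM -!mulrA.
have Gx : G * hx x = \sum_(s | refl s) hc (kap s) * hx (x *m crep D s^-1%g) * hg s.
  by rewrite mulr_suml; apply: eq_bigr => s _; rewrite -!mulrA hg_x.
have xG : hx x * G = \sum_(s | refl s) hc (kap s) * hx x * hg s.
  by rewrite mulr_sumr; apply: eq_bigr => s _; rewrite mulrA hcC.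
have EG : \sum_(s | refl s) hc (kap s) * hx (x - x *m crep D s^-1%g) * hg s = hx x * G - G * hx x.
  by rewrite xG Gx -sumrB; apply: eq_bigr => s _; rewrite hxB mulrBr mulrBl.
rewrite mulrBl mulrDl Ex EG [RHS]mulrDr mulrBr mulrDr mulr1 -(hcC _ (hx x) : c0 * hx x = hx x * c0).
rewrite opprB; set a := hx x * E; set b := hx x * G; set c := G * hx x; set d := c0 * hx x.
have K : c + (- b + (d - c)) = d - b by rewrite addrA addrC subrKA.
by rewrite -!addrA K; congr (_ + _); rewrite addrC -addrA.
Qed.

Lemma euler_1 : euler D *: poly_std D 1 = hc (lowest_weight D) *: poly_std D 1.
Proof.
have -> : poly_std D 1 = tens (fun (_ : D) (v : C^o) => v) 1 1.
  by rewrite /poly_std -mpolyC1 hpolyC hc1 scale1r.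
set v := tens _ _ _.
rewrite /euler /lowest_weight hcB (raddf_sum hc) !scalerDl !scaleNr scaler_suml big1 ?add0r => [|i _].
  congr (_ - _); rewrite !scaler_suml; apply: eq_bigr => s _.
  by rewrite -scalerA -tens1_act.
by rewrite -scalerA tens1_y scaler0.
Qed.

Lemma euler_homog m f : f \is m.-homog ->
  euler D *: poly_std D f = hc (lowest_weight D + m%:R) *: poly_std D f.
Proof.
pose Q (p : S) m := euler D *: poly_std D p = hc (lowest_weight D + m%:R) *: poly_std D p.
have QX i p k : Q p k -> Q ('X_i * p) k.+1.
  rewrite /Q /poly_std hpoly_mulX => Qp.
  rewrite -scalerA scalerA euler_x -!scalerA scalerDl Qp scale1r.
  rewrite -natr1 addrA (hcD _ _ 1) scalerDl -[hc 1]/(1 : H) scale1r scalerDr.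
  by rewrite [in RHS]scalerA hcC -scalerA.
have Q1 : Q 1 0%N by rewrite /Q addr0 euler_1.
move=> /dhomogP fm; rewrite (mpolyE f) /poly_std (raddf_sum (hpoly D)) !scaler_suml /=.
rewrite !scaler_sumr big_seq [RHS]big_seq; apply: eq_bigr => k /fm /= <-.
suff : Q 'X_[k] (mdeg k).
  rewrite /Q /poly_std => Qk; rewrite hpolyZ -scalerA scalerA -hcC -scalerA Qk.
  by rewrite !scalerA -hcM mulrC hcM.
rewrite mpolyXE_id mdegE; apply: (big_rec2 Q) => // i p q _ Qpq.
elim: (k i) => [|d IH]; first by rewrite mul1r.
by rewrite exprS -mulrA addSn; exact: QX.
Qed.

End EulerElement.

(** * Matrices of operators in a basis of A *)

Section CoordinateMatrices.
Variables (R : realType) (l : nat) (D : cherednik_datum R l).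
Local Notation C := R[i].
Local Notation H := (cherednik D).
Local Notation hc := (hc D).
Variable u : 'I_l -> {mpoly C[l]}.
Local Notation A := (Aquot D u).

Lemma Alin_inj n (e : 'I_n -> A) z z' : Abasis e -> Alin e z = Alin e z' -> z = z'.
Proof. by move=> eb E; have [z0 [_ zU]] := eb (Alin e z); rewrite -(zU z) // (zU z'). Qed.

Lemma AmxE n (e : 'I_n -> A) h j z : Abasis e -> h *: e j = Alin e z ->
  col j (Amx e h) = z.
Proof.
move=> eb E; apply/colP => i; rewrite !mxE; case: xgetP => [z' _ /= E'|/(_ z)]; last first.
  by rewrite /= E.
by rewrite (Alin_inj eb (etrans (esym E) E')).
Qed.

Lemma Alin_delta n (e : 'I_n -> A) j : Alin e (delta_mx j 0) = e j.
Proof.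
rewrite /Alin (bigD1 j) //= mxE !eqxx -[hc 1]/(1 : H) scale1r big1 ?addr0 // => i ij.
by rewrite mxE (negbTE ij) raddf0 scale0r.
Qed.

Lemma Amx_Alin n (e : 'I_n -> A) h z : Abasis e -> h *: Alin e z = Alin e (Amx e h *m z).
Proof.
move=> eb; have -> : Amx e h *m z = \sum_j z j 0 *: col j (Amx e h).
  apply/colP => i; rewrite mxE summxE; apply: eq_bigr => j _.
  by rewrite !mxE mulrC.
rewrite Alin_sum scaler_sumr; apply: eq_bigr => j _.
have [c [Ec _]] := eb (h *: e j).
by rewrite (AmxE eb Ec) -Ec !scalerA hcC.
Qed.

Lemma Abasis_change n k (e : 'I_n -> A) (b : 'I_k -> A) : Abasis e -> Abasis b ->
  exists (P : 'M_(n, k)) (Q : 'M_(k, n)), [/\ P *m Q = 1%:M, Q *m P = 1%:M &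
    forall h, Amx e h = P *m Amx b h *m Q].
Proof.
have key n1 n2 (e1 : 'I_n1 -> A) (e2 : 'I_n2 -> A) : Abasis e1 ->
    exists P : 'M_(n1, n2), forall z, Alin e2 z = Alin e1 (P *m z).
  move=> b1; have /choice [c cE] : forall j, exists z, e2 j = Alin e1 z.
    by move=> j; have [z [Ez _]] := b1 (e2 j); exists z.
  exists (\matrix_(i, j) c j i 0) => z.
  have -> : (\matrix_(i, j) c j i 0) *m z = \sum_j z j 0 *: c j.
    by apply/colP => i; rewrite mxE summxE; apply: eq_bigr => j _; rewrite !mxE mulrC.
  by rewrite Alin_sum; apply: eq_bigr => j _; rewrite cE.
move=> be bb; have [P PE] := key _ _ e b be; have [Q QE] := key _ _ b e bb.
have ext m1 m2 (X Y : 'M[C]_(m1, m2)) : (forall z : 'cV_m2, X *m z = Y *m z) -> X = Y.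
  exact: eq_mulmx_cV.
exists P, Q; split=> [||h]; apply: ext => z.
- by apply: (Alin_inj be); rewrite -mulmxA -PE -QE mul1mx.
- by apply: (Alin_inj bb); rewrite -mulmxA -QE -PE mul1mx.
- by apply: (Alin_inj be); rewrite -!mulmxA -PE -!Amx_Alin // -QE.
Qed.

End CoordinateMatrices.

Section GradedBasis.
Variables (R : realType) (l : nat) (D : cherednik_datum R l) (r : nat).
Local Notation C := R[i].
Local Notation S := {mpoly C[l]}.
Local Notation H := (cherednik D).
Local Notation hc := (hc D).
Variable u : 'I_l -> S.
Hypothesis u_deg : forall j, u j \is r.-homog.
Variable rU : mx_representation C [set: D] l.
Local Notation A := (Aquot D u).
Local Notation Acls := (Acls D u).
Hypothesis Acls_eq0 : forall f, Acls f = 0 <-> gen u f.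
Variable N : nat.
Hypothesis uN : forall i, gen u ('X_i ^+ N).

Lemma Acls_surj (a : A) : exists f, a = Acls f.
Proof.
elim/quotW: a => v; exists (cf0 (theta u rU 0 v : ext S l)).
by rewrite /Defs.Acls poly_stdP.
Qed.

Lemma scale_Aproj h v : h *: Aproj u v = Aproj u (h *: v) :> A.
Proof. exact: qscale_pi. Qed.

Lemma hg_Acls g f : hg g *: Acls f = Acls (gS g f).
Proof. by rewrite scale_Aproj (hg_poly_std u rU). Qed.

Lemma hpoly_Acls f f' : hpoly D f *: Acls f' = Acls (f * f').
Proof. by rewrite scale_Aproj (hpoly_poly_std u rU). Qed.

Lemma euler_Acls m f : f \is m.-homog ->
  euler D *: Acls f = hc (lowest_weight D + m%:R) *: Acls f.
Proof. by move=> fm; rewrite !scale_Aproj (euler_homog _ fm). Qed.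

Variable g : D.
Let M := (l * N).+1.

(** From degree M on the quotient vanishes and the basis is taken empty, so that the union over all
    degrees is finite. *)
Lemma hbasis m : exists n (e : 'I_n -> S) (G : 'M[C]_n),
  [/\ basis_mod (fun f => f \is m.-homog) (gen u) e,
      forall j, gen u (gS g (e j) - lc e (col j G)) & (M <= m)%N -> n = 0%N].
Proof.
case: (leqP M m) => mM; last first.
  have [t [n [e [G [eb eG _]]]]] := htrace_exists (g := gS g) (@gS_homog _ _ D g) m (ideal_gen u).
  by exists n, e, G; split.
exists 0%N, (fun=> 0), 0; split=> // [|[]//]; split=> [[]//|c _|s sm].
  exact: flatmx0.
by exists 0; rewrite /lc big_ord0 subr0; apply: (gen_large uN) sm.
Qed.

(** The weight w is left free: the character takes powers of t, the dimension takes w = 1. *)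
Lemma graded_basis : exists (t : nat -> C) (k : nat) (b : 'I_k -> S) (dg : 'I_k -> nat),
  [/\ forall m, htrace (gS g) (gen u) m (t m), forall m, (M <= m)%N -> t m = 0,
      Abasis (fun j => Acls (b j)), forall j, b j \is (dg j).-homog &
      forall w : nat -> C, \sum_j Amx (fun j => Acls (b j)) (hg g) j j * w (dg j)
        = \sum_(m < M) t m * w m].
Proof.
have [I0 ID IM] := ideal_gen u.
have [n [e [G P]]] : exists (n : nat -> nat) (e : forall m, 'I_(n m) -> S)
    (G : forall m, 'M[C]_(n m)), forall m,
    [/\ basis_mod (fun f => f \is m.-homog) (gen u) (e m),
      forall j, gen u (gS g (e m j) - lc (e m) (col j (G m))) & (M <= m)%N -> n m = 0%N].
  exists (fun m => projT1 (cid (hbasis m))), (fun m => projT1 (cid (projT2 (cid (hbasis m))))),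
    (fun m => projT1 (cid (projT2 (cid (projT2 (cid (hbasis m))))))) => m.
  exact: projT2 (cid (projT2 (cid (projT2 (cid (hbasis m)))))).
pose J : finType := {m : 'I_M & 'I_(n m)}.
pose bJ (p : J) : S := e (tag p) (tagged p).
pose b (j : 'I_#|J|) := bJ (enum_val j).
pose zc (z : 'cV[C]_#|J|) (m : 'I_M) : 'cV[C]_(n m) :=
  \col_i z (enum_rank (Tagged (fun m : 'I_M => 'I_(n m)) i)) 0.
have sumJ (V : nmodType) (F : J -> V) : \sum_(j < #|J|) F (enum_val j)
    = \sum_(m < M) \sum_(i < n m) F (Tagged (fun m : 'I_M => 'I_(n m)) i).
  rewrite -(big_enum_val (A := J) F) /= (sig_big_dep _ (fun _ _ => true) (fun (m : 'I_M) i => F (Tagged (fun m : 'I_M => 'I_(n m)) i))) /=.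
  by apply: eq_bigr => -[m i] _.
have AlinE z : Alin (fun j => Acls (b j)) z = Acls (\sum_(m < M) lc (e m) (zc z m)).
  rewrite /Alin.
  under eq_bigr do rewrite -AclsZ //.
  rewrite -(raddf_sum (Acls : {additive S -> A})); congr Acls.
  pose F (p : J) := z (enum_rank p) 0 *: bJ p.
  transitivity (\sum_(j < #|J|) F (enum_val j)).
    by apply: eq_bigr => j _; rewrite /F enum_valK.
  rewrite (sumJ _ F); apply: eq_bigr => m _; rewrite /lc.
  by apply: eq_bigr => i _; rewrite mxE.
have zcK (c : forall m : 'I_M, 'cV[C]_(n m)) :
    exists z, forall m, zc z m = c m.
  exists (\col_j c (tag (enum_val j)) (tagged (enum_val j)) 0) => m.
  by apply/colP => i; rewrite !mxE enum_rankK.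
have lc_homog m c : lc (e m) c \is m.-homog.
  have [[eW _ _] _ _] := P m.
  by apply: rpred_sum => i _; apply: rpredZ; exact: eW.
have bfree z : gen u (\sum_(m < M) lc (e m) (zc z m)) -> z = 0.
  move=> gz; have zc0 (m : 'I_M) : zc z m = 0.
    have [[_ free _] _ _] := P m; apply: free.
    have /(pihomog_mem u_deg m) := gz.
    rewrite raddf_sum (bigD1 m) //= (pihomog_dE (lc_homog m _)) big1 ?addr0 // => m' m'm.
    by rewrite (pihomog_ne0 _ (lc_homog m' _)).
  apply/colP => j; rewrite mxE -(enum_valK j); case: (enum_val j) => m i.
  by have /colP /(_ i) := zc0 m; rewrite !mxE.
have bspan f : exists z, gen u (f - \sum_(m < M) lc (e m) (zc z m)).
  have cE m : {c | gen u (pihomog mdeg m f - lc (e m) c)}.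
    by apply: cid; have [[_ _ span] _ _] := P m; exact/span/pihomogP.
  pose c m := sval (cE m).
  have cP m : gen u (pihomog mdeg m f - lc (e m) (c m)) := svalP (cE m).
  have [z zE] := zcK (fun m => c m); exists z.
  under eq_bigr do rewrite zE.
  pose K := maxn M (msize f).
  have -> : \sum_(m < M) lc (e m) (c m) = \sum_(m < K) lc (e m) (c m).
    rewrite (big_ord_widen K (fun m => lc (e m) (c m))) ?leq_maxl // big_mkcond /=.
    apply: eq_bigr => m _; case: ltnP => // mM; have [_ _ /(_ mM) n0] := P m.
    rewrite /lc; move: (e m) (c m); rewrite n0 => e' c'; exact/esym/big_ord0.
  have -> : f = \sum_(m < K) pihomog mdeg m f.
    by rewrite -pihomog_partitionE // leq_maxr.
  by rewrite -sumrB; apply: (big_ind (gen u)).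
have bb : Abasis (fun j => Acls (b j)).
  move=> a; have [f ->] := Acls_surj a; have [z zf] := bspan f.
  exists z; split; first by rewrite AlinE; apply/Acls_eq.
  move=> z' Ez'; apply/esym/eqP; rewrite -subr_eq0; apply/eqP/bfree/Acls_eq0.
  rewrite -AlinE -scaleN1r addrC Alin_linear -Ez' AlinE.
  rewrite (raddfN hc) /= -[hc 1]/(1 : H) scaleN1r addrC.
  by apply/eqP; rewrite subr_eq0; apply/eqP/Acls_eq.
exists (fun m => \tr (G m)), #|J|, b, (fun j => nat_of_ord (tag (enum_val j))); split=> // [m|m mM|j|w].
- by have [? ? _] := P m; exists (n m), (e m), (G m).
- have [_ _ /(_ mM) n0] := P m; move: (G m); rewrite n0 => G'; exact: big_ord0.
- by have [[eW _ _] _ _] := P (tag (enum_val j)); exact: eW.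
(* The block diagonal matrix of g. Off the blocks [tagged_as] returns a default value, which the
   boolean factor kills. *)
pose G' (p' p : J) := (tag p' == tag p)%:R * G (tag p) (tagged_as p p') (tagged p).
have diagE j : Amx (fun j => Acls (b j)) (hg g) j j = G' (enum_val j) (enum_val j).
  have := AmxE (h := hg g) (j := j) (z := \col_j' G' (enum_val j') (enum_val j)) bb.
  move=> /(_ _)/colP /(_ j); rewrite !mxE; apply; rewrite hg_Acls AlinE; apply/(Acls_eq Acls_eq0).
  rewrite {1}/b /bJ; case: (enum_val j) => m i /=.
  have zcm m' : zc (\col_j' G' (enum_val j') (Tagged (fun m : 'I_M => 'I_(n m)) i)) m'
      = if m' == m then zc (\col_j' G' (enum_val j') (Tagged (fun m : 'I_M => 'I_(n m)) i)) m' else 0.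
    case: eqP => // /eqP m'm; apply/colP => i'.
    by rewrite !mxE enum_rankK /G' /= (negbTE m'm) mul0r.
  rewrite (bigD1 m) //= big1 ?addr0 => [|m' /negbTE m'm]; last first.
    by rewrite zcm m'm /lc big1 // => i' _; rewrite mxE scale0r.
  have -> : zc (\col_j' G' (enum_val j') (Tagged (fun m : 'I_M => 'I_(n m)) i)) m = col i (G m).
    by apply/colP => i'; rewrite !mxE enum_rankK /G' /= eqxx mul1r tagged_asE.
  by have [_ gG _] := P m; exact: gG.
pose F (p : J) := G' p p * w (tag p).
transitivity (\sum_(j < #|J|) F (enum_val j)).
  by apply: eq_bigr => j _; rewrite diagE.
rewrite (sumJ _ F); apply: eq_bigr => m _; rewrite /mxtrace mulr_suml.
by apply: eq_bigr => i _; rewrite /F /G' eqxx mul1r tagged_asE.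
Qed.

End GradedBasis.

Lemma cpowD (R : realType) (t : R) z m : 0 < t ->
  cpow t (z + m%:R) = cpow t z * t%:C ^+ m.
Proof.
move=> t0; rewrite /cpow.
have -> : complex.Re (z + m%:R) = complex.Re z + m%:R.
  by rewrite raddfD /=; congr (_ + _); rewrite raddfMn.
have -> : complex.Im (z + m%:R) = complex.Im z.
  by rewrite raddfD /= [X in _ + X](_ : _ = 0) ?addr0 // raddfMn /= mul0rn.
rewrite mulrDl expRD rmorphM /= -rmorphXn /=.
by rewrite expRM_natl lnK // [LHS]mulrAC.
Qed.

Section Character.
Variables (R : realType) (l : nat) (D : cherednik_datum R l) (r : nat).
Local Notation C := R[i].
Local Notation S := {mpoly C[l]}.
Local Notation hc := (hc D).
Variable u : 'I_l -> S.
Hypothesis u_free : forall a : 'I_l -> C, \sum_j a j *: u j = 0 -> forall j, a j = 0.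
Hypothesis u_deg : forall j, u j \is r.-homog.
Variable rU : mx_representation C [set: D] l.
Hypothesis gS_u : forall g j, gS g (u j) = \sum_i rU g i j *: u i.
Local Notation A := (Aquot D u).
Local Notation Acls := (Acls D u).
Hypothesis Acls_eq0 : forall f, Acls f = 0 <-> gen u f.
Variables (n : nat) (e : 'I_n -> A).
Hypothesis eb : Abasis e.

(** In degree 0 all u_j are constants, and two constants are dependent. *)
Lemma free_degree : (0 < r)%N || (l <= 1)%N.
Proof.
rewrite lt0n; case: eqP => //= r0; rewrite leqNgt; apply/negP => l2.
have uC j : u j = ((u j)@_0%MM)%:MP.
  by apply/msize1_polyC/dhomog_msize_le; move: (u_deg j); rewrite r0.
pose i0 : 'I_l := Ordinal (ltnW l2); pose i1 : 'I_l := Ordinal l2.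
have i01 : i0 != i1 by [].
have u0 j : u j != 0.
  apply/eqP => uj; suff /u_free /(_ j) /eqP : \sum_i (i == j)%:R *: u i = 0.
    by rewrite eqxx oner_eq0.
  by rewrite big1 // => i _; case: eqP => [->|_]; rewrite ?uj ?scaler0 ?scale0r.
pose a i : C := if i == i0 then (u i1)@_0%MM else if i == i1 then - (u i0)@_0%MM else 0.
have /u_free /(_ i0) : \sum_i a i *: u i = 0.
  rewrite (bigD1 i0) //= (bigD1 i1) 1?eq_sym //= big1 ?addr0 => [|i /andP [/negbTE i0n /negbTE i1n]].
    rewrite /a !eqxx eq_sym (negbTE i01) [u i0 in X in X + _]uC [u i1 in X in _ + X]uC.
    by rewrite -!mul_mpolyC -!mpolyCM mulNr mulrC -mpolyCD subrr.
  by rewrite /a i0n i1n scale0r.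
rewrite /a eqxx.
by move=> u10; have := u0 i1; rewrite uC u10 mpolyC0 eqxx.
Qed.

Lemma gS_X_dual (g : D) j : gS g 'X_j = \sum_i dual_mx g i j *: 'X_i.
Proof. by rewrite gS_X linE; apply: eq_bigr => i _; rewrite !mxE. Qed.

Let uN : forall i, gen u ('X_i ^+ n) := finite_dim_power u_deg Acls_eq0 eb.

Lemma character_formula (g : D) (t : R) : 0 < t ->
  \det (1%:M - t%:C *: dual_mx g) != 0 ->
  exists2 T, is_mxpow t (Amx e (euler D)) T &
    \tr (Amx e (hg g) *m T) =
      cpow t (lowest_weight D) * \det (1%:M - (t ^+ r)%:C *: rU g)
        / \det (1%:M - t%:C *: dual_mx g).
Proof.
move=> t0 dn0.
have [t' [k [b [dg [ht tM bb bdg trw]]]]] := graded_basis u_deg rU Acls_eq0 uN g.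
have [P [Q [PQ QP AE]]] := Abasis_change eb bb.
have nk : k = n by apply/eqP; rewrite eqn_leq (mulmx1_min QP) (mulmx1_min PQ).
subst k.
pose d : 'rV[C]_n := \row_j (lowest_weight D + (dg j)%:R).
have Ed : Amx (fun j => Acls (b j)) (euler D) = diag_mx d.
  apply/matrixP => i j; have := AmxE (h := euler D) (j := j) (z := d 0 j *: delta_mx j 0) bb.
  move=> /(_ _)/colP /(_ i); rewrite !mxE => ->; last first.
    rewrite (euler_Acls _ _ (bdg j)) -[_ *: delta_mx j 0]addr0 Alin_linear Alin_delta Alin0 addr0.
    by [].
  by rewrite eqxx andbT mulr_natr; case: eqP => [->|].
have [Qu _] := mulmx1_unit QP.
have PE : P = invmx Q by rewrite -[LHS]mul1mx -(mulVmx Qu) -mulmxA QP mulmx1.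
exists (P *m diag_mx (map_mx (cpow t) d) *m Q).
  by exists Q, d; split; rewrite ?AE ?Ed ?PE.
rewrite AE -!mulmxA (mulmxA Q) QP mul1mx mxtrace_mulC -!mulmxA QP mulmx1.
have E : (\poly_(m < (l * n).+1) t' m).[t%:C] * \det (1%:M - t%:C *: dual_mx g)
    = \det (1%:M - t%:C ^+ r *: rU g).
  apply: (complete_intersection_character (g := gS g) (@gS_homog _ _ D g) u_deg free_degree
    (gS_u g) uN _ _ (gS_X_dual g) ht tM) => i.
    by rewrite dhomogX; exact/eqP/mdeg1.
  exact: gen_self.
transitivity (\sum_j Amx (fun j => Acls (b j)) (hg g) j j * cpow t (lowest_weight D + (dg j)%:R)).
  apply: eq_bigr => j _; rewrite mxE (bigD1 j) //= !mxE eqxx mulr1n big1 ?addr0 // => i ij.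
  by rewrite !mxE (negbTE ij) mulr0n mulr0.
rewrite (trw (fun m => cpow t (lowest_weight D + m%:R))).
apply: (mulIf dn0); rewrite divfK // rmorphXn /=.
rewrite -E mulrA; congr (_ * _); rewrite horner_poly mulr_sumr.
by apply: eq_bigr => m _; rewrite cpowD // mulrCA.
Qed.

(** At g = 1 the formula for the character has a vanishing denominator at t = 1. The underlying
    polynomial identity is used instead, with (1 - X)^l cancelled before X = 1 is substituted. *)
Lemma dimension_formula : n = (r ^ l)%N.
Proof.
have [t' [k [b [dg [ht tM bb bdg trw]]]]] := graded_basis u_deg rU Acls_eq0 uN 1%g.
have [P [Q [PQ QP AE]]] := Abasis_change eb bb.
have nk : k = n by apply/eqP; rewrite eqn_leq (mulmx1_min QP) (mulmx1_min PQ).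
pose p := \poly_(m < (l * n).+1) t' m.
have E : p * \prod_(i < l) (1 - (1%:M : 'M[C]_l) i i *: 'X) = \prod_(i < l) (1 - (1%:M : 'M[C]_l) i i *: 'X^r).
  have key (f : 'I_l -> S) j : gS (1%g : D) (f j) = \sum_i (1%:M : 'M[C]_l) i j *: f i.
    rewrite gS1 (bigD1 j) //= mxE eqxx scale1r big1 ?addr0 // => i ij.
    by rewrite mxE (negbTE ij) scale0r.
  have trig (i j : 'I_l) : (i < j)%N -> (1%:M : 'M[C]_l) i j = 0.
    by move=> ij; rewrite mxE; case: eqP => // ijE; rewrite ijE ltnn in ij.
  apply: (complete_intersection_series (g := gS (1%g : D)) (@gS_homog _ _ D 1%g) (z := fun i => 'X_i)
     u_deg free_degree (key u) trig _ _ _ (key _) trig ht tM) => [m k' v _|i|i].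
  - exact: (koszul_exact_gen uN).
  - by rewrite dhomogX; exact/eqP/mdeg1.
  - exact: gen_self.
have pE : p = (\sum_(i < r) 'X^i) ^+ l.
  have X1 : (1 - 'X : {poly C}) != 0.
    by rewrite subr_eq0 eq_sym; apply/eqP => /(congr1 (fun q : {poly C} => size q)); rewrite size_polyX size_poly1.
  apply: (mulIf (expf_neq0 l X1)); rewrite -exprMn.
  have -> : (\sum_(i < r) 'X^i) * (1 - 'X) = 1 - 'X^r :> {poly C}.
    by apply: oppr_inj; rewrite -mulrN !opprB subrX1 mulrC.
  move: E; under eq_bigr do rewrite mxE eqxx scale1r.
  by under [X in _ = X -> _]eq_bigr do rewrite mxE eqxx scale1r; rewrite !prodr_const card_ord.
have : p.[1] = (r ^ l)%:R.
  rewrite pE horner_exp horner_sum natrX; congr (_ ^+ _).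
  under eq_bigr do rewrite hornerXn expr1n.
  by rewrite sumr_const card_ord.
rewrite horner_poly; under eq_bigr do rewrite expr1n.
rewrite -(trw (fun=> 1)); under eq_bigr => j _.
  have -> : Amx (fun j => Acls (b j)) (hg (1%g : D)) j j = 1.
    have := AmxE (h := hg (1%g : D)) (j := j) (z := delta_mx j 0) bb.
    by rewrite hg1 scale1r Alin_delta => /(_ (erefl _))/colP /(_ j); rewrite !mxE !eqxx.
  rewrite mulr1; over.
by rewrite sumr_const card_ord nk => /eqP; rewrite eqr_nat => /eqP.
Qed.

End Character.

(** * The sl2-triple attached to an invariant form *)

Section Sl2.
Variables (R : realType) (l : nat) (D : cherednik_datum R l).
Local Notation C := R[i].
Local Notation H := (cherednik D).
Local Notation hc := (hc D).
Local Notation hx := (hx D).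
Local Notation hy := (hy D).
Local Notation refl := (fun s : D => complex_reflection (crep D s)).
Variable B : 'M[C]_l.
Hypotheses (BT : B^T = B) (Bu : B \in unitmx).
Hypothesis B_inv : forall g : D, (crep D g)^T *m B *m crep D g = B.

Definition form (y y' : 'cV[C]_l) : C := (y^T *m B *m y') 0 0.

(** Invariance on v = alpha_s^v gives lambda^-2 (v, v) = (v, v). Moreover (v, v) is nonzero:
    otherwise s y and y have the same product with v, so (y, v) = lambda^-1 (y, v) for all y, and v
    would be in the radical. *)
Lemma clam_orthogonal s : refl s -> clam s = -1.
Proof.
move=> rs; set v := calphav s.
have inv y y' : form (crep D s *m y) (crep D s *m y') = form y y'.
  by rewrite /form trmx_mul -[in RHS](B_inv s) !mulmxA.
have lZ a y y' : form y (a *: y') = a * form y y' by rewrite /form -scalemxAr mxE.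
have rZ a y y' : form (a *: y) y' = a * form y y'.
  by rewrite /form linearZ /= -!scalemxAl mxE.
have Bl y y' z : form (y - y') z = form y z - form y' z.
  by rewrite /form raddfB /= !mulmxBl !mxE.
have l0 := clam_neq0 rs; have l1 := clam_neq1 rs.
have v0 : v != 0.
  by apply: contra_eq_neq (cpair2 rs); rewrite -/v => ->; rewrite pair0r eq_sym pnatr_eq0.
have vv : form v v != 0.
  apply: contra_neq v0 => vv; have yv y : form y v = 0.
    have := inv y v; rewrite (calphavE rs) lZ.
    have -> : crep D s *m y = y - (y - crep D s *m y) by rewrite subKr.
    rewrite (reflect_y rs) Bl rZ vv mulr0 subr0 => /eqP.
    rewrite -subr_eq0 -[X in _ - X]mul1r -mulrBl mulf_eq0 subr_eq0 => /orP [|/eqP //].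
    by rewrite -[1]invr1 (inj_eq invr_inj) (negbTE l1).
  apply: (can_inj (mulKmx Bu)); rewrite mulmx0; apply/colP => i.
  have := yv (delta_mx i 0); rewrite /form trmx_delta -mulmxA -rowE => E.
  by rewrite [RHS]mxE -E !mxE.
have := inv v v; rewrite (calphavE rs) lZ rZ mulrA => /eqP.
rewrite -subr_eq0 -[X in _ - X]mul1r -mulrBl mulf_eq0 (negbTE vv) orbF subr_eq0 -invfM.
rewrite -[1]invr1 (inj_eq invr_inj) -expr2 sqrf_eq1 (negbTE l1) => /eqP ->.
by rewrite invr1.
Qed.

Lemma reflection_sq s : refl s -> crep D s^-1%g *m crep D s^-1%g = 1%:M.
Proof.
move=> rs; have l1 := clam_orthogonal rs.
have two : (2 : C) != 0 by rewrite pnatr_eq0.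
have xG x : x *m crep D s^-1%g = x - pair x (calphav s) *: calpha s.
  have := reflect_x rs x; rewrite l1 opprK -[1 + 1]/(2 : C) divff // mul1r => <-.
  by rewrite subKr.
apply/row_matrixP => i; rewrite !rowE mulmx1 mulmxA (xG (delta_mx 0 i)) mulmxBl (xG (delta_mx 0 i)) -scalemxAl calphaE //.
by rewrite l1 scaleN1r scalerN opprK subrK.
Qed.

Lemma reflection_form s : refl s -> (crep D s^-1%g)^T *m B = B *m crep D s^-1%g.
Proof.
move=> rs; rewrite -[in RHS](B_inv s^-1%g) -[RHS]mulmxA reflection_sq //.
by rewrite mulmx1.
Qed.

(** The quadratic form B on h, and below its inverse on the dual, both without the usual factor 1/2;
    hence the constant 4 in [F_Eop]. *)
Definition Eop : H := \sum_i hx (row i B) * hx (delta_mx 0 i).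
Definition Fop : H := \sum_i hy (col i (invmx B)) * hy (delta_mx i 0).

Lemma sum_hx_row (A : 'M[C]_l) (y : 'cV[C]_l) : \sum_i hc (y i 0) * hx (row i A) = hx (y^T *m A).
Proof.
rewrite mulmx_sum_row (raddf_sum hx); apply: eq_bigr => i _ /=.
by rewrite hxZ mxE.
Qed.

Lemma sum_hx_delta (x : 'rV[C]_l) : \sum_i hc (x 0 i) * hx (delta_mx 0 i) = hx x.
Proof. by rewrite [in RHS](row_sum_delta x) (raddf_sum hx); apply: eq_bigr => i _; rewrite /= hxZ. Qed.

Lemma y_Eop y : hy y * Eop = Eop * hy y + hc 2 * hx (y^T *m B).
Proof.
pose Y x : H := hc (pair x y) - \sum_(s | refl s) hc (cxy s x y) * hg s.
have term (b e : 'rV[C]_l) : hy y * (hx b * hx e) = hx b * hx e * hy y + (Y b * hx e + hx b * Y e).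
  by rewrite mulrA hyx_cxy mulrDl -mulrA hyx_cxy mulrDr mulrA -addrA [X in _ + X]addrC.
have Yl b e : Y b * hx e = hc (pair b y) * hx e
    - \sum_(s | refl s) hc (cxy s b y) * hx (e *m crep D s^-1%g) * hg s.
  rewrite /Y mulrBl mulr_suml; congr (_ - _); apply: eq_bigr => s _.
  by rewrite -!mulrA hg_x.
have Yr b e : hx b * Y e = hc (pair e y) * hx b - \sum_(s | refl s) hc (cxy s e y) * hx b * hg s.
  rewrite /Y mulrBr mulr_sumr -(hcC _ (hx b)); congr (_ - _); apply: eq_bigr => s _.
  by rewrite mulrA -(hcC _ (hx b)).
rewrite /Eop mulr_sumr mulr_suml; under eq_bigr do rewrite term Yl Yr.
rewrite big_split /=; congr (_ + _); rewrite big_split /= !sumrB.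
have yB : y^T *m B = (B *m y)^T by rewrite trmx_mul BT.
have -> : \sum_i hc (pair (row i B) y) * hx (delta_mx 0 i) = hx (y^T *m B).
  rewrite yB -[RHS]sum_hx_delta; apply: eq_bigr => i _; congr (hc _ * _).
  by rewrite /pair -row_mul !mxE.
have -> : \sum_i hc (pair (delta_mx 0 i) y) * hx (row i B) = hx (y^T *m B).
  rewrite -[RHS]sum_hx_row; apply: eq_bigr => i _; congr (hc _ * _).
  by rewrite /pair -rowE !mxE.
(* For each s the two reflection terms add up to a multiple of B (1 - s) (1 + s), which is zero
   since s is an involution, self-adjoint for B. *)
suff E0 : \sum_i \sum_(s | refl s) hc (cxy s (row i B) y) * hx (delta_mx 0 i *m crep D s^-1%g) * hg s
    + \sum_i \sum_(s | refl s) hc (cxy s (delta_mx 0 i) y) * hx (row i B) * hg s = 0.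
  move/eqP: E0; rewrite addr_eq0 => /eqP ->; rewrite opprK addrACA subrr addr0.
  by rewrite -[2]/(1 + 1) hcD mulrDl -[hc 1]/(1 : H) mul1r.
rewrite exchange_big [X in _ + X]exchange_big -big_split big1 //= => s rs.
rewrite -!mulr_suml -mulrDl; set G := crep D s^-1%g.
have -> : \sum_i hc (cxy s (row i B) y) * hx (delta_mx 0 i *m G)
    = hx ((kap s *: (B *m (y - G *m y)))^T *m G).
  rewrite -sum_hx_row; apply: eq_bigr => i _; rewrite -rowE /cxy -/G.
  by rewrite pairBl pair_mul -pairBr mxE /pair -row_mul !mxE.
have -> : \sum_i hc (cxy s (delta_mx 0 i) y) * hx (row i B)
    = hx ((kap s *: (y - G *m y))^T *m B).
  rewrite -sum_hx_row; apply: eq_bigr => i _; rewrite /cxy -/G.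
  by rewrite pairBl pair_mul -pairBr mxE /pair -rowE !mxE.
rewrite -hxD (_ : _ + _ = 0) ?raddf0 ?mul0r //.
rewrite !linearZ /= -!scalemxAl -scalerDr trmx_mul BT -[_ *m B *m G]mulmxA -mulmxDr.
have -> : y - G *m y = (1%:M - G) *m y by rewrite mulmxBl mul1mx.
rewrite trmx_mul raddfB /= trmx1 -mulmxA mulmxDr mulmxBl mul1mx mulmxBl mul1mx.
rewrite mulmxA reflection_form // -mulmxA reflection_sq // mulmx1.
by rewrite addrC subrKA subrr mulmx0 scaler0.
Qed.

Lemma sum_hx_hy : \sum_i hx (row i B) * hy (col i (invmx B)) = \sum_i hx (delta_mx 0 i) * hy (delta_mx i 0).
Proof.
have colE' i : hy (col i (invmx B)) = \sum_k hc (invmx B k i) * hy (delta_mx k 0).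
  rewrite [col i _](_ : _ = \sum_k invmx B k i *: delta_mx k 0); last first.
    rewrite [LHS]matrix_sum_delta; apply: eq_bigr => k _.
    by rewrite big_ord1 mxE.
  by rewrite (raddf_sum hy); apply: eq_bigr => k _; rewrite /= hyZ.
under eq_bigr do rewrite colE' mulr_sumr.
rewrite exchange_big; apply: eq_bigr => k _ /=.
under eq_bigr do rewrite mulrA -(hcC _ (hx _)).
rewrite -mulr_suml; congr (_ * _).
rewrite (eq_bigr (fun i => hc ((row k (invmx B))^T i 0) * hx (row i B))) => [|i _]; last by rewrite !mxE.
by rewrite sum_hx_row trmxK -row_mul mulVmx // rowE mulmx1.
Qed.

(** Applying [y_Eop] twice leaves constant terms which are traces: l from the pairing, and kap_s tr
    (1 - s^-1) = 2 kap_s for each reflection. They are the matching terms of the Euler element. *)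
Lemma F_Eop : Fop * Eop = Eop * Fop + hc 4 * euler D.
Proof.
have pairBQ (A : 'M[C]_l) i : pair (row i B *m A) (col i (invmx B)) = (B *m A *m invmx B) i i.
  by rewrite /pair -row_mul colE mulmxA -row_mul -colE !mxE.
have term i : hy (col i (invmx B)) * hy (delta_mx i 0) * Eop
    = Eop * (hy (col i (invmx B)) * hy (delta_mx i 0))
      + hc 2 * (hx (delta_mx 0 i) * hy (delta_mx i 0))
      + hc 2 * (hx (row i B) * hy (col i (invmx B)) + (hc (pair (row i B) (col i (invmx B)))
        - \sum_(s | refl s) hc (cxy s (row i B) (col i (invmx B))) * hg s)).
  rewrite -hyx_cxy -mulrA y_Eop mulrDr mulrA y_Eop mulrDl -!mulrA; congr (_ + _ * _ + _).
    congr (hx _ * _); rewrite tr_col trmx_inv BT -row_mul mulVmx // rowE mulmx1.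
    by [].
  by rewrite mulrA -hcC -mulrA trmx_delta -rowE.
rewrite /Fop mulr_suml; under eq_bigr do rewrite term.
rewrite !big_split /= -mulr_sumr -addrA; congr (_ + _).
rewrite -!mulr_sumr !big_split /= sum_hx_hy sumrN.
rewrite -(raddf_sum hc) /= exchange_big /=.
have -> : \sum_i pair (row i B) (col i (invmx B)) = l%:R.
  rewrite -(mxtrace1 C l) -(mulmxV Bu); apply: eq_bigr => i _.
  by have := pairBQ 1%:M i; rewrite !mulmx1.
have -> : \sum_(s | refl s) \sum_i hc (cxy s (row i B) (col i (invmx B))) * hg s
    = \sum_(s | refl s) hc 2 * (hc (kap s) * hg s).
  apply: eq_bigr => s rs; rewrite -mulr_suml -(raddf_sum hc) /= mulrA -hcM; congr (hc _ * _).
  transitivity (kap s * \tr (B *m (1%:M - crep D s^-1%g) *m invmx B)).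
    rewrite mulr_sumr; apply: eq_bigr => i _; rewrite /cxy; congr (_ * _).
    by rewrite -pairBQ mulmxBr mulmx1.
  rewrite mxtrace_mulC mulmxA mulVmx // mul1mx trace_reflection // clam_orthogonal // opprK.
  by rewrite mulrC.
rewrite -mulr_sumr /euler.
have -> : \sum_(s | refl s) hc (2 * cparam s / (1 - clam s)) * hg s = \sum_(s | refl s) hc (kap s) * hg s :> H by [].
set X := \sum_i _; set K := \sum_(s | _) _.
have -> : hc l%:R = hc 2 * hc (l%:R / 2) by rewrite -hcM mulrC divfK // pnatr_eq0.
have -> : hc 4 = hc 2 * hc 2 by rewrite -hcM -natrM.
rewrite -mulrDr -mulrA; congr (_ * _).
have X2 : X + X = hc 2 * X by rewrite -[2]/(1 + 1) hcD -[hc 1]/(1 : H) mulrDl mul1r.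
by rewrite mulrBr mulrDr -X2 -!addrA.
Qed.

End Sl2.

(** * Irreducibility *)

Section Irreducible.
Variables (R : realType) (l : nat) (D : cherednik_datum R l).
Local Notation C := R[i].
Local Notation S := {mpoly C[l]}.
Local Notation H := (cherednik D).
Local Notation hc := (hc D).
Local Notation hx := (hx D).
Local Notation hy := (hy D).
Variable u : 'I_l -> S.
Variable rU : mx_representation C [set: D] l.
Local Notation A := (Aquot D u).
Local Notation Acls := (Acls D u).
Hypothesis Acls_eq0 : forall f, Acls f = 0 <-> gen u f.
Implicit Types (a b : A).

Lemma hx_Acls x f : hx x *: Acls f = Acls (lin x * f).
Proof. by rewrite scale_Aproj (hx_poly_std u rU). Qed.

Lemma hy_Acls y (f : S) : hy y *: Acls f = Acls (cf0 (yM rU y (vac l f))).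
Proof.
rewrite scale_Aproj /Defs.Acls; congr Aproj.
rewrite -[LHS](poly_stdP (u := u) (rU := rU)); congr (poly_std D (cf0 _)).
by rewrite (linearZ_LR (theta u rU 0)) /= theta_poly dunkl_y.
Qed.

Lemma vals_vac n (P : S -> Prop) f : P 0 -> P f -> vals P (vac n f : ext S n).
Proof. by move=> P0 Pf; elim: n => //= n IH; split=> //; exact: vals_0. Qed.

Lemma cf0_emap n (F : S -> S) (z : ext S n) : cf0 (emap F z) = F (cf0 z).
Proof. by elim: n z => //= n IH z; exact: IH. Qed.

Lemma Acomp0 m : Acomp m (0 : A).
Proof. by exists 0; [exact: dhomog0 | apply/esym/Acls_eq0; case: (ideal_gen u)]. Qed.

Lemma AcompD m a b : Acomp m a -> Acomp m b -> Acomp m (a + b).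
Proof.
move=> [f fm ->] [h hm ->]; exists (f + h); first exact: rpredD.
by have := AclsP D u 1 f h; rewrite scale1r -[hc 1]/(1 : H) scale1r.
Qed.

Lemma Acomp_sum m (I : finType) (F : I -> A) : (forall i, Acomp m (F i)) -> Acomp m (\sum_i F i).
Proof. by move=> FP; apply: (big_ind (Acomp m)) => // [|a b]; [exact: Acomp0 | exact: AcompD]. Qed.

Lemma hx_Acomp x m a : Acomp m a -> Acomp m.+1 (hx x *: a).
Proof.
move=> [f fm ->]; rewrite hx_Acls; exists (lin x * f) => //.
by rewrite -add1n; apply: dhomogM => //; exact: lin_homog.
Qed.

Lemma hy_Acomp y m a : Acomp m.+1 a -> Acomp m (hy y *: a).
Proof.
move=> [f fm ->]; rewrite hy_Acls; exists (cf0 (yM rU y (vac l f))) => //.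
have fh : vals (fun f : S => f \is m.+1.-homog) (vac l f).
  by apply: vals_vac => //; exact: dhomog0.
by rewrite -(yM_homog rU y fh) cf0_emap; exact: pihomogP.
Qed.

Lemma hy_Acomp0 y a : Acomp 0 a -> hy y *: a = 0.
Proof.
move=> [f fm ->]; rewrite hy_Acls yM_dhomog0 ?raddf0 //.
by apply: vals_vac => //; exact: dhomog0.
Qed.

Variable B : 'M[C]_l.
Hypotheses (BT : B^T = B) (Bu : B \in unitmx).
Hypothesis B_inv : forall g : D, (crep D g)^T *m B *m crep D g = B.
Local Notation E := (Eop D B).
Local Notation F := (Fop D B).
Local Notation h0 := (lowest_weight D).

Lemma E_Acomp m a : Acomp m a -> Acomp m.+2 (E *: a).
Proof.
move=> am; rewrite /Eop scaler_suml; apply: Acomp_sum => i.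
by rewrite -scalerA; do 2!apply: hx_Acomp.
Qed.

Lemma F_Acomp m a : Acomp m.+2 a -> Acomp m (F *: a).
Proof.
move=> am; rewrite /Fop scaler_suml; apply: Acomp_sum => i.
by rewrite -scalerA; do 2!apply: hy_Acomp.
Qed.

Lemma F_Acomp_lt m a : (m < 2)%N -> Acomp m a -> F *: a = 0.
Proof.
move=> m2 am; rewrite /Fop scaler_suml big1 // => i _; rewrite -scalerA.
case: m am m2 => [|[|//]] am _; first by rewrite (hy_Acomp0 _ am) scaler0.
by rewrite (hy_Acomp0 _ (hy_Acomp _ am)).
Qed.

Lemma FE_Acomp m a : Acomp m a ->
  F *: (E *: a) = E *: (F *: a) + hc (4 * (h0 + m%:R)) *: a.
Proof.
move=> [f fm ->]; rewrite !scalerA F_Eop // scalerDl hcM -[RHS]scalerDl.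
by rewrite !scalerDl -!scalerA (euler_Acls D u fm).
Qed.

Lemma hc_inj0 z a : a <> 0 -> hc z *: a = 0 -> z = 0.
Proof.
move=> a0 za; apply/eqP; apply: contrapT => /negP z0; apply: a0.
by rewrite -[a]scale1r -[1]/(hc 1) -(mulVf z0) hcM -scalerA za scaler0.
Qed.

Lemma Acls1_Acomp : Acomp 0 (Acls 1).
Proof. by exists 1 => //; exact: dhomog1. Qed.

Lemma iterE_Acomp j : Acomp (2 * j) (iter j (fun a => E *: a) (Acls 1)).
Proof.
elim: j => [|j IH]; first exact: Acls1_Acomp.
by rewrite mulnS; exact: E_Acomp.
Qed.

(** The constant is the sum of 4 (h0 + 2 i) for 0 <= i <= j, the weights met along the E-string. *)
Lemma F_iterE j : F *: iter j.+1 (fun a => E *: a) (Acls 1)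
  = hc (4 * j.+1%:R * (h0 + j%:R)) *: iter j (fun a => E *: a) (Acls 1).
Proof.
elim: j => [|j IH].
  by rewrite /= (FE_Acomp Acls1_Acomp) (F_Acomp_lt _ Acls1_Acomp) // scaler0 add0r mulr1.
rewrite iterS (FE_Acomp (iterE_Acomp j.+1)) IH scalerA -hcC -scalerA -iterS -scalerDl -hcD.
congr (hc _ *: _); ring.
Qed.

(** For E^j 1 the last nonzero vector of the string, [F_iterE] at j reads 0 = 4 (j + 1) (h0 + j) E^j
    1. *)
Lemma lowest_weight_exists d : (forall m a, (d < m)%N -> Acomp m a -> a = 0) -> Acls 1 <> 0 ->
  exists j, [/\ h0 = - j%:R & (2 * j <= d)%N].
Proof.
move=> top one0; pose P j := `[< iter j.+1 (fun a => E *: a) (Acls 1) = 0 >].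
have Pex : exists j, P j.
  exists d; apply/asboolP/(top _ _ _ (iterE_Acomp d.+1)).
  by rewrite mulnS addSn ltnS (leq_trans (leq_pmull d (isT : 0 < 2)%N)) // leq_addl.
case: (ex_minnP Pex) => j /asboolP Ej jmin.
have nj : iter j (fun a => E *: a) (Acls 1) <> 0.
  case: j jmin {Ej} => [|j] jmin // Ej; have := jmin j; rewrite ltnn => /(_ _) H'.
  by have : false by apply: H'; apply/asboolP.
exists j; split.
  have := F_iterE j; rewrite Ej scaler0 => /esym /(hc_inj0 nj) /eqP.
  rewrite !mulf_eq0 !pnatr_eq0 /= addr_eq0 => /eqP.
  by [].
rewrite leqNgt; apply/negP => dj; apply: nj; exact: top (iterE_Acomp j).
Qed.

Section TopDegree.
Variables (d : nat) (w : A).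
Hypotheses (wd : Acomp d w) (w0 : w <> 0).
Hypothesis top : forall m a, (d < m)%N -> Acomp m a -> a = 0.
Local Notation W i := (iter i (fun a => F *: a) w).

Lemma iterF_Acomp i : ((2 * i <= d)%N -> Acomp (d - 2 * i) (W i)) /\ ((d < 2 * i)%N -> W i = 0).
Proof.
elim: i => [|i [IH1 IH2]]; first by rewrite muln0 subn0.
rewrite iterS; case: (ltnP d (2 * i)) => di.
  by rewrite IH2 // scaler0; split=> // _; exact: Acomp0.
have {}IH1 := IH1 di; rewrite mulnS; split=> [di2|di2].
  apply: F_Acomp; have -> : (d - (2 + 2 * i)).+2 = (d - 2 * i)%N by lia.
  exact: IH1.
by apply: F_Acomp_lt IH1; lia.
Qed.

(** The constant is minus the sum of 4 (h0 + d - 2 k) for 0 <= k <= i, the weights met along the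
    F-string. *)
Lemma E_iterF i : E *: W i.+1 = hc (- (4 * i.+1%:R * (h0 + d%:R - i%:R))) *: W i.
Proof.
elim: i => [|i IH].
  have := FE_Acomp wd; rewrite (top _ (E_Acomp wd)) 1?ltnW // scaler0.
  move=> /esym /eqP; rewrite addr_eq0 => /eqP ->.
  by rewrite -scaleNr -(raddfN hc) /= mulr1 subr0.
have [W1 W2] := iterF_Acomp i.+1; case: (ltnP d (2 * i.+1)) => di.
  by rewrite iterS W2 // !scaler0.
have := FE_Acomp (W1 di); rewrite IH scalerA -hcC -scalerA -iterS => E1.
have -> : E *: W i.+2 = hc (- (4 * i.+1%:R * (h0 + d%:R - i%:R))) *: W i.+1
    - hc (4 * (h0 + (d - 2 * i.+1)%:R)) *: W i.+1 by rewrite E1 addrK.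
rewrite -scalerBl -hcB; congr (hc _ *: _); rewrite natrB //; ring.
Qed.

(** With h0 = - j the constant of [E_iterF] is nonzero for i < d - j, so F^(d - j) w is nonzero. Its
    existence forces 2 (d - j) <= d, which together with 2 j <= d leaves degree 0. *)
Lemma lowest_vector : Acls 1 <> 0 -> exists i, W i <> 0 /\ Acomp 0 (W i).
Proof.
move=> one0; have [j [h0j jd]] := lowest_weight_exists top one0.
have Wn0 i : (i <= d - j)%N -> W i <> 0.
  elim: i => [_|i IH id] //= Wi0; apply: (IH (ltnW id)).
  have := E_iterF i; rewrite /= Wi0 scaler0 => /esym; apply: contraPP => Wi /(hc_inj0 Wi) /eqP.
  have -> : h0 + d%:R - i%:R = (d - j - i)%:R.
    by rewrite natrB 1?ltnW // natrB ?h0j; [ring | lia].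
  by rewrite oppr_eq0 !mulf_eq0 !pnatr_eq0 /= subn_eq0 leqNgt id.
have [W1 W2] := iterF_Acomp (d - j).
have dj : (2 * (d - j) <= d)%N by rewrite leqNgt; apply/negP => /W2; exact: Wn0.
exists (d - j)%N; split; first exact: Wn0.
have -> : 0%N = (d - 2 * (d - j))%N by apply/esym/eqP; rewrite subn_eq0; lia.
exact: W1.
Qed.

End TopDegree.

Lemma irreducible_holds : frobenius D u -> irreducible D u.
Proof.
move=> [d [[w [wd w0 wline]] top nondeg]].
have [I0 ID IM] := ideal_gen u.
split; first by exists w.
move=> N N0 ND NH; case: (pselect (exists2 a, N a & a <> 0)) => [[a Na a0]|nN]; last first.
  by left=> a Na; apply: contrapT => a0; apply: nN; exists a.
right; have [f fE] := Acls_surj rU a; rewrite {}fE in Na a0.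
have nf : ~ gen u f by move/Acls_eq0.
(* The multiplier is found from the lowest degree k in which f is nonzero modulo (u). *)
pose P k := `[< ~ gen u (pihomog mdeg k f) >].
have Pex : exists k, P k.
  apply: contrapT => nP; apply: nf; rewrite (pihomog_partitionE (leqnn (msize f))).
  apply: (big_ind (gen u)) => // k _; apply: contrapT => kf; apply: nP.
  by exists k; apply/asboolP.
case: (ex_minnP Pex) => k /asboolP nk kmin.
have fk : pihomog mdeg k f \is k.-homog by exact: pihomogP.
have kd : (k <= d)%N.
  rewrite leqNgt; apply/negP => dk; apply/nk/Acls_eq0/(top k) => //.
  by exists (pihomog mdeg k f).
have [g gh gn] : exists2 g, g \is (d - k).-homog & Acls (pihomog mdeg k f * g) <> 0.
  apply: contrapT => ng; apply/nk/Acls_eq0/(nondeg k) => // g gh.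
  by apply: contrapT => gn; apply: ng; exists g.
(* Components of f below degree k lie in (u); those above it land beyond the top degree d after
   multiplication by g. *)
have gfE : Acls (g * f) = Acls (pihomog mdeg k f * g).
  apply/(Acls_eq Acls_eq0).
  have -> : g * f - pihomog mdeg k f * g = g * (f - pihomog mdeg k f).
    by rewrite mulrBr [g * pihomog _ _ _]mulrC.
  pose K := maxn (msize f) k.+1.
  have fK : (msize f <= K)%N by rewrite leq_maxl.
  have kK : (k < K)%N by rewrite leq_maxr.
  rewrite {1}(pihomog_partitionE fK) (bigD1 (Ordinal kK)) //= [X in X - _]addrC addrK mulr_sumr.
  apply: (big_ind (gen u)) => // k' k'k.
  case: (ltngtP k' k) => kk'.
  - apply: (IM); apply: contrapT => nk'; have := kmin k'; rewrite leqNgt kk'.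
    by move=> /(_ _)/negP; apply=> //; apply/asboolP.
  - apply/Acls_eq0/(top (d - k + k')%N); first by rewrite -ltn_subLR; lia.
    by exists (g * pihomog mdeg k' f) => //; apply: dhomogM => //; exact: pihomogP.
  - by case/eqP: k'k; apply: val_inj.
have Nw : N w.
  have : N (Acls (g * f)) by rewrite -(hpoly_Acls u rU); exact: NH.
  rewrite gfE; have [|z zE] := wline (Acls (pihomog mdeg k f * g)).
    by exists (pihomog mdeg k f * g) => //; rewrite -(subnKC kd); exact: dhomogM.
  rewrite zE; have z0 : z != 0.
    by apply/eqP => z0; apply: gn; rewrite zE z0 (raddf0 hc) scale0r.
  by move/(NH (hc z^-1)); rewrite scalerA -hcM mulVf // -[hc 1]/(1 : H) scale1r.
have one0 : Acls 1 <> 0.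
  move=> /Acls_eq0 g1; apply: nf; rewrite -[f]mulr1; exact: IM.
have [i [Wi0 Wi]] := lowest_vector wd w0 top one0.
have NW : N (iter i (fun a => F *: a) w).
  by elim: i {Wi0 Wi} => //= i IH; exact: NH.
(* The end of the F-string is the class of a nonzero constant, so N contains the generator 1. *)
have [c c0 cE] := Wi; have cC : c = (c@_0%MM)%:MP by apply/msize1_polyC/dhomog_msize_le.
have N1 : N (Acls 1).
  have cn : c@_0%MM != 0.
    apply/eqP => c00; apply: Wi0; rewrite cE cC c00 mpolyC0.
    exact/Acls_eq0.
  move: NW; rewrite cE cC -[_%:MP]mulr1 mul_mpolyC (AclsZ Acls_eq0).
  by move/(NH (hc (c@_0%MM)^-1)); rewrite scalerA -hcM mulVf // -[hc 1]/(1 : H) scale1r.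
move=> b; have [h ->] := Acls_surj rU b.
by rewrite -[h]mulr1 -(hpoly_Acls u rU); exact: NH.
Qed.

End Irreducible.

Theorem theorem3p45 (R : realType) (l : nat) (D : cherednik_datum R l) (r : nat)
    (* U is the span of u, and rU is the matrix form of the G-action on U *)
    (u : 'I_l -> {mpoly R[i][l]})
    (u_free : forall a : 'I_l -> R[i],
       \sum_(j < l) a j *: u j = 0 -> forall j, a j = 0)
    (u_deg : forall j, u j \is r.-homog)
    (rU : mx_representation R[i] [set: D] l)
    (u_stable : forall (g : D) (j : 'I_l),
       hg g *: poly_std D (u j) = poly_std D (\sum_(i < l) rU g i j *: u i))
    (u_singular : forall (y : 'cV[R[i]]_l) (j : 'I_l),
       hy D y *: poly_std D (u j) = 0)
    (* A is finite-dimensional *)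
    (n : nat) (e : 'I_n -> Aquot D u) (e_basis : Abasis e) :
  [/\ (0 < r)%N -> frobenius D u,
      bgg_resolution u rU,
      forall (g : D) (t : R), 0 < t ->
        \det (1%:M - t%:C *: dual_mx g) != 0 ->
        exists2 T, is_mxpow t (Amx e (euler D)) T &
          \tr (Amx e (hg g) *m T) =
            cpow t (lowest_weight D) * \det (1%:M - (t ^+ r)%:C *: rU g)
              / \det (1%:M - t%:C *: dual_mx g),
      n = (r ^ l)%N
    & preserves_inner_product D -> (0 < r)%N -> irreducible D u].

Proof.
have uS := gS_u u_stable.
have A0 f : Acls D u f = 0 <-> gen u f := Acls_eq0 u_stable u_singular f.
have uN := finite_dim_power u_deg A0 e_basis.
have u_exact : koszul_exact u by exact: koszul_exact_gen uN.
split.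
- by move=> r0; exact: (frobenius_holds u_deg A0 r0 uN).
- exact: (bgg_resolution_holds u_deg u_stable u_singular u_exact).
- exact: (character_formula u_free u_deg uS A0 e_basis).
- exact: (dimension_formula u_free u_deg rU A0 e_basis).
- move=> [B [BT Bu B_inv]] r0.
  exact: (irreducible_holds rU A0 BT Bu B_inv (frobenius_holds u_deg A0 r0 uN)).
Qed.
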